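(* Fix $\alpha$ with $0<\alpha<1$, let $m=\lfloor\alpha n\rfloor$, and let $F(z)=p_n(z)+\overline{q_m(z)}$ be a random harmonic polynomial sampled from the truncated model. Let $N_+$ be the number of zeros of $F$ in $\mathbb{C}$ at which $F$ is orientation-preserving and $N_-$ the number of zeros of $F$ in $\mathbb{C}$ at which $F$ is orientation-reversing. Then, as $n\to\infty$, $$\mathbb{E} N_+ \sim \mathbb{E} N_- \sim \frac{c_\alpha}{2}\, n^{3/2},$$ where $$c_\alpha = \frac12\left( \arctan\left(\sqrt{\frac{\alpha}{1-\alpha}}\right) - \sqrt{\alpha(1-\alpha)} \right).$$
   Context: Truncated model: for positive integers $m\le n$, $$p_n(z)=\sum_{k=0}^n a_k z^k,\qquad q_m(z)=\sum_{k=0}^m b_k z^k,$$ where $a_0,\dots,a_n,b_0,\dots,b_m$ are independent centered (circularly symmetric) complex Gaussian random variables with $\mathbb{E}\, a_j\overline{a_k}=\delta_{jk}\binom{n}{j}$ and $\mathbb{E}\, b_j\overline{b_k}=\delta_{jk}\binom{n}{j}$ (so both variances use $\binom{n}{\cdot}$). Thus each coefficient of variance $\sigma^2$ has independent real and imaginary parts, each $N(0,\sigma^2/2)$. The Jacobian determinant of $F=p_n+\overline{q_m}$, viewed as a map $\mathbb{R}^2\to\mathbb{R}^2$, is $J_F(z)=|p_n'(z)|^2-|q_m'(z)|^2$. $F$ is orientation-preserving at $z$ if $J_F(z)>0$ and orientation-reversing at $z$ if $J_F(z)<0$. The notation $A_n\sim B_n$ means $A_n/B_n\to1$ as $n\to\infty$.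 *)

(* Defs.v *)
From HB Require Import structures.
From mathcomp Require Import all_boot all_order all_algebra.
From mathcomp Require Import all_classical all_reals all_analysis.
From mathcomp Require Import complex ring.

Set Implicit Arguments.
Unset Strict Implicit.
Unset Printing Implicit Defensive.

Import Order.TTheory GRing.Theory Num.Theory.
Import numFieldNormedType.Exports.

Local Open Scope classical_set_scope.
Local Open Scope ring_scope.
Local Open Scope complex_scope.

Section HarmonicPolynomials.
Context {R : realType}.

Definition harmonic_fun (p q : {poly R[i]}) (z : R[i]) : R[i] :=
  p.[z] + (q.[z])^*.

Definition row_of_complex (z : R[i]) : 'rV[R]_2 :=
  \row_j (if j == 0 then complex.Re z else complex.Im z).

Definition complex_of_row (v : 'rV[R]_2) : R[i] := v 0 0 +i* v 0 1.

Definition plane_map (F : R[i] -> R[i]) : 'rV[R]_2 -> 'rV[R]_2 :=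
  row_of_complex \o F \o complex_of_row.

(* [jacobian] acts on row vectors, so it is the transpose of the usual matrix
   of partial derivatives. *)
Definition jacobian_det (F : R[i] -> R[i]) (z : R[i]) : R :=
  \det (jacobian (plane_map F) (row_of_complex z)).

Definition orientation_preserving_at (F : R[i] -> R[i]) (z : R[i]) : Prop :=
  0 < jacobian_det F z.

Definition orientation_reversing_at (F : R[i] -> R[i]) (z : R[i]) : Prop :=
  jacobian_det F z < 0.

(* [counting] is valued in [\bar R]; it is [+oo] on infinite sets. *)
Definition num_zeros_preserving (F : R[i] -> R[i]) : \bar R :=
  counting [set z | F z = 0 /\ orientation_preserving_at F z].

Definition num_zeros_reversing (F : R[i] -> R[i]) : \bar R :=
  counting [set z | F z = 0 /\ orientation_reversing_at F z].

End HarmonicPolynomials.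

Section Jacobian.
Context {R : realType}.
Implicit Types (p q : {poly R[i]}) (z : R[i]) (v w : 'rV[R]_2).

Let is_diff_coord v (j : 'I_2) :
  is_diff v (fun w => w 0 j : R) (fun w => w 0 j : R).
Proof.
apply: DiffDef; first exact: differentiable_coord.
have lin : linear (fun w => w 0 j : R).
  by move=> k x y; rewrite !mxE.
pose f : {linear 'rV[R]_2 -> R} :=
  HB.pack (fun w => w 0 j : R)
    (@GRing.isLinear.Build _ _ _ _ (fun w => w 0 j : R) lin).
rewrite (_ : (fun w => w 0 j : R) = f)//.
by rewrite diff_lin//; exact: coord_continuous.
Qed.

Let horner_at p w := p.[complex_of_row w].

(* Cauchy-Riemann: the differential of [p] is multiplication by [p'(z)]. *)
Let is_diff_horner p v :
  is_diff v (fun w => complex.Re (horner_at p w) : R)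
    (fun w => complex.Re (horner_at p^`() v * complex_of_row w)) /\
  is_diff v (fun w => complex.Im (horner_at p w) : R)
    (fun w => complex.Im (horner_at p^`() v * complex_of_row w)).
Proof.
elim/poly_ind: p => [|p c [IHre IHim]].
  rewrite /horner_at; split.
    rewrite (_ : (fun w => _) = cst 0); last by apply/funext => w; rewrite horner0.
    by apply: is_diff_eq; apply/funext => w; rewrite deriv0 horner0 mul0r.
  rewrite (_ : (fun w => _) = cst 0); last by apply/funext => w; rewrite horner0.
  by apply: is_diff_eq; apply/funext => w; rewrite deriv0 horner0 mul0r.
have D0 := is_diff_coord v 0; have D1 := is_diff_coord v 1.
have E w : horner_at (p * 'X + c%:P) w = horner_at p w * complex_of_row w + c.
  by rewrite /horner_at hornerMXaddC.
have E' w : horner_at (p * 'X + c%:P)^`() w =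
    horner_at p w + horner_at p^`() w * complex_of_row w.
  by rewrite /horner_at derivMXaddC hornerD hornerM hornerX.
split.
- rewrite (_ : (fun w => _) =
    (fun w => complex.Re (horner_at p w) : R) * (fun w => w 0 0 : R)
    - (fun w => complex.Im (horner_at p w) : R) * (fun w => w 0 1 : R)
    + cst (complex.Re c)); last first.
    apply/funext => w; rewrite E /complex_of_row.
    rewrite !fctE /=; case: (horner_at p w) => x y; case: (c) => s t /=; ring.
  apply: is_diff_eq; apply/funext => w.
  rewrite !E' /complex_of_row.
  case: (horner_at p v) => ? ?; case: (horner_at p^`() v) => ? ?.
  rewrite /= !fctE /= [X in _ + X = _](_ : _ = 0)//. 
  rewrite /GRing.scale/=; ring.
- rewrite (_ : (fun w => _) =
    (fun w => complex.Re (horner_at p w) : R) * (fun w => w 0 1 : R)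
    + (fun w => complex.Im (horner_at p w) : R) * (fun w => w 0 0 : R)
    + cst (complex.Im c)); last first.
    apply/funext => w; rewrite E /complex_of_row.
    rewrite !fctE /=; case: (horner_at p w) => x y; case: (c) => s t /=; ring.
  apply: is_diff_eq; apply/funext => w.
  rewrite !E' /complex_of_row.
  case: (horner_at p v) => ? ?; case: (horner_at p^`() v) => ? ?.
  rewrite /= !fctE /= [X in _ + X = _](_ : _ = 0)//.
  rewrite /GRing.scale/=; ring.
Qed.

Let jacobian_detE (F : R[i] -> R[i]) z (A B : 'rV[R]_2 -> R) :
  is_diff (row_of_complex z) (fun w => complex.Re (F (complex_of_row w)) : R) A ->
  is_diff (row_of_complex z) (fun w => complex.Im (F (complex_of_row w)) : R) B ->
  jacobian_det F z =
  A (delta_mx 0 0) * B (delta_mx 0 1) - A (delta_mx 0 1) * B (delta_mx 0 0).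
Proof.
move=> DA DB.
have D : is_diff (row_of_complex z) (plane_map F)
    (fun w => A w *: delta_mx 0 0 + B w *: delta_mx 0 1).
  rewrite (_ : plane_map F =
    ((fun x : R => x *: (delta_mx 0 0 : 'rV[R]_2)) \o
      (fun w => complex.Re (F (complex_of_row w)) : R)) +
    ((fun x : R => x *: (delta_mx 0 1 : 'rV[R]_2)) \o
      (fun w => complex.Im (F (complex_of_row w)) : R))).
    exact: is_diff_eq.
  apply/funext => w; apply/rowP => j; rewrite !fctE /= !mxE /=.
  by case: j => -[|[|//]] jlt; rewrite /= ?mulr1 ?mulr0 ?addr0 ?add0r.
rewrite /jacobian_det /jacobian (@diff_val _ _ _ _ _ _ _ D).
rewrite (expand_det_row _ 0) !big_ord_recl big_ord0 /cofactor !det_mx11 !mxE /=.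
have -> : lift 0 0 = 1 :> 'I_2 by exact: val_inj.
by rewrite /bump/= !addn0 expr0 expr1; ring.
Qed.

Lemma jacobian_det_harmonic p q z :
  (jacobian_det (harmonic_fun p q) z)%:C =
  `|p^`().[z]| ^+ 2 - `|q^`().[z]| ^+ 2.
Proof.
have [pRe pIm] := is_diff_horner p (row_of_complex z).
have [qRe qIm] := is_diff_horner q (row_of_complex z).
have zE : complex_of_row (row_of_complex z) = z.
  by case: z {pRe pIm qRe qIm} => x y; rewrite /complex_of_row !mxE.
have DRe : is_diff (row_of_complex z)
    (fun w => complex.Re (harmonic_fun p q (complex_of_row w)) : R)
    (fun w => complex.Re (p^`().[z] * complex_of_row w)
      + complex.Re (q^`().[z] * complex_of_row w)).
  rewrite (_ : (fun w => complex.Re (harmonic_fun p q _)) =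
    (fun w => complex.Re (horner_at p w) : R)
    + (fun w => complex.Re (horner_at q w) : R)).
    by apply: is_diff_eq; rewrite /horner_at zE.
  apply/funext => w; rewrite !fctE /harmonic_fun /horner_at.
  by case: p.[_] => ? ?; case: q.[_].
have DIm : is_diff (row_of_complex z)
    (fun w => complex.Im (harmonic_fun p q (complex_of_row w)) : R)
    (fun w => complex.Im (p^`().[z] * complex_of_row w)
      - complex.Im (q^`().[z] * complex_of_row w)).
  rewrite (_ : (fun w => complex.Im (harmonic_fun p q _)) =
    (fun w => complex.Im (horner_at p w) : R)
    - (fun w => complex.Im (horner_at q w) : R)).
    by apply: is_diff_eq; rewrite /horner_at zE.
  apply/funext => w; rewrite !fctE /harmonic_fun /horner_at.
  by case: p.[_] => ? ?; case: q.[_].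
rewrite (jacobian_detE DRe DIm) /complex_of_row !mxE /= !sqr_normc.
case: p^`().[z] => x y; case: q^`().[z] => s t /=.
by apply/eqP; rewrite eq_complex /=; apply/andP; split; apply/eqP; ring.
Qed.

End Jacobian.

Section TruncatedModel.
Context {R : realType} {d : measure_display} {T : measurableType d}.
Variable P : probability T R.

Definition mutually_independent (I : finType) (d' : measure_display)
    (T' : measurableType d') (X : I -> T -> T') : Prop :=
  forall (J : {set I}) (B : I -> set T'), (forall i, measurable (B i)) ->
    P (\bigcap_(i in [set` J]) (X i @^-1` B i))
    = (\prod_(i in J) P (X i @^-1` B i))%E.

Definition has_law (X : T -> R) (mu : set R -> \bar R) : Prop :=
  measurable_fun setT X /\
  forall A : set R, measurable A -> P (X @^-1` A) = mu A.

(* [normal_prob] takes the mean and the standard deviation. *)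
Definition complex_gaussian (Z : T -> R[i]) (v : R) : Prop :=
  [/\ has_law (fun w => complex.Re (Z w)) (normal_prob 0 (Num.sqrt (v / 2))),
      has_law (fun w => complex.Im (Z w)) (normal_prob 0 (Num.sqrt (v / 2))) &
      mutually_independent (fun (b : bool) w =>
        if b then complex.Re (Z w) else complex.Im (Z w))].

Definition re_im (z : R[i]) : R * R := (complex.Re z, complex.Im z).

Record truncated_model (n m : nat) (a b : nat -> T -> R[i]) : Prop := {
  truncated_degrees : (0 < m <= n)%N ;
  truncated_gaussian_a : forall k, (k <= n)%N ->
    complex_gaussian (a k) 'C(n, k)%:R ;
  truncated_gaussian_b : forall k, (k <= m)%N ->
    complex_gaussian (b k) 'C(n, k)%:R ;
  truncated_independent :
    mutually_independent (fun (i : 'I_n.+1 + 'I_m.+1) w =>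
      match i with
      | inl k => re_im (a k w)
      | inr k => re_im (b k w)
      end) }.

Definition random_harmonic (n m : nat) (a b : nat -> T -> R[i]) (w : T) :
    R[i] -> R[i] :=
  harmonic_fun (\poly_(k < n.+1) a k w) (\poly_(k < m.+1) b k w).

End TruncatedModel.

Definition c_alpha {R : realType} (alpha : R) : R :=
  2^-1 * (atan (Num.sqrt (alpha / (1 - alpha)))
          - Num.sqrt (alpha * (1 - alpha))).

(* In [\bar R] the inverse of [0] is [+oo] and that of [+oo] is [0], so
   convergence to [1] forces numerator and denominator to be eventually finite
   and nonzero. *)
Definition asymp_equiv {R : realType} (u v : nat -> \bar R) : Prop :=
  (u n / v n)%E @[n --> \oo] --> 1%E.

(* Main.v *)
Require Import Defs.
From HB Require Import structures.
From mathcomp Require Import all_boot all_order all_algebra.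
From mathcomp Require Import all_classical all_reals all_analysis.
From mathcomp Require Import measurable_realfun.
From mathcomp Require Import complex.
From mathcomp Require Import ring lra.

Set Implicit Arguments.
Unset Strict Implicit.
Unset Printing Implicit Defensive.

Import Order.TTheory GRing.Theory Num.Theory.
Import numFieldNormedType.Exports.
Import HBNNSimple.

Local Open Scope classical_set_scope.
Local Open Scope ring_scope.

(** Why the theorem holds. Let s = 1 or s = -1 and let J be the Jacobian
determinant of F. The constant term a_0 is a standard complex Gaussian,
independent of the other coefficients; given these, the zeros of F are the
points where G = F - a_0 takes the value - a_0. Integrating the number of such
points against the density phi of a_0 is the business of the area formula
([area_formula]), and gives the Kac-Rice identity ([expected_count])

  E #{F = 0, s J > 0} = int_C E [max (0, s J(z)) phi (- G(z))] dz.

The area formula is proved by smoothing. The weighted number of zeros is the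
limit of integrals of |J| against an approximate identity evaluated at G + c.
On a small cell where J stays away from 0 the differential of G outweighs the
quadratic Taylor remainder, and G expands distances; hence the cell contains at
most one zero, the smoothed integrals are bounded, and they converge for every
c ([cell_cvg], [cell_integral], [area_sign_weight]). Being a limit of such
integrals, the number of zeros is a measurable function of c and of the
coefficients.

At a fixed z the integrand is a function of the Gaussian vector formed by G(z),
z p'(z) and the conjugate of z q'(z). A rotation of each coefficient by the
argument of z^k makes its covariance real and dependent on t = |z|^2 only. Such
a vector is handled as a list of weights, one for each independent Gaussian, up
to plane rotations. Gram-Schmidt by rotations isolates G, the factor phi (- G)
conditions on F = 0, and a last rotation diagonalises the form |z p'|^2 - |z
q'|^2. The mean of the positive part of the difference of two independent
exponential variables remains, so that an explicit density in t is obtained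
([gauss_value], [expected_zeros]).

Up to powers of 1 + t, this density is a combination of the moments of the
binomial law with n trials and success probability x = t / (1 + t), for p, and
of the same moments truncated at m, for q. If x > alpha the truncated moments
are exponentially small, by Chernoff's bound, and the density is negligible at
the scale n^(3/2). If x < alpha the truncation is invisible, so z p'(z) and the
conjugate of z q'(z) have asymptotically the same conditional variance: the
difference of the variances has order n, the square root of the determinant has
order n^(3/2), and both signs receive the same limiting density n^(3/2) sqrt t
/ (4 (1 + t)^2) ([tail_decay], [zero_density_limit]). A bound by 7 n^(3/2) (1 +
t)^(-3/2), valid for all n ([zero_density_bound]), permits dominated
convergence, and the integral of sqrt t / (4 (1 + t)^2) over 0 < t < alpha / (1
- alpha) is c_alpha / 2 ([profile_integral], [scaled_limit]). *)

(** * Linear substitution in plane integrals *)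

Section PlaneIntegrals.

Context {R : realType}.
Notation mu := (@lebesgue_measure R).
Notation MR := (measurableTypeR R).

(** Both sides are measures in A, and half-open intervals determine Lebesgue
measure. *)
Lemma lebesgue_affine (a b : R) (A : set R) : 0 < a -> measurable A ->
  (a%:E * mu ((fun x => a * x + b)%R @^-1` A) = mu A)%E.
Proof.
move=> a0 mA.
have mf : measurable_fun setT ((fun x : R => (a * x + b)%R) : MR -> MR).
  by apply: measurable_funD => //; apply: measurable_funM.
pose f : measurableTypeR R -> measurableTypeR R := (fun x : R => (a * x + b)%R).
pose pf : {measure set MR -> \bar R} := measure_function_pushforward__canonical__measure_function_Measure mu mf.
pose nu : {measure set MR -> \bar R} := mscale (NngNum (ltW a0)) pf.
rewrite [RHS](@lebesgue_measure_unique _ nu)//.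
move=> _ [[c d]] _ <-.
have E : f @^-1` `]c, d]%classic = `](c - b) / a, (d - b) / a]%classic.
  apply/seteqP; split => x /=; rewrite /f !in_itv/= ltr_pdivrMr// ler_pdivlMr// ltrBlDr lerBrDr [x * a]mulrC//.
transitivity (a%:E * mu (f @^-1` `]c, d]))%E; last by [].
rewrite E !lebesgue_measure_itv/= !lte_fin ltr_pM2r ?invr_gt0// ltrBlDr subrK.
case: ifPn => _; last by rewrite mule0.
rewrite -!EFinD -EFinM; congr (_%:E). field. by rewrite gt_eqF.
Qed.

(** Monotone convergence reduces the identity to simple functions, hence to
indicators, for which it is the hypothesis on nu. *)
Lemma density_integral (p : R -> R) (nu : {measure set MR -> \bar R}) :
  measurable_fun setT p -> (forall x, 0 <= p x) ->
  (forall A, measurable A -> nu A = (\int[mu]_(x in A) (p x)%:E)%E) ->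
  forall f : R -> \bar R, measurable_fun setT f -> (forall x, 0 <= f x)%E ->
  (\int[nu]_x f x = \int[mu]_x (f x * (p x)%:E))%E.
Proof.
move=> mp p0 nuE f mf f0.
pose g : {nnsfun MR >-> R}^nat := @nnsfun_approx _ MR R setT measurableT f mf.
transitivity (limn (fun n => \int[nu]_x (g n x)%:E)%E).
  rewrite -monotone_convergence//.
  - by apply: eq_integral => x _; apply/esym/cvg_lim => //; apply: cvg_nnsfun_approx.
  - by move=> n; exact/measurable_EFinP/measurable_funTS.
  - by move=> *; rewrite lee_fin.
  - by move=> x _ m n mn; rewrite lee_fin; exact/lefP/nd_nnsfun_approx.
transitivity (limn (fun n => \int[mu]_x ((g n x)%:E * (p x)%:E))%E); last first.
  rewrite -monotone_convergence//.
  - apply: eq_integral => x _; apply/cvg_lim => //.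
    apply: cvgeZr => //; apply: cvg_nnsfun_approx => //.
  - move=> n; apply/measurable_EFinP; apply: measurable_funM => //.
  - by move=> n x _; rewrite lee_fin mulr_ge0.
  - by move=> x _ m n mn; rewrite lee_fin ler_wpM2r//; exact/lefP/nd_nnsfun_approx.
congr (limn _); apply/funext => n.
under eq_integral do rewrite fimfunE -fsumEFin//.
rewrite ge0_integral_fsum//=; last 2 first.
- by move=> r; exact/measurable_EFinP/measurable_funM.
- by move=> r x _; rewrite EFinM nnfun_muleindic_ge0.
under [RHS]eq_integral.
  move=> x _. rewrite fimfunE -fsumEFin// muleC ge0_mule_fsumr; last first.
    by move=> r; rewrite EFinM nnfun_muleindic_ge0.
  over.
rewrite ge0_integral_fsum//=; last 2 first.
- move=> r; apply/measurable_EFinP; apply: measurable_funM => //. apply: measurable_funM => //.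
- by move=> r x _; apply: mule_ge0; rewrite ?lee_fin// -lee_fin EFinM nnfun_muleindic_ge0.
apply: eq_fsbigr => r _.
rewrite integralZl_indic_nnsfun//= integral_indic// setIT.
have [r0|r0] := ltP r 0.
  rewrite preimage_nnfun0// measure0 mule0; symmetry.
  by under eq_integral do rewrite indicE in_set0 mulr0 mule0; rewrite integral0.
under eq_integral do rewrite EFinM muleCA.
rewrite ge0_integralZl//; last 2 first.
- apply/measurable_EFinP; apply: measurable_funM => //.
- by move=> x _; rewrite -EFinM lee_fin mulr_ge0.
congr (_ * _)%E; rewrite nuE// [LHS]integral_mkcond.
apply: eq_integral => x _; rewrite patchE indicE.
by case: ifP => _; rewrite ?mule1 ?mule0.
Qed.

Lemma affine_integral (a b : R) (f : R -> \bar R) : a != 0 ->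
  measurable_fun setT f -> (forall x, 0 <= f x)%E ->
  (`|a|%:E * \int[mu]_x f (a * x + b)%R = \int[mu]_x f x)%E.
Proof.
wlog a0 : a f / 0 < a.
  move=> H an mf f0; have [a0|a0|a0] := ltgtP 0 a; [exact: H| |by rewrite a0 eqxx in an].
  have := H (- a) f.
  have mN : measurable_fun setT (-%R : R -> measurableTypeR R) by [].
  have E (h : R -> \bar R) : measurable_fun setT h -> (forall x, 0 <= h x)%E ->
     (\int[mu]_x h (- x)%R = \int[mu]_x h x)%E.
    move=> mh h0.
    have := @ge0_integral_pushforward _ _ MR MR R _ mN mu setT h measurableT mh (fun x _ => h0 x).
    rewrite preimage_setT => <-.
    by apply: eq_measure_integral => A mA _; exact: lebesgue_measureN.
  rewrite -(E (fun x => f (a * x + b)))//; last first.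
    apply: measurableT_comp => //. by apply: measurable_funD => //; apply: measurable_funM.
  rewrite oppr_gt0 oppr_eq0 normrN => /(_ a0 an mf f0) <-.
  congr (_ * _)%E. apply: eq_integral => x _. by rewrite mulrN mulNr.

move=> an mf f0; rewrite gtr0_norm//.
have maf : measurable_fun setT (fun x : R => (a * x + b)%R : measurableTypeR R).
  by apply: measurable_funD => //; apply: measurable_funM.
have := @ge0_integral_pushforward _ _ MR MR R _ maf mu setT f measurableT mf (fun x _ => f0 x).
rewrite preimage_setT => <-.
rewrite -[a in LHS]/((NngNum (ltW a0))%:num).
rewrite -ge0_integral_mscale//.
apply: eq_measure_integral => A mA _.
exact: (lebesgue_affine b a0 mA).
Qed.

Lemma measurable_integral_l (f : MR * MR -> \bar R) : measurable_fun setT f ->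
  (forall x, 0 <= f x)%E -> measurable_fun setT (fun y : MR => \int[mu]_x f (x, y))%E.
Proof. by move=> mf f0; exact: (measurable_fun_fubini_tonelli_G (m1 := mu) f). Qed.

Lemma measurable_integral_r (f : MR * MR -> \bar R) : measurable_fun setT f ->
  (forall x, 0 <= f x)%E -> measurable_fun setT (fun x : MR => \int[mu]_y f (x, y))%E.
Proof. by move=> mf f0; exact: (measurable_fun_fubini_tonelli_F (m2 := mu) f). Qed.

Lemma tonelli2 (f : MR * MR -> \bar R) : measurable_fun setT f -> (forall x, 0 <= f x)%E ->
  (\int[mu]_x \int[mu]_y f (x, y) = \int[mu]_y \int[mu]_x f (x, y))%E.
Proof. by move=> mf f0; exact: (fubini_tonelli (m1 := mu) (m2 := mu)). Qed.

Lemma measurable_lin (a b : R) : measurable_fun setT (fun p : MR * MR => a * p.1 + b * p.2 : MR).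
Proof. by apply: measurable_funD; apply: measurable_funM. Qed.

(** When a is not 0 the matrix is a product of two triangular ones: substitute
in x at fixed y, exchange the integrals, then substitute in y at fixed x. *)
Lemma linear_integral2_aux (f : MR * MR -> \bar R) (a b c d : R) : a != 0 -> a * d - b * c != 0 ->
  measurable_fun setT f -> (forall x, 0 <= f x)%E ->
  (`|a * d - b * c|%:E * \int[mu]_x \int[mu]_y f ((a * x + b * y)%R, (c * x + d * y)%R)
   = \int[mu]_x \int[mu]_y f (x, y))%E.
Proof.
move=> a0 D0 mf f0.

have mg : measurable_fun setT (fun p : MR * MR => f ((a * p.1 + b * p.2)%R, (c * p.1 + d * p.2)%R)).
  by apply: measurableT_comp => //; apply/measurable_fun_pair; exact: measurable_lin.
rewrite (tonelli2 mg)//=.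
have E2 y : (`|a|%:E * \int[mu]_x f ((a * x + b * y)%R, (c * x + d * y)%R) =
   \int[mu]_s f (s, (c / a * s + (a * d - b * c) / a * y)%R))%E.
  rewrite -(@affine_integral a (b * y) (fun s => f (s, (c / a * s + (a * d - b * c) / a * y)%R)))//; last first.
    apply: measurableT_comp => //. apply/measurable_fun_pair => //=.
    apply: measurable_funD => //; apply: measurable_funM => //.
  congr (_ * _)%E; apply: eq_integral => x _; congr (f (_, _)); field => //.
have -> : `|a * d - b * c|%:E = (`|(a * d - b * c) / a|%:E * `|a|%:E)%E.
  by rewrite -EFinM -normrM; congr (`| _ |%:E); field.
rewrite -muleA -ge0_integralZl; first last.
- by [].
- by move=> y _; apply: integral_ge0 => x _; exact: f0.
- exact: (measurable_integral_l mg).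
- by [].
under eq_integral do rewrite E2.
have mh : measurable_fun setT (fun p : MR * MR => f (p.1, (c / a * p.1 + (a * d - b * c) / a * p.2)%R)).
  by apply: measurableT_comp => //; apply/measurable_fun_pair => //; exact: measurable_lin.
rewrite -(tonelli2 mh)//= -ge0_integralZl; first last.
- by [].
- by move=> y _; apply: integral_ge0 => x _; exact: f0.
- exact: (measurable_integral_r mh).
- by [].
apply: eq_integral => s _.
rewrite -[RHS](@affine_integral ((a * d - b * c) / a) (c / a * s) (fun t => f (s, t)))//.
- by congr (_ * _)%E; apply: eq_integral => x _; rewrite addrC.
- by rewrite mulf_neq0// invr_eq0.
- by apply: measurableT_comp => //; exact: measurable_pair1.
Qed.

(** If a vanishes then b does not, and exchanging the two variables reduces to
the previous case. *)
Lemma linear_integral2 (f : MR * MR -> \bar R) (a b c d : R) : a * d - b * c != 0 ->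
  measurable_fun setT f -> (forall x, 0 <= f x)%E ->
  (`|a * d - b * c|%:E * \int[mu]_x \int[mu]_y f ((a * x + b * y)%R, (c * x + d * y)%R)
   = \int[mu]_x \int[mu]_y f (x, y))%E.
Proof.
move=> D0 mf f0; have [a0|a0] := eqVneq a 0; last exact: linear_integral2_aux.
have b0 : b != 0 by apply: contra_neq D0 => ->; rewrite a0 !mul0r subrr.
have mg : measurable_fun setT (fun p : MR * MR => f ((a * p.1 + b * p.2)%R, (c * p.1 + d * p.2)%R)).
  by apply: measurableT_comp => //; apply/measurable_fun_pair; exact: measurable_lin.
rewrite (tonelli2 mg); last by [].
rewrite -(@linear_integral2_aux f b a d c); first last.
- by [].
- by [].
- by rewrite -oppr_eq0 opprB.
- by [].
rewrite (_ : a * d - b * c = - (b * c - a * d)) ?normrN; last by ring.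
congr (_ * _)%E; apply: eq_integral => y _; apply: eq_integral => x _.
by congr (f (_, _)); rewrite addrC.
Qed.

End PlaneIntegrals.

(** * Half-variance Gaussians and polar coordinates *)

Section Gauss.
Context {R : realType}.
Notation mu := (@lebesgue_measure R).
Notation MR := (measurableTypeR R).

Definition gam_pdf (x : R) : R := expR (- x ^+ 2) / Num.sqrt pi.
(** The law of the real part, and of the imaginary part, of a complex Gaussian
of variance 1, namely N(0, 1/2), with density [gam_pdf]. *)
Definition gam : set MR -> \bar R := normal_prob 0 (Num.sqrt 2^-1 : R).
HB.instance Definition _ := Probability.on gam.

Lemma measurable_gam_pdf : measurable_fun setT (gam_pdf : MR -> MR).
Proof.
apply: measurable_funM => //; apply: measurableT_comp => //.
by apply: measurableT_comp => //; apply: measurable_funX.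
Qed.

Lemma gam_pdf_ge0 x : 0 <= gam_pdf x.
Proof. by rewrite divr_ge0 ?expR_ge0 ?sqrtr_ge0. Qed.

Lemma normal_pdf_scale v x : 0 < v ->
  Num.sqrt v * normal_pdf 0 (Num.sqrt (v / 2)) (Num.sqrt v * x) = gam_pdf x.
Proof.
move=> v0; have s0 : Num.sqrt (v / 2) != 0 by rewrite gt_eqF// sqrtr_gt0 divr_gt0.
rewrite normal_pdfE// /normal_peak /normal_fun subr0 exprMn !sqr_sqrtr ?ltW ?divr_gt0//.
rewrite (_ : v / 2 * pi *+ 2 = v * pi); last by rewrite -mulr_natr; field.
rewrite (_ : - (v * x ^+ 2) / (v / 2 *+ 2) = - x ^+ 2); last first.
  rewrite -mulr_natr; field; by rewrite gt_eqF.
rewrite sqrtrM ?ltW// /gam_pdf mulrA invfM mulrA divff ?mul1r 1?mulrC//.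
by rewrite gt_eqF// sqrtr_gt0.
Qed.

Lemma normal_integral_pdf s (f : MR -> \bar R) : measurable_fun setT f -> (forall x, 0 <= f x)%E ->
  (\int[normal_prob 0 s]_x f x = \int[mu]_x (f x * (normal_pdf 0 s x)%:E))%E.
Proof.
move=> mf f0; apply: (@density_integral R (normal_pdf 0 s) (normal_prob 0 s)) => //.
- exact: measurable_normal_pdf.
- by move=> x; exact: normal_pdf_ge0.
Qed.

Lemma gam_integral (f : MR -> \bar R) : measurable_fun setT f -> (forall x, 0 <= f x)%E ->
  (\int[gam]_x f x = \int[mu]_x (f x * (gam_pdf x)%:E))%E.
Proof.
move=> mf f0; rewrite normal_integral_pdf//.
apply: eq_integral => x _; congr (_ * _%:E)%E.
by have := @normal_pdf_scale 1 x ltr01; rewrite sqrtr1 !mul1r.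
Qed.

(** The variance is halved because v is the variance of the complex Gaussian
of which this is one coordinate. *)
Lemma normal_integral v (f : MR -> \bar R) : 0 < v -> measurable_fun setT f ->
  (forall x, 0 <= f x)%E ->
  (\int[normal_prob 0 (Num.sqrt (v / 2))]_x f x = \int[gam]_x f (Num.sqrt v * x)%R)%E.
Proof.
move=> v0 mf f0.
have sv0 : Num.sqrt v != 0 by rewrite gt_eqF// sqrtr_gt0.
rewrite [LHS]normal_integral_pdf; [|exact: mf|exact: f0].
rewrite [RHS]gam_integral; [|  |by move=> x; exact: f0]; last first.
  by apply: measurableT_comp => //; apply: measurable_funM.
rewrite -(@affine_integral R (Num.sqrt v) 0)//; last 2 first.
- apply: emeasurable_funM => //. apply/measurable_EFinP. exact: measurable_normal_pdf.
- by move=> x; rewrite mule_ge0// lee_fin normal_pdf_ge0.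
rewrite -ge0_integralZl//; last 2 first.
- apply: (measurableT_comp (f := fun x => f x * (normal_pdf 0 (Num.sqrt (v / 2)) x)%:E)%E).
    apply: emeasurable_funM => //. apply/measurable_EFinP. exact: measurable_normal_pdf.
  by apply: measurable_funD => //; apply: measurable_funM.
- by move=> x _; rewrite mule_ge0// lee_fin normal_pdf_ge0.
apply: eq_integral => x _; rewrite addr0 muleCA -EFinM ger0_norm ?sqrtr_ge0//.
by rewrite normal_pdf_scale.
Qed.

Lemma gam_pdf2 x y : gam_pdf x * gam_pdf y = expR (- (x ^+ 2 + y ^+ 2)) / pi.
Proof.
rewrite /gam_pdf mulrACA -expRD -opprD -invfM -expr2 sqr_sqrtr// ltW//; exact: pi_gt0.
Qed.

Opaque gam.

Lemma gam_integral2 (f : MR * MR -> \bar R) : measurable_fun setT f -> (forall x, 0 <= f x)%E ->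
  (\int[gam]_x \int[gam]_y f (x, y) =
   \int[mu]_x \int[mu]_y (f (x, y) * (expR (- (x ^+ 2 + y ^+ 2)) / pi)%:E))%E.
Proof.
move=> mf f0.
rewrite gam_integral; first last.
- by move=> x; apply: integral_ge0.
- exact: (measurable_fun_fubini_tonelli_F (m2 := gam) f).
apply: eq_integral => x _.
rewrite gam_integral//; last by apply: measurableT_comp => //; exact: measurable_pair1.
rewrite muleC -ge0_integralZl//; first last.
- by rewrite lee_fin gam_pdf_ge0.
- by move=> y _; rewrite mule_ge0// lee_fin gam_pdf_ge0.
- apply: emeasurable_funM; first by apply: measurableT_comp => //; exact: measurable_pair1.
  by apply/measurable_EFinP; exact: measurable_gam_pdf.
apply: eq_integral => y _.
by rewrite muleCA -EFinM gam_pdf2.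
Qed.

Lemma measurable_gauss2 : measurable_fun setT (fun p : MR * MR => expR (- (p.1 ^+ 2 + p.2 ^+ 2)) / pi : MR).
Proof.
apply: measurable_funM => //; apply: measurableT_comp => //.
by apply: measurableT_comp => //; apply: measurable_funD; apply: measurable_funX.
Qed.

(** The joint density depends on x^2 + y^2 only, and an orthogonal
substitution preserves both this sum and Lebesgue measure. *)
Lemma gam_orthogonal (f : MR * MR -> \bar R) a b c d :
  a ^+ 2 + c ^+ 2 = 1 -> b ^+ 2 + d ^+ 2 = 1 -> a * b + c * d = 0 ->
  measurable_fun setT f -> (forall x, 0 <= f x)%E ->
  (\int[gam]_x \int[gam]_y f ((a * x + b * y)%R, (c * x + d * y)%R) = \int[gam]_x \int[gam]_y f (x, y))%E.
Proof.
move=> h1 h2 h3 mf f0.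
have D1 : `|a * d - b * c| = 1.
  apply/eqP; rewrite -(@eqrXn2 _ 2)// expr1n real_normK ?num_real//.
  apply/eqP; transitivity ((a ^+ 2 + c ^+ 2) * (b ^+ 2 + d ^+ 2) - (a * b + c * d) ^+ 2).
    by ring.
  by rewrite h1 h2 h3 expr0n/= subr0 mulr1.
have mg : measurable_fun setT (fun p : MR * MR => f ((a * p.1 + b * p.2)%R, (c * p.1 + d * p.2)%R)).
  by apply: measurableT_comp => //; apply/measurable_fun_pair; exact: measurable_lin.
rewrite [LHS](gam_integral2 mg); last by move=> x; exact: f0.
rewrite [RHS]gam_integral2; [|exact: mf|exact: f0].
pose F (p : MR * MR) := (f (p.1, p.2) * (expR (- (p.1 ^+ 2 + p.2 ^+ 2)) / pi)%:E)%E.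
rewrite -[RHS](@linear_integral2 R F a b c d); first last.
- by move=> x; rewrite /F mule_ge0// lee_fin divr_ge0 ?expR_ge0// ltW// pi_gt0.
- apply: emeasurable_funM; last by apply/measurable_EFinP; exact: measurable_gauss2.
  by under eq_fun do rewrite -surjective_pairing.
- by apply/eqP => D; move: D1; rewrite D normr0 => /esym/eqP; rewrite oner_eq0.
rewrite D1 mul1e; apply: eq_integral => x _; apply: eq_integral => y _.
rewrite /F/=; congr (_ * (expR (- _) / _)%:E)%E.
transitivity ((a ^+ 2 + c ^+ 2) * x ^+ 2 + (b ^+ 2 + d ^+ 2) * y ^+ 2 + (a * b + c * d) * (x * y) *+ 2).
  by rewrite h1 h2 h3 !mul1r mul0r mul0rn addr0.
by ring.
Qed.
End Gauss.

Section Polar.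
Context {R : realType}.
Notation mu := (@lebesgue_measure R).
Notation MR := (measurableTypeR R).

Let q (p : MR * MR) : MR := p.1 ^+ 2 + p.2 ^+ 2.
Let mq : measurable_fun setT q.
Proof. by apply: measurable_funD; apply: measurable_funX. Qed.

(** The image of the Lebesgue measure of the plane under x^2 + y^2. Scaling
shows that it is proportional to Lebesgue measure on the half line, and the
Gaussian density identifies the factor [kap], the area of the unit disc, as
pi. *)
Let nu : {measure set MR -> \bar R} :=
  measure_function_pushforward__canonical__measure_function_Measure (mu \x mu)%E mq.

Let nu_integral (f : MR -> \bar R) : measurable_fun setT f -> (forall x, 0 <= f x)%E ->
  (\int[nu]_t f t = \int[mu]_x \int[mu]_y f (x ^+ 2 + y ^+ 2)%R)%E.
Proof.
move=> mf f0.
have -> := @ge0_integral_pushforward _ _ _ _ _ _ mq (mu \x mu)%E setT f measurableT mf (fun x _ => f0 x).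
rewrite preimage_setT fubini_tonelli1 => [//||x]; last exact: f0.
exact: measurableT_comp.
Qed.

Let kap := nu `]-oo, 1%R]%classic.

Let nuE A : measurable A -> nu A = (\int[mu]_x \int[mu]_y (\1_A (x ^+ 2 + y ^+ 2))%:E)%E.
Proof.
move=> mA; rewrite -(nu_integral (f := fun t => (\1_A t)%:E)).
- by rewrite integral_indic// setIT.
- by apply/measurable_EFinP; exact: measurable_indic.
- by move=> x; rewrite lee_fin indicE.
Qed.

(** A scaling by sqrt t multiplies areas by t. *)
Let nu_disc t : 0 < t -> nu `]-oo, t]%classic = (t%:E * kap)%E.
Proof.
move=> t0; rewrite /kap !nuE//.
pose F (p : MR * MR) : \bar R := ((\1_(`]-oo, t]%classic : set R) (p.1 ^+ 2 + p.2 ^+ 2))%:E).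
have tE : Num.sqrt t * Num.sqrt t = t by rewrite -expr2 sqr_sqrtr// ltW.
rewrite -[LHS](@linear_integral2 R F (Num.sqrt t) 0 0 (Num.sqrt t)).
- rewrite mul0r subr0 tE (gtr0_norm t0); apply: (congr1 (fun z => t%:E * z)%E).
  apply: eq_integral => x _; apply: eq_integral => y _.
  rewrite /F/= !indicE; congr (_%:R%:E); rewrite !mem_setE !in_itv/= !mul0r addr0 add0r !exprMn.
  rewrite (sqr_sqrtr (ltW t0)).
  by rewrite -mulrDr -[X in (_ <= X)]mulr1 (ler_pM2l t0).
- by rewrite mul0r subr0 tE gt_eqF.
- apply/measurable_EFinP.
  have mi : measurable_fun setT (\1_(`]-oo, t]%classic : set MR) : MR -> MR) by apply: measurable_indic.
  exact: (measurableT_comp mi mq).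
- by move=> x; rewrite lee_fin indicE.
Qed.

Let kap_fin : kap \is a fin_num.
Proof.
rewrite ge0_fin_numE; last exact: measure_ge0.
apply: (@le_lt_trans _ _ ((mu \x mu)%E (`[-1, 1]%classic `*` `[-1, 1]%classic))).
  rewrite -[leLHS]/((mu \x mu)%E (q @^-1` `]-oo,1%R]%classic)); apply: le_measure.
  - rewrite inE; rewrite -[X in measurable X]setTI; exact: mq.
  - by rewrite inE; exact: measurableX.
  - move=> [x y]; rewrite /q/= in_itv/= => h; split; rewrite /= in_itv/=; nra.
rewrite product_measure1E; [|exact: measurable_itv|exact: measurable_itv].
have m2 : mu `[(-1)%R, 1%R]%classic = 2%:E.
  by rewrite lebesgue_measure_itv/= lte_fin (lt_trans (ltrN10 R) ltr01) -EFinD opprK.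
by rewrite [X in (X * _)%E]m2 [X in (_ * X)%E]m2 -EFinM ltry.
Qed.

Let nu0 : nu `]-oo, 0%R]%classic = 0%E.
Proof.
apply/eqP; rewrite eq_le measure_ge0 andbT; apply/lee_addgt0Pr => e e0; rewrite add0e.
have k0 : 0 <= fine kap by apply: fine_ge0; exact: measure_ge0.
apply: (@le_trans _ _ (nu `]-oo, (e / (1 + fine kap))]%classic)).
  apply: le_measure; rewrite ?inE// => x; rewrite /= !in_itv/= => /le_trans; apply.
  by rewrite divr_ge0// ?addr_ge0// ltW.
rewrite nu_disc ?divr_gt0 ?ltr_pwDl// -(fineK kap_fin) -EFinM lee_fin.
rewrite mulrAC ler_pdivrMr ?ltr_pwDl// ler_pM2l//. by rewrite lerDr.
Qed.

Let nu_itv a b : nu `]a, b]%classic = (kap * mu (`]a, b] `&` `[0%R, +oo[))%E.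
Proof.
have [ba|ab] := leP b a.
  rewrite set_itv_ge ?measure0 ?set0I ?measure0 ?mule0//.
  by rewrite bnd_simp -leNgt.
have nuN t : t <= 0 -> nu `]-oo, t]%classic = 0%E.
  move=> t0; apply/eqP; rewrite eq_le measure_ge0 andbT -nu0.
  apply: le_measure; rewrite ?inE// => x; rewrite /= !in_itv/= => /le_trans; exact.
have [b0|b0] := leP b 0.
  rewrite (_ : mu _ = 0%E) ?mule0.
    apply/eqP; rewrite eq_le measure_ge0 andbT -(nuN b b0); apply: le_measure; rewrite ?inE//.
    by move=> x; rewrite /= !in_itv/= => /andP[].
  apply/eqP; rewrite eq_le measure_ge0 andbT.
  rewrite -(lebesgue_measure_set1 (0 : R)); apply: le_measure; rewrite ?inE//; first exact: measurableI.
  move=> x /=; rewrite !in_itv/= ?andbT => -[/andP[_ xb] x0].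
  by apply/eqP; rewrite eq_le x0 andbT (le_trans xb).
have disj : nu `]-oo, b]%classic = (nu `]-oo, a]%classic + nu `]a, b]%classic)%E.
  rewrite -measureU//.
    by congr (nu _); rewrite -itv_bndbnd_setU// bnd_simp// ltW.
  by apply/seteqP; split => x //=; rewrite !in_itv/= => -[xa /andP[]]; rewrite ltNge xa.
have [a0|a0] := ltP 0 a.
  rewrite (_ : _ `&` _ = `]a, b]%classic); last first.
    apply/setIidPl => x /=; rewrite !in_itv/= andbT => /andP[ax _]; exact/ltW/(lt_trans a0).
  rewrite lebesgue_measure_itv/= lte_fin ab.
  move: disj; rewrite (nu_disc b0) (nu_disc a0).
  have aux (X k : \bar R) : k \is a fin_num -> (b%:E * k = a%:E * k + X -> X = k * (b%:E - a%:E))%E.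
    case: k => // k _; case: X => [r| |]//; rewrite -!EFinM -!EFinD => -[E]; apply: congr1.
    by rewrite mulrC mulrBl E addrAC subrr add0r.
  exact: aux.
move: disj; rewrite (nuN a a0) add0e => <-.
rewrite (nu_disc b0) muleC; apply: (congr1 (fun z => kap * z)%E).
have [a0'|a0'] := ltP a 0.
  rewrite (_ : _ `&` _ = `[0, b]%classic); last first.
    apply/seteqP; split => x /=; rewrite !in_itv/= andbT; first by move=> [/andP[_ ->] ->].
    by move=> /andP[x0 ->]; rewrite x0 (lt_le_trans a0').
  by rewrite lebesgue_measure_itv/= lte_fin b0 oppr0 adde0.
have -> : a = 0 by apply/eqP; rewrite eq_le a0.
rewrite (_ : _ `&` _ = `]0, b]%classic); last first.
  by apply/setIidPl => x /=; rewrite !in_itv/= andbT => /andP[/ltW].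
by rewrite lebesgue_measure_itv/= lte_fin b0 oppr0 adde0.
Qed.

Let k0 : 0 <= fine kap. Proof. by apply: fine_ge0; exact: measure_ge0. Qed.
Let nup : {measure set MR -> \bar R} := mscale (NngNum k0) (mrestr mu (measurable_itv `[0, +oo[)).

Let nu_mu A : measurable A -> nu A = nup A.
Proof.
move=> mA. have H := (@measure_unique _ R MR (@ocitv R) (fun k => `](- (k%:R)), k%:R]%classic) _ _ _ _ nu nup). apply: H => //.
- exact: ocitvI.
- by move=> i; exists (- i%:R, i%:R).
- apply/seteqP; split => // x _.
  exists (Num.truncn `|x|).+1 => //=; rewrite in_itv/=.
  have : `|x| < (Num.truncn `|x|).+1%:R by exact: truncnS_gt.
  by rewrite ltr_norml => /andP[-> /ltW].
- move=> _ [[a b]] _ <-; rewrite nu_itv /nup /mscale/= /mrestr.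
  by rewrite -[in LHS](fineK kap_fin).
- move=> k; rewrite nu_itv; apply: lte_mul_pinfty => //; first exact: measure_ge0.
  apply: (@le_lt_trans _ _ (mu `](- (k%:R)), k%:R]%classic)).
    by apply: le_measure; rewrite ?inE//; exact: measurableI.
  by rewrite lebesgue_measure_itv/= lte_fin; case: ifP; rewrite ?ltry// -EFinB ltry.
Qed.

Let polar0 (f : MR -> \bar R) : measurable_fun setT f -> (forall x, 0 <= f x)%E ->
  (\int[mu]_x \int[mu]_y f (x ^+ 2 + y ^+ 2)%R = kap * \int[mu]_(t in `[0%R, +oo[) f t)%E.
Proof.
move=> mf f0; rewrite -nu_integral; [|exact: mf|exact: f0].
pose p t := fine kap * \1_(`[0, +oo[%classic : set R) t.
rewrite (@density_integral R p nu); first last.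
- exact: f0.
- exact: mf.
- move=> A mA; rewrite nu_mu// /nup /mscale/= /mrestr/= /p.
  under eq_integral do rewrite EFinM.
  rewrite ge0_integralZl; first last.
  + by rewrite lee_fin k0.
  + by move=> x _; rewrite lee_fin indicE.
  + by apply/measurable_EFinP; apply: measurable_funTS.
  + exact: mA.
  by rewrite integral_indic// setIC.
- by move=> t; rewrite /p mulr_ge0// indicE.
- by apply: measurable_funM => //.
rewrite [in RHS]integral_mkcond -ge0_integralZl; first last.
- exact: measure_ge0.
- by move=> x _; rewrite patchE; case: ifP.
- by apply/(measurable_restrictT _ _).1 => //; exact: measurable_funTS.
- exact: measurableT.
apply: eq_integral => t _; rewrite /p patchE indicE -[in RHS](fineK kap_fin).
by case: ifP => _; [rewrite mulr1 muleC|rewrite mulr0 !mule0].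
Qed.

Let int_exp : (\int[mu]_(t in `[0%R, +oo[) (expR (- t))%:E = 1 :> \bar R)%E.
Proof.
rewrite (@ge0_continuous_FTC2y _ _ (fun x => - expR (- x)) _ 0)//.
- by rewrite oppr0 expR0 EFinN oppeK add0e.
- by apply: continuous_subspaceT => x; apply: continuous_comp; [exact: opp_continuous|exact: continuous_expR].
- rewrite -oppr0; apply: cvgN; exact: cvgr_expR.
- apply: cvgN; apply/cvg_at_right_filter.
  by apply: continuous_comp; [exact: opp_continuous|exact: continuous_expR].
- move=> z; rewrite in_itv/= andbT => z0.
  rewrite derive1_comp// derive1N// derive1_id mulN1r derive1_comp// derive1E.
  have /funeqP -> := @derive_expR R.
  by rewrite derive1N// derive1_id mulrN1 opprK.
Qed.

(** The plane Gaussian density has total mass 1; in polar form its mass is kap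
/ pi times the integral of exp (- t). *)
Let kapE : kap = pi%:E.
Proof.
have mE : measurable_fun setT (fun t : MR => (expR (- t) / pi)%:E).
  by apply/measurable_EFinP; apply: measurable_funM => //; apply: measurableT_comp.
have := polar0 mE (fun t => _).
have e0 t : (0 <= (expR (- t) / pi : R)%:E)%E by rewrite lee_fin divr_ge0 ?expR_ge0// pi_ge0.
move=> /(_ e0).
have := @gam_integral2 R (fun=> 1%E) (@measurable_cst _ _ _ _ _ _) (fun=> lee01).
have C1 : (\int[@gam R]__ (1 : \bar R) = 1)%E.
  rewrite integral_cst; last exact: measurableT.
 by rewrite [X in (_ * X)%E](_ : _ = 1%E) ?mule1//; exact: (probability_setT (gam (R := R))).
rewrite C1 C1 => E1.
have <- : 1%E = (\int[mu]_x \int[mu]_y (expR (- (x ^+ 2 + y ^+ 2)) / pi)%:E)%E :> \bar R.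
  rewrite E1; apply: eq_integral => x _; apply: eq_integral => y _; by rewrite mul1e.
under eq_integral do rewrite EFinM.
rewrite ge0_integralZr; first last.
- by rewrite lee_fin invr_ge0 pi_ge0.
- by move=> x _; rewrite lee_fin expR_ge0.
- by apply/measurable_EFinP; apply: measurable_funTS; apply: measurableT_comp.
- exact: measurable_itv.
rewrite int_exp mul1e -(fineK kap_fin) -EFinM => -[E]; congr (_%:E).
by rewrite -[RHS]mul1r E divfK// gt_eqF// pi_gt0.
Qed.

Lemma polar_integral (f : MR -> \bar R) : measurable_fun setT f -> (forall x, 0 <= f x)%E ->
  (\int[mu]_x \int[mu]_y f (x ^+ 2 + y ^+ 2)%R = pi%:E * \int[mu]_(t in `[0%R, +oo[) f t)%E.
Proof. by rewrite -kapE; exact: polar0. Qed.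
End Polar.

(** * Gaussian sums up to rotation *)

Section GaussianSums.
Context {R : realType}.
Notation MR := (measurableTypeR R).
Notation C := (MR * MR)%type.
Notation E := (C * C * C)%type.
Notation gam := (@gam R).

Definition vadd (x : R) (v w : E) : E :=
  ((x * v.1.1.1 + w.1.1.1, x * v.1.1.2 + w.1.1.2), (x * v.1.2.1 + w.1.2.1, x * v.1.2.2 + w.1.2.2),
   (x * v.2.1 + w.2.1, x * v.2.2 + w.2.2)).

(** The expectation of f at the sum of the vectors xi_v v over the weights v
of the list s, the xi_v being independent of law [gam]. A weight has three
complex coordinates, for the values of p + conj q, z p' and the conjugate of z
q'. *)
Fixpoint Egauss (s : seq E) (f : E -> \bar R) : \bar R :=
  if s is v :: s' then (\int[gam]_x Egauss s' (fun w => f (vadd x v w)))%E else f ((0,0),(0,0),(0,0)).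

Lemma Egauss_ge0 s f : (forall w, 0 <= f w)%E -> (0 <= Egauss s f)%E.
Proof.
elim: s f => [|v s IH] f f0 /=; first exact: f0.
by apply: integral_ge0 => x _; apply: IH => w; exact: f0.
Qed.

Lemma measurable_vadd d (T : measurableType d) (h : T -> MR) (k : T -> E) v :
  measurable_fun setT h -> measurable_fun setT k -> measurable_fun setT (fun t => vadd (h t) v (k t)).
Proof.
move=> mh mk.
have mk1 : measurable_fun setT (fun t => (k t).1) by apply: measurableT_comp.
have mk2 : measurable_fun setT (fun t => (k t).2) by apply: measurableT_comp.
have mk11 : measurable_fun setT (fun t => (k t).1.1) by apply: (measurableT_comp (f := fst)).
have mk12 : measurable_fun setT (fun t => (k t).1.2) by apply: (measurableT_comp (f := snd)).
have aux (c : R) (u : T -> MR) : measurable_fun setT u -> measurable_fun setT (fun t => h t * c + u t : MR).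
  by move=> mu'; apply: measurable_funD => //; apply: measurable_funM.
rewrite /vadd; apply: measurable_fun_pair; [apply: measurable_fun_pair|]; apply: measurable_fun_pair;
apply: aux; first [exact: (measurableT_comp measurable_fst)|exact: (measurableT_comp measurable_snd)].
Qed.

Lemma measurable_Egauss d (T : measurableType d) s (f : T * E -> \bar R) :
  measurable_fun setT f -> (forall w, 0 <= f w)%E ->
  measurable_fun setT (fun t => Egauss s (fun w => f (t, w))).
Proof.
elim: s d T f => [|v s IH] d T f mf f0 /=.
  by apply: measurableT_comp => //; exact: measurable_pair2.
have := IH _ (T * MR)%type (fun p => f (p.1.1, vadd p.1.2 v p.2)).
move=> /(_ _ (fun _ => f0 _)) H.
apply: (measurable_fun_fubini_tonelli_F (m2 := gam) (fun p : T * MR => Egauss s (fun w => f (p.1, vadd p.2 v w)))).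
- apply: H; apply: measurableT_comp => //; apply: measurable_fun_pair => //=.
    by apply: measurableT_comp => //; exact: measurableT_comp.
  by apply: measurable_vadd => //; exact: measurableT_comp.
- by move=> x; apply: Egauss_ge0.
Qed.

Definition eq_law (s s' : seq E) := forall f, measurable_fun setT f -> (forall w, 0 <= f w)%E -> Egauss s f = Egauss s' f.

Lemma eq_law_refl s : eq_law s s. Proof. by []. Qed.
Lemma eq_law_trans s1 s2 s3 : eq_law s1 s2 -> eq_law s2 s3 -> eq_law s1 s3.
Proof. by move=> h1 h2 f mf f0; rewrite h1// h2. Qed.
Lemma eq_law_sym s1 s2 : eq_law s1 s2 -> eq_law s2 s1.
Proof. by move=> h1 f mf f0; rewrite h1. Qed.

Lemma measurable_vadd1 x v (f : E -> \bar R) : measurable_fun setT f -> measurable_fun setT (fun w => f (vadd x v w)).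
Proof. by move=> mf; apply: measurableT_comp => //; apply: measurable_vadd. Qed.

Lemma eq_law_cons v s s' : eq_law s s' -> eq_law (v :: s) (v :: s').
Proof.
move=> h f mf f0 /=; apply: eq_integral => x _; apply: h => //.
exact: measurable_vadd1.
Qed.

Definition vlin (a b : R) (v w : E) : E := vadd a v (vadd b w ((0,0),(0,0),(0,0))).

Lemma vadd2 x y a b c d v w u : vadd x (vlin a b v w) (vadd y (vlin c d v w) u)
  = vadd (a * x + c * y) v (vadd (b * x + d * y) w u).
Proof. by rewrite /vlin /vadd /=; repeat congr (_, _); ring. Qed.

(** Two independent coordinates of law [gam] may be rotated; on the weights
this is the transposed rotation. *)
Lemma eq_law_givens a b c d v w s : a ^+ 2 + b ^+ 2 = 1 -> c ^+ 2 + d ^+ 2 = 1 -> a * c + b * d = 0 ->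
  eq_law (vlin a b v w :: vlin c d v w :: s) (v :: w :: s).
Proof.
move=> h1 h2 h3 f mf f0 /=.
pose F (p : MR * MR) := Egauss s (fun u => f (vadd p.1 v (vadd p.2 w u))).
rewrite -[RHS](@gam_orthogonal R F a c b d h1 h2 h3).
- apply: eq_integral => x _; apply: eq_integral => y _; rewrite /F /=; congr (Egauss s _).
  by apply/funext => u; rewrite vadd2.
- apply: (@measurable_Egauss _ _ s (fun q : (MR * MR) * E => f (vadd q.1.1 v (vadd q.1.2 w q.2)))) => //.
  apply: measurableT_comp => //; apply: measurable_vadd; first exact: measurableT_comp.
  by apply: measurable_vadd => //; exact: measurableT_comp.
- by move=> p; exact: Egauss_ge0.
Qed.

Lemma vlin10 v w : vlin 1 0 v w = v.
Proof. by case: v => [[[? ?] [? ?]] [? ?]]; case: w => [[[? ?] [? ?]] [? ?]]; rewrite /vlin /vadd/=; repeat congr (_, _); ring. Qed.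
Lemma vlin01 v w : vlin 0 1 v w = w.
Proof. by case: v => [[[? ?] [? ?]] [? ?]]; case: w => [[[? ?] [? ?]] [? ?]]; rewrite /vlin /vadd/=; repeat congr (_, _); ring. Qed.

Lemma eq_law_swap v w s : eq_law (w :: v :: s) (v :: w :: s).
Proof.
have := @eq_law_givens 0 1 1 0 v w s; rewrite vlin10 vlin01; apply; ring.
Qed.

Lemma eq_law_zero s : eq_law (((0,0),(0,0),(0,0)) :: s) s.
Proof.
move=> f mf f0 /=.
rewrite (_ : (fun x => _) = cst (Egauss s f)).
  by rewrite integral_cst// [X in (_ * X)%E](_ : _ = 1%E) ?mule1//; exact: (probability_setT gam).
apply/funext => x /=; congr (Egauss s _); apply/funext => w.
by case: w => [[[? ?] [? ?]] [? ?]]; rewrite /vadd/= !mulr0 !add0r.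
Qed.

Notation T3 := (R * R * R)%type.
Definition tlin (a b : R) (t t' : T3) : T3 :=
  (a * t.1.1 + b * t'.1.1, a * t.1.2 + b * t'.1.2, a * t.2 + b * t'.2).
(** A real triple t stands for the weight of a standard complex Gaussian: its
real part moves the three complex coordinates along the real axis, its
imaginary part along the imaginary axis. *)
Definition vre (t : T3) : E := ((t.1.1, 0), (t.1.2, 0), (t.2, 0)).
Definition vim (t : T3) : E := ((0, t.1.1), (0, t.1.2), (0, t.2)).
Definition dbl (ts : seq T3) : seq E := flatten [seq [:: vre t; vim t] | t <- ts].

Lemma vre_lin a b t t' : vre (tlin a b t t') = vlin a b (vre t) (vre t').
Proof. by rewrite /vre /vlin /vadd /=; repeat congr (_, _); ring. Qed.
Lemma vim_lin a b t t' : vim (tlin a b t t') = vlin a b (vim t) (vim t').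
Proof. by rewrite /vim /vlin /vadd /=; repeat congr (_, _); ring. Qed.

Definition eq_claw ts ts' := eq_law (dbl ts) (dbl ts').

Lemma eq_claw_refl s : eq_claw s s. Proof. exact: eq_law_refl. Qed.
Lemma eq_claw_trans s1 s2 s3 : eq_claw s1 s2 -> eq_claw s2 s3 -> eq_claw s1 s3.
Proof. exact: eq_law_trans. Qed.

Lemma eq_claw_cons v s s' : eq_claw s s' -> eq_claw (v :: s) (v :: s').
Proof. by move=> h; rewrite /eq_claw /dbl/=; do 2 apply: eq_law_cons. Qed.

Lemma eq_claw_zero s : eq_claw ((0, 0, 0) :: s) s.
Proof. exact: eq_law_trans (eq_law_zero _) (eq_law_zero _). Qed.

(** A real rotation of two complex Gaussians rotates their real parts and
their imaginary parts separately; swaps bring each pair together. *)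
Lemma eq_claw_givens a b c d v w s : a ^+ 2 + b ^+ 2 = 1 -> c ^+ 2 + d ^+ 2 = 1 -> a * c + b * d = 0 ->
  eq_claw (tlin a b v w :: tlin c d v w :: s) (v :: w :: s).
Proof.
move=> h1 h2 h3; rewrite /eq_claw /dbl/= !vre_lin !vim_lin.
set s0 := flatten _.
apply: eq_law_trans (_ : eq_law _ (vre v :: vre w :: vim v :: vim w :: s0)) _; last first.
  by apply: eq_law_cons; exact: eq_law_swap.
apply: eq_law_trans (eq_law_cons _ (eq_law_swap _ _ _)) _.
apply: eq_law_trans (eq_law_givens _ _ _ h1 h2 h3) _.
by do 2 apply: eq_law_cons; exact: eq_law_givens.
Qed.

Definition linf (f : T3 -> R) := forall a b t t', f (tlin a b t t') = a * f t + b * f t'.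
(** For coordinates f and g of the weights, the covariance of the
corresponding coordinates of the Gaussian vector. *)
Definition gram (f g : T3 -> R) (ts : seq T3) := \sum_(t <- ts) f t * g t.

Lemma gram_givens f g a b c d v w s : linf f -> linf g ->
  a ^+ 2 + c ^+ 2 = 1 -> b ^+ 2 + d ^+ 2 = 1 -> a * b + c * d = 0 ->
  gram f g (tlin a b v w :: tlin c d v w :: s) = gram f g (v :: w :: s).
Proof.
move=> lf lg h1 h2 h3; rewrite /gram !big_cons !addrA; congr (_ + _).
rewrite !lf !lg.
transitivity ((a ^+ 2 + c ^+ 2) * (f v * g v) + (b ^+ 2 + d ^+ 2) * (f w * g w) +
  (a * b + c * d) * (f v * g w + f w * g v)); first by ring.
by rewrite h1 h2 h3; ring.
Qed.

(** Gram-Schmidt orthogonalisation: successive rotations cancel the coordinate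
f in every weight but one. They preserve the covariances, and a coordinate
that vanishes on all weights keeps doing so. *)
Lemma eq_claw_isolate (f : T3 -> R) ts : linf f -> exists x ts',
  [/\ eq_claw ts (x :: ts'), all (fun t => f t == 0) ts',
   forall g h, linf g -> linf h -> gram g h ts = gram g h (x :: ts') &
   forall g, linf g -> all (fun t => g t == 0) ts -> all (fun t => g t == 0) (x :: ts')].
Proof.
move=> lf; elim: ts => [|y ts [x [ts' [h1 h2 h3 h4]]]].
  exists (0, 0, 0), [::]; split => //.
  - by apply: eq_law_sym; exact: eq_claw_zero.
  - move=> g h lg lh; rewrite /gram big_nil big_cons big_nil.
    have := lg 0 0 (0,0,0) (0,0,0); rewrite /tlin/= !mul0r addr0 => ->.
    by rewrite mul0r addr0.
  - by move=> g lg _ /=; have := lg 0 0 (0,0,0) (0,0,0); rewrite /tlin/= !mul0r addr0 => ->; rewrite eqxx.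
have G g h : linf g -> linf h -> gram g h (y :: ts) = gram g h (y :: x :: ts').
  by move=> lg lh; rewrite /gram big_cons [in RHS]big_cons; congr (_ + _); exact: h3.
have [n0|n0] := eqVneq (f y ^+ 2 + f x ^+ 2) 0.
  have /andP[fy fx] : (f y == 0) && (f x == 0).
    by rewrite -(sqrf_eq0 (f y)) -(sqrf_eq0 (f x)) -paddr_eq0 ?sqr_ge0// n0.
  exists y, (x :: ts'); split => //; first exact: eq_claw_cons.
    by rewrite /= fx.
  by move=> g lg /= /andP[-> /(h4 _ lg)].
have np : 0 < f y ^+ 2 + f x ^+ 2 by rewrite lt_neqAle eq_sym n0 addr_ge0// sqr_ge0.
set n := Num.sqrt (f y ^+ 2 + f x ^+ 2).
have nn0 : n != 0 by rewrite gt_eqF// sqrtr_gt0.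
have n2 : n ^+ 2 = f y ^+ 2 + f x ^+ 2 by rewrite sqr_sqrtr// ltW.
set c := f y / n; set s := f x / n.
have cs : c ^+ 2 + s ^+ 2 = 1 by rewrite !expr_div_n -mulrDl -n2 divff// expf_neq0.
exists (tlin c s y x), (tlin (- s) c y x :: ts'); split.
- apply: eq_claw_trans (eq_claw_cons _ h1) _ => F mF F0.
  rewrite (eq_claw_givens _ _ _ _ _ _ mF F0)//; first by rewrite sqrrN addrC.
  by ring.
- rewrite /= h2 andbT lf /c /s; apply/eqP; field => //.
- move=> g h lg lh; rewrite G// gram_givens//; first by rewrite sqrrN.
  + by rewrite addrC.
  + by ring.
- move=> g lg /= /andP[/eqP gy /(h4 _ lg)/= /andP[/eqP gx ->]].
  by rewrite !lg gy gx !mulr0 addr0 eqxx.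
Qed.

End GaussianSums.

(** * The mean of the positive part of a difference of squares *)

Section ExpInt.
Context {R : realType}.
Notation mu := (@lebesgue_measure R).
Notation MR := (measurableTypeR R).
Notation gam := (@gam R).

Lemma exp_integral (c : R) : 0 < c -> (\int[mu]_(t in `[0%R, +oo[) (expR (- (c * t)))%:E = c^-1%:E)%E.
Proof.
move=> c0.
have := integral_exponential_pdf c0.
rewrite (_ : (fun x => _) = (fun x => (c * expR (- c * x))%:E) \_ `[0%R, +oo[); last first.
  by apply/funext => x; rewrite /exponential_pdf !patchE; case: ifP.
rewrite -integral_mkcond.
under eq_integral do rewrite EFinM.
rewrite ge0_integralZl; first last.
- by rewrite lee_fin ltW.
- by move=> x _; rewrite lee_fin expR_ge0.
- by apply/measurable_EFinP; apply: measurable_funTS; apply: measurableT_comp => //; apply: measurable_funM.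
- exact: measurable_itv.
rewrite (_ : (\int[mu]_(x in _) _)%E = (\int[mu]_(t in `[0%R, +oo[) (expR (- (c * t)))%:E)%E); last first.
  by apply: eq_integral => x _; rewrite mulNr.
have : (0 <= \int[mu]_(t in `[0%R, +oo[) (expR (- (c * t)))%:E)%E.
  by apply: integral_ge0 => x _; rewrite lee_fin expR_ge0.
case: (integral _ _ _) => [r| |] //; last by rewrite gt0_muley ?lte_fin.
by rewrite -EFinM => _ -[E]; apply: congr1; rewrite -[RHS]mulr1 -E mulKf// gt_eqF.
Qed.

Lemma xexp_integral : (\int[mu]_(t in `[0%R, +oo[) (t * expR (- t))%:E = 1 :> \bar R)%E.
Proof.
rewrite (@ge0_continuous_FTC2y _ _ (fun x => - ((x + 1) * expR (- x))) _ 0).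
- by rewrite oppr0 expR0 mulr1 add0r EFinN oppeK add0r.
- by move=> x x0; rewrite mulr_ge0// expR_ge0.
- apply: continuous_subspaceT => x; apply: cvgM => //.
  by apply: continuous_comp; [exact: opp_continuous|exact: continuous_expR].
- rewrite -oppr0; apply: cvgN.
  apply: (@squeeze_cvgr _ _ _ _ (cst 0) (fun x => 2 * expR (- (x / 2)))).
  + near=> x; have x0 : 0 <= x by near: x; apply: nbhs_pinfty_ge.
    rewrite /cst mulr_ge0 ?expR_ge0 ?addr_ge0//=.
    rewrite (_ : - x = - (x / 2) - x / 2); last by field.
    rewrite expRD mulrA ler_wpM2r ?expR_ge0//.
    rewrite expRN ler_pdivrMr ?expR_gt0//.
    have := expR_ge1Dx (x / 2); nra.
  + exact: cvg_cst.
  + rewrite -[X in _ --> X](mulr0 2); apply: cvgM; first exact: cvg_cst.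
    apply: (@cvg_comp _ _ _ (fun x => x / 2) (fun z => expR (- z)) _ (pinfty_nbhs R)); last exact: cvgr_expR.
    by apply: gt0_cvgMly.
- by move=> x _; apply: derivableN; apply: derivableM => //; apply: ex_derive.
- apply: cvgN; apply: cvg_at_right_filter; apply: cvgM; first by apply: cvgD => //; exact: cvg_cst.
  by apply: continuous_comp; [exact: opp_continuous|exact: continuous_expR].
- move=> z _; rewrite derive1E.
  have D : is_derive z 1 (fun x : R => - ((x + 1) * expR (- x))) (z * expR (- z)).
    apply: is_derive_eq; rewrite /GRing.scale/=; ring.
  by rewrite derive_val.
Unshelve. all: by end_near. Qed.

Lemma integral_itv0y (h : MR -> \bar R) : (forall x, x < 0 -> h x = 0%E) ->
  (\int[mu]_(t in `[0%R, +oo[) h t = \int[mu]_t h t)%E.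
Proof.
move=> h0; rewrite integral_mkcond; apply: eq_integral => t _; rewrite patchE mem_setE in_itv/= andbT.
by have [|/h0 ->] := leP 0 t.
Qed.

(** The integrand vanishes for t < c / a, and the translation by c / a takes
out the factor exp (- c / a). *)
Lemma posexp_integral (a c : R) : 0 < a -> 0 <= c ->
  (\int[mu]_(t in `[0%R, +oo[) (Num.max 0 (a * t - c) * expR (- t))%:E = (a * expR (- (c / a)))%:E)%E.
Proof.
move=> a0 c0; rewrite integral_itv0y; last first.
  by move=> x x0; congr (_%:E); rewrite (elimT max_idPl) ?mul0r//; nra.
have mm (u v : R) : measurable_fun setT (fun t : MR => (Num.max 0 (u * t - v) * expR (- t))%:E).
  apply/measurable_EFinP; apply: measurable_funM; last by apply: measurableT_comp.
  by apply: measurable_maxr => //; apply: measurable_funB => //; apply: measurable_funM.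
rewrite -(@affine_integral R 1 (c / a)); first last.
- by move=> x; rewrite lee_fin mulr_ge0 ?expR_ge0// le_max lexx.
- exact: mm.
- exact: oner_neq0.
rewrite normr1 mul1e.
transitivity (\int[mu]_t ((a * expR (- (c / a)))%:E * (Num.max 0 (1 * t - 0) * expR (- t))%:E))%E.
  apply: eq_integral => t _; rewrite -EFinM; congr (_%:E).
  rewrite mul1r opprD expRD subr0 (_ : a * (t + c / a) - c = a * t); last by field; rewrite gt_eqF.
  have -> : Num.max 0 (a * t) = a * Num.max 0 t by rewrite maxr_pMr ?ltW// mulr0.
  ring.
rewrite ge0_integralZl; first last.
- by rewrite lee_fin mulr_ge0 ?expR_ge0// ltW.
- by move=> x _; rewrite lee_fin mulr_ge0 ?expR_ge0// le_max lexx.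
- exact: mm.
- exact: measurableT.
rewrite -[RHS]mule1 -xexp_integral; apply: (congr1 (fun z => (a * expR (- (c / a)))%:E * z)%E).
rewrite -integral_itv0y; last first.
  by move=> x x0; congr (_%:E); rewrite (elimT max_idPl) ?mul0r//; lra.
apply: eq_integral => t; rewrite mem_setE in_itv/= andbT => t0; congr (_%:E).
by rewrite mul1r subr0 (elimT max_idPr).
Qed.

(** The squared modulus of a complex Gaussian of variance 1 is exponential
with parameter 1. *)
Lemma gam_polar (f : MR -> \bar R) : measurable_fun setT f -> (forall x, 0 <= f x)%E ->
  (\int[gam]_x \int[gam]_y f (x ^+ 2 + y ^+ 2)%R = \int[mu]_(t in `[0%R, +oo[) (f t * (expR (- t))%:E))%E.
Proof.
move=> mf f0.
rewrite (@gam_integral2 R (fun p => f (p.1 ^+ 2 + p.2 ^+ 2)%R)); first last.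
- by move=> x; exact: f0.
- by apply: measurableT_comp => //; apply: measurable_funD; apply: measurable_funX.
rewrite (@polar_integral R (fun t => f t * (expR (- t) / pi)%:E)%E); first last.
- by move=> x; rewrite mule_ge0// lee_fin divr_ge0 ?expR_ge0 ?pi_ge0.
- by apply: emeasurable_funM => //; apply/measurable_EFinP; apply: measurable_funM => //; apply: measurableT_comp.
rewrite -ge0_integralZl; first last.
- by rewrite lee_fin pi_ge0.
- by move=> x _; rewrite mule_ge0// lee_fin divr_ge0 ?expR_ge0 ?pi_ge0.
- by apply: measurable_funTS; apply: emeasurable_funM => //; apply/measurable_EFinP; apply: measurable_funM => //; apply: measurableT_comp.
- exact: measurable_itv.
apply: eq_integral => t _; rewrite muleCA -EFinM; congr (_ * _%:E)%E.
by rewrite mulrC divfK// gt_eqF// pi_gt0.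
Qed.

(** With X and Y independent and exponential of parameter 1, the mean of the
positive part of a X - b Y given Y is a exp (- b Y / a); averaging over Y
gives a^2 / (a + b). *)
Lemma gam4_difference (a b : R) : 0 <= a -> 0 <= b ->
  (\int[gam]_y1 \int[gam]_y2 \int[gam]_x1 \int[gam]_x2
   (Num.max 0 (a * (x1 ^+ 2 + x2 ^+ 2) - b * (y1 ^+ 2 + y2 ^+ 2)))%:E = (a ^+ 2 / (a + b))%:E)%E.
Proof.
move=> a0 b0.
have [->|an] := eqVneq a 0.
  rewrite expr0n/= mul0r (_ : (fun y1 => _) = cst 0%E) ?integral0//.
  apply/funext => y1; rewrite (_ : (fun y2 => _) = cst 0%E) ?integral0//.
  apply/funext => y2; rewrite (_ : (fun x1 => _) = cst 0%E) ?integral0//.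
  apply/funext => x1; rewrite (_ : (fun x2 => _) = cst 0%E) ?integral0//.
  apply/funext => x2; congr (_%:E); rewrite (elimT max_idPl)// mul0r sub0r oppr_le0.
  by rewrite mulr_ge0// addr_ge0// sqr_ge0.
have ap : 0 < a by rewrite lt_neqAle eq_sym an.
transitivity (\int[gam]_y1 \int[gam]_y2 (a * expR (- (b / a * (y1 ^+ 2 + y2 ^+ 2))))%:E)%E.
  apply: eq_integral => y1 _; apply: eq_integral => y2 _.
  have u0 : 0 <= b * (y1 ^+ 2 + y2 ^+ 2) by rewrite mulr_ge0// addr_ge0// sqr_ge0.
  rewrite (@gam_polar (fun t => (Num.max 0 (a * t - b * (y1 ^+ 2 + y2 ^+ 2)))%:E)).
  - by rewrite mulrAC; exact: posexp_integral.
  - apply/measurable_EFinP; apply: measurable_maxr => //.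
    by apply: measurable_funB => //; apply: measurable_funM.
  - by move=> t; rewrite lee_fin le_max lexx.
have me (c : R) : measurable_fun setT (fun t : MR => (a * expR (- (c * t)))%:E).
  apply/measurable_EFinP; apply: measurable_funM => //; apply: measurableT_comp => //.
  by apply: measurableT_comp => //; apply: measurable_funM.
rewrite (@gam_polar (fun t => (a * expR (- (b / a * t)))%:E)); first last.
- by move=> t; rewrite lee_fin mulr_ge0// expR_ge0.
- exact: me.
transitivity (\int[mu]_(t in `[0%R, +oo[) (a%:E * (expR (- ((b / a + 1) * t)))%:E))%E.
  apply: eq_integral => t _; rewrite -!EFinM; congr (_%:E).
  by rewrite -[LHS]mulrA -expRD; congr (_ * expR _); ring.
rewrite ge0_integralZl; first last.
- by rewrite lee_fin.
- by move=> t _; rewrite lee_fin expR_ge0.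
- apply: measurable_funTS; apply/measurable_EFinP; apply: measurableT_comp => //.
  by apply: measurableT_comp => //; apply: measurable_funM.
- exact: measurable_itv.
have ab : 0 < b / a + 1 by rewrite ltr_wpDl// divr_ge0.
rewrite exp_integral// -EFinM; congr (_%:E); field.
by rewrite an andbT gt_eqF// ltr_pwDl.
Qed.
End ExpInt.

Section GaussValue.
Context {R : realType}.
Notation mu R := (@lebesgue_measure R).
Notation MR := (measurableTypeR R).
Notation C := (MR * MR)%type.
Notation E := (C * C * C)%type.
Notation T3 := (R * R * R)%type.
Notation gam := (@gam R).

Definition sqn (c : C) : R := c.1 ^+ 2 + c.2 ^+ 2.
Definition posdiff (s : R) (w : E) : R := Num.max 0 (s * (sqn w.1.2 - sqn w.2)).
(** The mean of the positive part of a Hermitian form in a complex Gaussian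
vector, when the form has trace d and determinant - D: its eigenvalues are
then l and - l' with l - l' = d and l l' = D, and the value is l^2 / (l + l')
by [gam4_difference]. *)
Definition posdiff_mean (d D : R) : R := ((Num.sqrt (d ^+ 2 + 4 * D) + d) / 2) ^+ 2 / Num.sqrt (d ^+ 2 + 4 * D).

Notation cg := (fun t : T3 => t.1.1).
Notation cp := (fun t : T3 => t.1.2).
Notation cq := (fun t : T3 => t.2).

Lemma linf_g : linf cg. Proof. by []. Qed.
Lemma linf_p : linf cp. Proof. by []. Qed.
Lemma linf_q : linf cq. Proof. by []. Qed.

Lemma measurable_sqn d (T : measurableType d) (h : T -> C) : measurable_fun setT h -> measurable_fun setT (fun t => sqn (h t) : MR).
Proof.
move=> mh; apply: measurable_funD; apply: measurable_funX.
  exact: (measurableT_comp measurable_fst).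
exact: (measurableT_comp measurable_snd).
Qed.

Lemma measurable_posdiff s : measurable_fun setT (fun w : E => posdiff s w : MR).
Proof.
apply: measurable_maxr => //; apply: measurable_funM => //; apply: measurable_funB; apply: measurable_sqn => //.
exact: (measurableT_comp measurable_snd).
Qed.

Lemma posdiff_ge0 s w : 0 <= posdiff s w.
Proof. by rewrite /posdiff le_max lexx. Qed.

Lemma eq_claw_swap (v w : T3) s : eq_claw (w :: v :: s) (v :: w :: s).
Proof.
have := @eq_claw_givens R 0 1 1 0 v w s; rewrite !expr0n !expr1n !mulr0 !mul0r !addr0 add0r.
move=> /(_ erefl erefl erefl).
rewrite (_ : tlin 0 1 v w = w) 1?(_ : tlin 1 0 v w = v)//; move: v w => [[? ?] ?] [[? ?] ?]; rewrite /tlin/=; repeat congr (_, _); ring.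
Qed.

(** The hypothesis p1 p2 = q1 q2 says that the two weights are orthogonal for
the form p^2 - q^2, which thus splits into multiples of two independent
squared moduli; their coefficients have opposite signs, up to exchanging the
two. *)
Lemma posdiff_mean2 s (p1 q1 p2 q2 : R) : s ^+ 2 = 1 -> p1 * p2 = q1 * q2 ->
  Egauss (dbl [:: (0, p1, q1); (0, p2, q2)]) (fun w => (posdiff s w)%:E) =
  (posdiff_mean (s * (p1 ^+ 2 + p2 ^+ 2 - (q1 ^+ 2 + q2 ^+ 2)))
    ((p1 ^+ 2 + p2 ^+ 2) * (q1 ^+ 2 + q2 ^+ 2) - (p1 * q1 + p2 * q2) ^+ 2))%:E.
Proof.
move=> s1 pq.
wlog h : p1 q1 p2 q2 pq / s * (p1 ^+ 2 - q1 ^+ 2) <= 0 /\ 0 <= s * (p2 ^+ 2 - q2 ^+ 2).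
  move=> H.
  have Hm : (s * (p1 ^+ 2 - q1 ^+ 2)) * (s * (p2 ^+ 2 - q2 ^+ 2)) <= 0.
    rewrite (_ : _ * _ = - s ^+ 2 * (p1 * q2 - q1 * p2) ^+ 2 + s ^+ 2 * (p1 * p2 - q1 * q2) ^+ 2); last by ring.
    by rewrite pq subrr expr0n mulr0 addr0 mulNr oppr_le0 mulr_ge0// sqr_ge0.
  have [h1|h1] := leP (s * (p1 ^+ 2 - q1 ^+ 2)) 0; last first.
    have := H p2 q2 p1 q1; rewrite mulrC [X in _ = X -> _]mulrC => /(_ pq).
    have smoothed : s * (p2 ^+ 2 - q2 ^+ 2) <= 0 /\ 0 <= s * (p1 ^+ 2 - q1 ^+ 2) by split; nra.
    move=> /(_ smoothed) H'.
    transitivity (Egauss (dbl [:: (0, p2, q2); (0, p1, q1)]) (fun w => (posdiff s w)%:E)).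
      apply: eq_claw_swap.
      - by apply/measurable_EFinP; exact: measurable_posdiff.
      - by move=> w; rewrite lee_fin posdiff_ge0.
    by rewrite H'; congr (posdiff_mean (s * _) _)%:E; ring.
  have [h2|h2] := leP 0 (s * (p2 ^+ 2 - q2 ^+ 2)); first exact: H.
  (* both forms are nonpositive, so the first one vanishes *)
  have h1' : s * (p1 ^+ 2 - q1 ^+ 2) = 0 by nra.
  have := H p2 q2 p1 q1; rewrite mulrC [X in _ = X -> _]mulrC => /(_ pq).
  rewrite h1' lexx => /(_ (conj (ltW h2) erefl)) H'.
  transitivity (Egauss (dbl [:: (0, p2, q2); (0, p1, q1)]) (fun w => (posdiff s w)%:E)).
    apply: eq_claw_swap.
    - by apply/measurable_EFinP; exact: measurable_posdiff.
    - by move=> w; rewrite lee_fin posdiff_ge0.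
  by rewrite H'; congr (posdiff_mean (s * _) _)%:E; ring.
case: h => h1 h2.
set a := s * (p2 ^+ 2 - q2 ^+ 2) in h2 *; set b := - (s * (p1 ^+ 2 - q1 ^+ 2)).
have b0 : 0 <= b by rewrite oppr_ge0.
transitivity ((a ^+ 2 / (a + b))%:E).
  rewrite -(gam4_difference h2 b0) /dbl/=.
  apply: eq_integral => y1 _; apply: eq_integral => y2 _; apply: eq_integral => x1 _; apply: eq_integral => x2 _.
  congr (_%:E); rewrite /posdiff; congr (Num.max _ _); rewrite /vadd /vre /vim /sqn/= /a /b.
  transitivity (s * (p2 ^+ 2 - q2 ^+ 2) * (x1 ^+ 2 + x2 ^+ 2) - - (s * (p1 ^+ 2 - q1 ^+ 2)) * (y1 ^+ 2 + y2 ^+ 2) + s *+ 2 * (p1 * p2 - q1 * q2) * (x1 * y1 + x2 * y2)); first by ring.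
  by rewrite pq subrr mulr0 mul0r addr0.
have -> : (p1 ^+ 2 + p2 ^+ 2) * (q1 ^+ 2 + q2 ^+ 2) - (p1 * q1 + p2 * q2) ^+ 2 = a * b.
  rewrite /a /b; transitivity (- s ^+ 2 * ((p1 ^+ 2 - q1 ^+ 2) * (p2 ^+ 2 - q2 ^+ 2))); last by ring.
  rewrite s1; transitivity ((p1 * q2 - q1 * p2) ^+ 2); first by ring.
  transitivity ((p1 * q2 - q1 * p2) ^+ 2 - (p1 * p2 - q1 * q2) ^+ 2); last by ring.
  by rewrite pq subrr expr0n subr0.
have -> : s * (p1 ^+ 2 + p2 ^+ 2 - (q1 ^+ 2 + q2 ^+ 2)) = a - b by rewrite /a /b; ring.
rewrite /posdiff_mean (_ : (a - b) ^+ 2 + 4 * (a * b) = (a + b) ^+ 2); last by ring.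
rewrite sqrtr_sqr ger0_norm ?addr_ge0//.
by congr (_ ^+ 2 / _)%:E; field.
Qed.

(** If all weights vanish in the first coordinate, so does the Gaussian
vector. *)
Lemma Egauss_supp (s : seq E) (f f' : E -> \bar R) : all (fun v : E => v.1.1 == (0, 0)) s ->
  (forall w, w.1.1 = (0, 0) -> f w = f' w) -> Egauss s f = Egauss s f'.
Proof.
elim: s f f' => [|v s IH] f f' /=; first by move=> _ ->.
move=> /andP[/eqP v0 s0] ff'; apply: eq_integral => x _; apply: IH => // w w0; apply: ff'.
by rewrite /vadd/= v0 w0 /= mulr0 addr0.
Qed.

Lemma Egauss_scale (s : seq E) (k : \bar R) (f : E -> \bar R) : (0 <= k)%E -> measurable_fun setT f -> (forall w, 0 <= f w)%E ->
  Egauss s (fun w => k * f w)%E = (k * Egauss s f)%E.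
Proof.
move=> k0; elim: s f => [|v s IH] f mf f0 //=.
rewrite -ge0_integralZl; first last.
- exact: k0.
- by move=> x _; exact: Egauss_ge0.
- apply: (@measurable_Egauss R _ MR s (fun p => f (vadd p.1 v p.2))) => //.
  by apply: measurableT_comp => //; apply: measurable_vadd.
- exact: measurableT.
by apply: eq_integral => x _; apply: IH => //; exact: measurable_vadd1.
Qed.

(** The factor exp (- nu^2 |xi|^2) turns the Gaussian density into that of a
Gaussian of variance 1 / (1 + nu^2), up to its mass. *)
Lemma gauss_tilt (nu : R) (K : MR * MR -> \bar R) : measurable_fun setT K -> (forall x, 0 <= K x)%E ->
  (\int[gam]_x \int[gam]_y ((expR (- ((x * nu) ^+ 2 + (y * nu) ^+ 2)) / pi)%:E * K (x, y)) =
   ((pi * (1 + nu ^+ 2))^-1)%:E *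
   \int[gam]_x \int[gam]_y K ((x / Num.sqrt (1 + nu ^+ 2))%R, (y / Num.sqrt (1 + nu ^+ 2))%R))%E.
Proof.
move=> mK K0; set V := 1 + nu ^+ 2.
have V0 : 0 < V by rewrite ltr_pwDl// sqr_ge0.
have sV0 : Num.sqrt V != 0 by rewrite gt_eqF// sqrtr_gt0.
have sV2 : Num.sqrt V ^+ 2 = V by rewrite sqr_sqrtr// ltW.
have p0 : 0 < pi :> R by exact: pi_gt0.
have mE : measurable_fun setT (fun p : MR * MR => (expR (- ((p.1 * nu) ^+ 2 + (p.2 * nu) ^+ 2)) / pi)%:E).
  apply/measurable_EFinP; apply: measurable_funM => //; apply: measurableT_comp => //.
  apply: measurableT_comp => //; apply: measurable_funD; apply: measurable_funX; exact: measurable_funM.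
have E0 (p : MR * MR) : (0 <= (expR (- ((p.1 * nu) ^+ 2 + (p.2 * nu) ^+ 2)) / pi)%:E)%E.
  by rewrite lee_fin divr_ge0 ?expR_ge0 ?ltW.
have mg : measurable_fun setT (fun p : MR * MR => (expR (- (p.1 ^+ 2 + p.2 ^+ 2)) / pi)%:E).
  by apply/measurable_EFinP; exact: measurable_gauss2.
have g0 (p : MR * MR) : (0 <= (expR (- (p.1 ^+ 2 + p.2 ^+ 2)) / pi)%:E)%E.
  by rewrite lee_fin divr_ge0 ?expR_ge0 ?ltW.
have mK' : measurable_fun setT (fun p : MR * MR => K ((p.1 / Num.sqrt V)%R, (p.2 / Num.sqrt V)%R)).
  by apply: measurableT_comp => //; apply: measurable_fun_pair; apply: measurable_funM.
rewrite (@gam_integral2 R (fun p => (expR (- ((p.1 * nu) ^+ 2 + (p.2 * nu) ^+ 2)) / pi)%:E * K p)%E); first last.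
- by move=> p; rewrite mule_ge0.
- exact: emeasurable_funM.
rewrite (@gam_integral2 R (fun p => K ((p.1 / Num.sqrt V)%R, (p.2 / Num.sqrt V)%R))); [|exact: mK'|by []].
pose F (p : MR * MR) := ((expR (- ((p.1 * nu) ^+ 2 + (p.2 * nu) ^+ 2)) / pi)%:E * K p * (expR (- (p.1 ^+ 2 + p.2 ^+ 2)) / pi)%:E)%E.
have mF : measurable_fun setT F by apply: emeasurable_funM => //; exact: emeasurable_funM.
have F0 p : (0 <= F p)%E by rewrite !mule_ge0.
rewrite -[LHS](@linear_integral2 R F (Num.sqrt V)^-1 0 0 (Num.sqrt V)^-1); first last.
- exact: F0.
- exact: mF.
- by rewrite mul0r subr0 mulf_neq0// invr_eq0.
have -> : `|(Num.sqrt V)^-1 / Num.sqrt V - 0 * 0| = V^-1.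
  by rewrite mul0r subr0 -invfM -expr2 sV2 ger0_norm ?invr_ge0 ?ltW.
have -> : ((pi * V)^-1)%:E = (V^-1%:E * (pi^-1)%:E)%E by rewrite -EFinM invfM mulrC.
rewrite -muleA; apply: (congr1 (fun z => V^-1%:E * z)%E).
have E2 x : (\int[mu R]_y (K ((x / Num.sqrt V)%R, (y / Num.sqrt V)%R) * (expR (- (x ^+ 2 + y ^+ 2)) / pi)%:E) * (pi^-1)%:E =
   \int[mu R]_y F (((Num.sqrt V)^-1 * x + 0 * y)%R, (0 * x + (Num.sqrt V)^-1 * y)%R))%E.
  rewrite -ge0_integralZr; first last.
  - by rewrite lee_fin invr_ge0 ltW.
  - by move=> y _; apply: mule_ge0; [exact: K0|exact: (g0 (x, y))].
  - apply: emeasurable_funM; first exact: (measurableT_comp mK' (measurable_pair1 x)).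
    exact: (measurableT_comp mg (measurable_pair1 x)).
  - exact: measurableT.
  apply: eq_integral => y _; rewrite /F/= !mul0r addr0 add0r [_^-1 * x]mulrC [_^-1 * y]mulrC.
  rewrite [RHS]muleAC -EFinM [RHS]muleC -muleA -EFinM; apply: (congr1 (fun z => K _ * z%:E)%E).
  rewrite mulrACA -expRD mulrA; congr (expR _ / _ / _).
  rewrite !exprMn !exprVn sV2 /V; field; rewrite gt_eqF//.
symmetry; rewrite muleC -ge0_integralZr; first last.
- by rewrite lee_fin invr_ge0 ltW.
- by move=> x _; apply: integral_ge0 => y _; apply: mule_ge0; [exact: K0|exact: (g0 (x, y))].
- apply: (@measurable_integral_r R (fun p => K ((p.1 / Num.sqrt V)%R, (p.2 / Num.sqrt V)%R) * (expR (- (p.1 ^+ 2 + p.2 ^+ 2)) / pi)%:E)%E).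
    exact: emeasurable_funM.
  by move=> p; apply: mule_ge0; [exact: K0|exact: (g0 p)].
- exact: measurableT.
by apply: eq_integral => x _; exact: E2.
Qed.

Lemma eq_claw_allzero (ts : seq T3) : all (fun t : T3 => t.1.1 == 0) ts -> all (fun t : T3 => t.1.2 == 0) ts ->
  all (fun t : T3 => t.2 == 0) ts -> eq_claw ts [::].
Proof.
elim: ts => [|[[g p] q] ts IH]; first by move=> _ _ _; exact: eq_claw_refl.
rewrite /=.
move=> /andP[/eqP-> h1] /andP[/eqP-> h2] /andP[/eqP-> h3].
exact: eq_claw_trans (eq_claw_zero _) (IH h1 h2 h3).
Qed.

(** A rotation diagonalises the symmetric matrix with rows (a, b) and (b, d):
a + w is an eigenvalue and (b, w) an eigenvector. *)
Lemma symmetric_diag (a b d : R) : exists c s : R, c ^+ 2 + s ^+ 2 = 1 /\ c * s * (d - a) + (c ^+ 2 - s ^+ 2) * b = 0.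
Proof.
have [b0|b0] := eqVneq b 0.
  by exists 1, 0; rewrite b0; split; ring.
pose w := (d - a + Num.sqrt ((a - d) ^+ 2 + 4 * b ^+ 2)) / 2.
have De : 0 <= (a - d) ^+ 2 + 4 * b ^+ 2 by rewrite addr_ge0 ?sqr_ge0// mulr_ge0// sqr_ge0.
have wE : w ^+ 2 + (a - d) * w - b ^+ 2 = 0.
  transitivity ((Num.sqrt ((a - d) ^+ 2 + 4 * b ^+ 2) ^+ 2 - (a - d) ^+ 2) / 4 - b ^+ 2).
    by rewrite /w; move: (Num.sqrt _) => r; field.
  by rewrite sqr_sqrtr//; field.
clearbody w.
have n0 : 0 < b ^+ 2 + w ^+ 2 by rewrite ltr_pwDl ?sqr_ge0// exprn_even_gt0.
have nn : Num.sqrt (b ^+ 2 + w ^+ 2) != 0 by rewrite gt_eqF// sqrtr_gt0.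
have n2 : Num.sqrt (b ^+ 2 + w ^+ 2) ^+ 2 = b ^+ 2 + w ^+ 2 by rewrite sqr_sqrtr// ltW.
exists (b / Num.sqrt (b ^+ 2 + w ^+ 2)), (w / Num.sqrt (b ^+ 2 + w ^+ 2)).
move: (Num.sqrt _) nn n2 => n nn n2; split.
  by rewrite !expr_div_n -mulrDl -n2 divff// expf_neq0.
transitivity (- b * (w ^+ 2 + (a - d) * w - b ^+ 2) / n ^+ 2); first by field.
by rewrite wE mulr0 mul0r.
Qed.

(** Isolating the second and then the third coordinate leaves two complex
Gaussians; a last rotation makes their weights orthogonal for the form p^2 -
q^2, as [posdiff_mean2] requires. Trace and determinant of the form are read
off from the Gram sums. *)
Lemma posdiff_value s ts : s ^+ 2 = 1 -> all (fun t : T3 => t.1.1 == 0) ts ->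
  Egauss (dbl ts) (fun w => (posdiff s w)%:E) =
  (posdiff_mean (s * (gram cp cp ts - gram cq cq ts)) (gram cp cp ts * gram cq cq ts - gram cp cq ts ^+ 2))%:E.
Proof.
move=> s1 ts0.
have mJ : measurable_fun setT (fun w : E => (posdiff s w)%:E) by apply/measurable_EFinP; exact: measurable_posdiff.
have J0 (w : E) : (0 <= (posdiff s w)%:E)%E by rewrite lee_fin posdiff_ge0.
have [x1 [ts1 [e1 z1 G1 P1]]] := eq_claw_isolate ts linf_p.
have [x2 [ts2 [e2 z2 G2 P2]]] := eq_claw_isolate ts1 linf_q.
have /andP[g1 ts1g] := P1 _ linf_g ts0.
have /andP[g2 ts2g] := P2 _ linf_g ts1g.
have /andP[p2 ts2p] := P2 _ linf_p z1.
have e3 : eq_claw ts [:: x1; x2].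
  apply: eq_claw_trans e1 _; apply: eq_claw_cons; apply: eq_claw_trans e2 _; apply: eq_claw_cons.
  exact: eq_claw_allzero.
have G3 g h : linf g -> linf h -> gram g h ts = gram g h [:: x1; x2].
  move=> lg lh; rewrite G1// /gram !big_cons big_nil; congr (_ + _).
  have := G2 _ _ lg lh; rewrite /gram => ->; rewrite big_cons; congr (_ + _).
  rewrite big1_seq// => t /= tin.
  have t0 : t = (0, 0, 0).
    move/allP : ts2g => /(_ _ tin)/eqP; move/allP : ts2p => /(_ _ tin)/eqP; move/allP: z2 => /(_ _ tin)/eqP.
    by case: (t) => [[? ?] ?] /= -> -> ->.
  have := lg 0 0 t t; rewrite {1}/tlin t0/= !mul0r addr0 => ->.
  by rewrite mul0r.
have [c [sn [cs od]]] := symmetric_diag (x1.1.2 ^+ 2 - x1.2 ^+ 2) (x1.1.2 * x2.1.2 - x1.2 * x2.2) (x2.1.2 ^+ 2 - x2.2 ^+ 2).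
have c1 : (- sn) ^+ 2 + c ^+ 2 = 1 by rewrite sqrrN addrC.
have c2 : c * - sn + sn * c = 0 by ring.
have c1' : c ^+ 2 + (- sn) ^+ 2 = 1 by rewrite sqrrN.
have c2' : c * sn + - sn * c = 0 by ring.
have e4 := eq_claw_givens x1 x2 [::] cs c1 c2.
have G4 g h : linf g -> linf h -> gram g h ts = gram g h [:: tlin c sn x1 x2; tlin (- sn) c x1 x2].
  by move=> lg lh; rewrite G3// gram_givens// addrC.
rewrite (e3 _ mJ J0) -(e4 _ mJ J0) !G4//.
have Z a b : (tlin a b x1 x2).1.1 = 0 by rewrite /= (eqP g1) (eqP g2) !mulr0 addr0.
have ZE a b : tlin a b x1 x2 = (0, (tlin a b x1 x2).1.2, (tlin a b x1 x2).2).
  by rewrite -(Z a b).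
rewrite [X in dbl [:: X; _]]ZE [X in dbl [:: _; X]]ZE posdiff_mean2//; last first.
  rewrite /tlin/=; apply/eqP; rewrite -subr_eq0; apply/eqP; rewrite -[RHS]od; ring.
rewrite /gram !big_cons !big_nil !addr0 !expr2.
done.
Qed.

(** The factor exp (- |w|^2) / pi, in the first coordinate w, is the density
of an independent standard Gaussian a_0 at - w: the expectation is that of the
positive part conditioned on w + a_0 = 0, times the density 1 / (pi V) of w +
a_0 at 0, and the S's are the conditional covariances. Once the first
coordinate is isolated in one Gaussian, the conditioning is [gauss_tilt]. *)
Lemma gauss_value s ts : s ^+ 2 = 1 ->
  let V := 1 + gram cg cg ts in
  let S11 := gram cp cp ts - gram cg cp ts ^+ 2 / V in
  let S22 := gram cq cq ts - gram cg cq ts ^+ 2 / V in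
  let S12 := gram cp cq ts - gram cg cp ts * gram cg cq ts / V in
  Egauss (dbl ts) (fun w => (expR (- sqn w.1.1) / pi * posdiff s w)%:E) =
  (posdiff_mean (s * (S11 - S22)) (S11 * S22 - S12 ^+ 2) / (pi * V))%:E.
Proof.
move=> s1 V S11 S22 S12.
have [x [ts1 [e1 z1 G1 P1]]] := eq_claw_isolate ts linf_g.
set nu := x.1.1.
have gram0 (h : T3 -> R) : gram cg h ts1 = 0.
  rewrite /gram big1_seq// => t /= tin; move/allP: z1 => /(_ _ tin)/eqP ->; exact: mul0r.
have VE : V = 1 + nu ^+ 2 by rewrite /V G1// /gram big_cons -/(gram cg cg ts1) gram0 addr0 expr2.
have p0 : 0 < pi :> R by exact: pi_gt0.
rewrite e1; first last.
- by move=> w; rewrite lee_fin mulr_ge0 ?posdiff_ge0// divr_ge0 ?expR_ge0// ltW.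
- apply/measurable_EFinP; apply: measurable_funM; last exact: measurable_posdiff.
  apply: measurable_funM => //; apply: measurableT_comp => //; apply: measurableT_comp => //.
  by apply: measurable_sqn; exact: (measurableT_comp measurable_fst).
rewrite [LHS]/=.
have z1' : all (fun v : E => v.1.1 == (0, 0)) (dbl ts1).
  apply/allP => v /flattenP[l] /mapP[t tin ->]; rewrite !inE.
  by move/allP: z1 => /(_ _ tin)/eqP/= t0 /orP[] /eqP -> /=; rewrite t0.
pose K (p : MR * MR) := Egauss (dbl ts1) (fun w => (posdiff s (vadd p.1 (vre x) (vadd p.2 (vim x) w)))%:E).
have mJ (y y' : E) (d : measure_display) (T : measurableType d) (h h' : T -> MR) (k : T -> E) : measurable_fun setT h -> measurable_fun setT h' -> measurable_fun setT k ->
    measurable_fun setT (fun t => (posdiff s (vadd (h t) y (vadd (h' t) y' (k t))))%:E).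
  move=> mh mh' mk; apply/measurable_EFinP; apply: (measurableT_comp (measurable_posdiff s)).
  by apply: measurable_vadd => //; exact: measurable_vadd.
have mK : measurable_fun setT K.
  apply: (@measurable_Egauss R _ (MR * MR)%type (dbl ts1) (fun q : (MR * MR) * E => (posdiff s (vadd q.1.1 (vre x) (vadd q.1.2 (vim x) q.2)))%:E)).
    apply: mJ => //; exact: measurableT_comp.
  by move=> q; rewrite lee_fin posdiff_ge0.
have K0 p : (0 <= K p)%E by apply: Egauss_ge0 => w; rewrite lee_fin posdiff_ge0.
transitivity (\int[gam]_a \int[gam]_b ((expR (- ((a * nu) ^+ 2 + (b * nu) ^+ 2)) / pi)%:E * K (a, b)))%E.
  apply: eq_integral => a _; apply: eq_integral => b _.
  rewrite /K -Egauss_scale; first last.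
  - by move=> w; rewrite lee_fin posdiff_ge0.
  - exact: mJ.
  - by rewrite lee_fin divr_ge0 ?expR_ge0// ltW.
  apply: Egauss_supp => // w w0; rewrite -EFinM; congr (expR (- _) / _ * _)%:E.
  by rewrite /sqn/= w0/= !mulr0 !addr0 add0r.
rewrite gauss_tilt// -VE.
set x0 : T3 := (0, x.1.2 / Num.sqrt V, x.2 / Num.sqrt V).
transitivity (((pi * V)^-1)%:E * Egauss (dbl (x0 :: ts1)) (fun w => (posdiff s w)%:E))%E.
  apply: (congr1 (fun z => ((pi * V)^-1)%:E * z)%E) => /=.
  apply: eq_integral => a _; apply: eq_integral => b _; rewrite /K; congr (Egauss _ _).
  apply/funext => w; rewrite /posdiff /sqn /vadd/=; congr ((Num.max _ (s * (_ ^+ 2 + _ ^+ 2 - (_ ^+ 2 + _ ^+ 2))))%:E); ring.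
rewrite posdiff_value//; last by rewrite /= eqxx.
rewrite -EFinM mulrC; congr (_ / _)%:E.
have V0 : 0 < V by rewrite VE ltr_pwDl// sqr_ge0.
have sV : Num.sqrt V ^+ 2 = V by rewrite sqr_sqrtr// ltW.
have sV0 : Num.sqrt V != 0 by rewrite gt_eqF// sqrtr_gt0.
have GE (h k : T3 -> R) : linf h -> linf k -> (forall t, h (0, t.1.2, t.2) = h t) -> (forall t, k (0, t.1.2, t.2) = k t) ->
   gram h k (x0 :: ts1) = gram h k ts - gram cg h ts * gram cg k ts / V.
  move=> lh lk hh hk; rewrite !G1// /gram !big_cons -/(gram cg h ts1) -/(gram cg k ts1) !gram0 !addr0.
  have x0E : x0 = tlin (Num.sqrt V)^-1 0 (0, x.1.2, x.2) (0, x.1.2, x.2).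
    by rewrite /x0 /tlin/= !mulr0 !mul0r !addr0 ![_^-1 * _]mulrC.
  rewrite x0E lh lk !mul0r !addr0 hh hk -/nu -/(gram h k ts1).
  move: (gram h k ts1) => g.
  transitivity (h x * k x / (Num.sqrt V ^+ 2) + g); first by field.
  rewrite sV VE; field.
  by rewrite gt_eqF// -VE.
rewrite !GE// /S11 /S22 /S12 ?expr2//.
Qed.

End GaussValue.

(** * The plane and an approximate identity *)

Section Plane.
Context {R : realType}.
Notation mu := (@lebesgue_measure R).
Notation MR := (measurableTypeR R).

(** A name of its own for the product measure, made opaque below, keeps
unification from unfolding it. *)
Definition plane : set (MR * MR)%type -> \bar R := (mu \x mu)%E.

Let plane0 : plane set0 = 0%E. Proof. exact: measure0. Qed.
Let plane_ge0 A : (0 <= plane A)%E. Proof. exact: measure_ge0. Qed.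
Let plane_additive : semi_sigma_additive plane.
Proof. exact: (@measure_semi_sigma_additive _ _ _ (mu \x mu)%E). Qed.
HB.instance Definition _ := isMeasure.Build _ _ R plane plane0 plane_ge0 plane_additive.

Let plane_sigma_finite : sigma_finite setT plane.
Proof.
pose I (k : nat) : set MR := `[(- k%:R)%R, k%:R%R]%classic.
have mI k : measurable (I k) by exact: measurable_itv.
exists (fun k => I k `*` I k).
- apply/esym; rewrite -subTset => -[x y] _.
  pose t := Num.max `|x| `|y|.
  have tk : t <= (Num.trunc t).+1%:R by rewrite ltW// truncnS_gt.
  exists (Num.trunc t).+1 => //; split; rewrite /I/= in_itv/= -ler_norml (le_trans _ tk)// /t le_max lexx ?orbT//.
- move=> k; split; first exact: measurableX.
  rewrite [X in (X < _)%E](product_measure1E mu mu (mI k) (mI k)).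
  have E : mu (I k) = (2 * k%:R)%:E.
    have := @lebesgue_measure_itv R `[(- k%:R)%R, k%:R%R]; rewrite /= lte_fin; case: ltP => h E.
      by rewrite [LHS]E -EFinB; congr (_%:E); ring.
    have k0 : (k%:R : R) = 0 by apply/eqP; rewrite eq_le ler0n andbT; have := ler0n R k; lra.
    by rewrite [LHS]E k0 mulr0.
  by rewrite [X in (X * _)%E]E [X in (_ * X)%E]E -EFinM ltry.
Qed.
HB.instance Definition _ := Measure_isSigmaFinite.Build _ _ R plane plane_sigma_finite.

Lemma int2E (f : MR * MR -> \bar R) : measurable_fun setT f -> (forall x, 0 <= f x)%E ->
  (\int[plane]_z f z = \int[mu]_x \int[mu]_y f (x, y))%E.
Proof. move=> mf f0; exact: (fubini_tonelli1 (m1 := mu) (m2 := mu)). Qed.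

Lemma planeX (A B : set MR) : measurable A -> measurable B -> plane (A `*` B) = (mu A * mu B)%E.
Proof. exact: product_measure1E. Qed.

End Plane.
#[global] Opaque plane.

Section Kernel.
Context {R : realType}.
Notation mu := (@lebesgue_measure R).
Notation MR := (measurableTypeR R).
Notation mu2 := (@plane R).

Lemma measurable_affine2 (e : R) (z0 : R * R) :
  measurable_fun setT ((fun h : MR * MR => (z0.1 + e * h.1, z0.2 + e * h.2)) : MR * MR -> MR * MR).
Proof. by apply: measurable_fun_pair; apply: measurable_funD => //; apply: measurable_funM. Qed.

Lemma subst2 (e : R) (z0 : R * R) (f : MR * MR -> \bar R) : 0 < e -> measurable_fun setT f -> (forall x, 0 <= f x)%E ->
  (\int[mu2]_z f z = (e ^+ 2)%:E * \int[mu2]_h f ((z0.1 + e * h.1)%R, (z0.2 + e * h.2)%R))%E.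
Proof.
move=> e0 mf f0; rewrite !int2E//; last by apply: measurableT_comp => //; exact: measurable_affine2.
have mg x : measurable_fun setT (fun y => f (x, y)) by apply: measurableT_comp => //; exact: measurable_pair1.
rewrite -(@affine_integral R e z0.1); first last.
- by move=> x; apply: integral_ge0.
- exact: (measurable_integral_r mf).
- by rewrite gt_eqF.
rewrite (gtr0_norm e0).
have -> : (e ^+ 2)%:E = (e%:E * e%:E)%E by rewrite -EFinM expr2.
rewrite -muleA; apply: (congr1 (fun z => e%:E * z)%E).
rewrite -ge0_integralZl; first last.
- by rewrite lee_fin ltW.
- by move=> x _; apply: integral_ge0.
- apply: (@measurable_integral_r R (fun h => f ((z0.1 + e * h.1)%R, (z0.2 + e * h.2)%R))) => //.
  by apply: measurableT_comp => //; exact: measurable_affine2.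
- exact: measurableT.
apply: eq_integral => x _ /=.
rewrite -(@affine_integral R e z0.2); [|by rewrite gt_eqF|exact: mg|by []].
rewrite (gtr0_norm e0); apply: (congr1 (fun z => e%:E * z)%E).
by apply: eq_integral => y _; rewrite [e * x + _]addrC [e * y + _]addrC.
Qed.

(** The clamp of x to [0, 1], in a form whose continuity and measurability are
immediate. *)
Definition ramp (x : R) := (`|x| - `|x - 1| + 1) / 2.

Lemma ramp0 x : x <= 0 -> ramp x = 0.
Proof. by move=> x0; rewrite /ramp !ler0_norm ?subr_le0 ?(le_trans x0)//; field. Qed.
Lemma ramp1 x : 1 <= x -> ramp x = 1.
Proof. by move=> x1; rewrite /ramp !ger0_norm ?subr_ge0 ?(le_trans ler01)//; field. Qed.
Lemma rampE x : 0 <= x <= 1 -> ramp x = x.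
Proof. by move=> /andP[x0 x1]; rewrite /ramp ger0_norm// ler0_norm ?subr_le0//; field. Qed.
Lemma ramp_le x y : x <= y -> ramp x <= ramp y.
Proof.
move=> xy; have [x0|x0] := leP x 0; have [y0|y0] := leP y 0.
- by rewrite !ramp0.
- rewrite (ramp0 x0); have [y1|y1] := leP y 1; first by rewrite rampE ltW.
  by rewrite ramp1// ltW.
- by move: (lt_le_trans x0 xy); rewrite ltNge y0.
- have [y1|y1] := leP y 1; first by rewrite (@rampE y) ?(ltW y0) ?y1// rampE// (ltW x0) (le_trans xy).
  rewrite (@ramp1 y (ltW y1)); have [x1|x1] := leP x 1; first by rewrite rampE// ltW.
  by rewrite ramp1// ltW.
Qed.
Lemma ramp_ge0 x : 0 <= ramp x.
Proof. by have [x0|x0] := leP x 0; [rewrite ramp0|rewrite -(@ramp0 0 (lexx _)) ramp_le// ltW]. Qed.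
Lemma ramp_le1 x : ramp x <= 1.
Proof. by have [x0|x0] := leP x 1; [rewrite -[leRHS](@ramp1 1 (lexx _)) ramp_le|rewrite ramp1// ltW]. Qed.
Lemma continuous_ramp : continuous ramp.
Proof.
move=> x; apply: cvgM; last exact: cvg_cst.
apply: cvgD; last exact: cvg_cst.
apply: cvgB; first exact: norm_continuous.
apply: (@continuous_comp _ _ _ (fun x : R => x - 1) (fun x : R => `|x|)); last exact: norm_continuous.
by apply: cvgB => //; exact: cvg_cst.
Qed.

Definition tent (x : R) := ramp (x + 1) - ramp x.
Lemma tent_ge0 x : 0 <= tent x. Proof. by rewrite subr_ge0 ramp_le// lerDl. Qed.
Lemma tent_le1 x : tent x <= 1. Proof. by rewrite lerBlDr (le_trans (ramp_le1 _))// lerDl ramp_ge0. Qed.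
Lemma tent_supp x : tent x != 0 -> `|x| < 1.
Proof.
apply: contra_neqT; rewrite -leNgt ler_normr => /orP[x1|x1]; rewrite /tent.
  by rewrite !ramp1 ?subrr//; lra.
by rewrite !ramp0 ?subrr//; lra.
Qed.
Lemma continuous_tent : continuous tent.
Proof.
move=> x; apply: cvgB; last exact: continuous_ramp.
apply: (@continuous_comp _ _ _ (fun x : R => x + 1) ramp); last exact: continuous_ramp.
by apply: cvgD => //; exact: cvg_cst.
Qed.
Lemma measurable_tent : measurable_fun setT (tent : MR -> MR).
Proof. exact: (continuous_measurable_fun continuous_tent). Qed.
Lemma measurable_ramp : measurable_fun setT (ramp : MR -> MR).
Proof. exact: (continuous_measurable_fun continuous_ramp). Qed.

(** The integer translates of [tent] form a partition of unity: the sum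
telescopes. *)
Lemma tent_sum (y : R) (N : nat) : `|y| <= N%:R -> \sum_(i < (2 * N).+1) tent (y - (i%:R - N%:R)) = 1.
Proof.
move=> yN.
have H m : \sum_(i < m) tent (y - (i%:R - N%:R)) = ramp (y + N%:R + 1) - ramp (y + N%:R + 1 - m%:R).
  elim: m => [|m IH]; first by rewrite big_ord0 subr0 subrr.
  rewrite big_ord_recr /= IH /tent addrA.
  rewrite (_ : y - (m%:R - N%:R) + 1 = y + N%:R + 1 - m%:R); last by ring.
  rewrite subrK (_ : y - (m%:R - N%:R) = y + N%:R + 1 - m.+1%:R)//.
  by rewrite -addn1 natrD; ring.
move: yN; rewrite ler_norml => /andP[y1 y2].
rewrite H ramp1 ?ramp0 ?subr0//; last by lra.
by rewrite -addn1 natrD natrM; lra.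
Qed.

Definition kint : \bar R := (\int[mu]_x (tent x)%:E)%E.

Definition kpos : R := fine kint.

Lemma kintE_gt0 : kint = kpos%:E /\ 0 < kpos.
Proof.
have mt : measurable_fun setT (fun x : MR => (tent x)%:E) by apply/measurable_EFinP; exact: measurable_tent.
have h1 : (kint <= 2%:E)%E.
  apply: (@le_trans _ _ (\int[mu]_x (\1_(`[-1, 1]%classic : set R) x)%:E)%E).
    apply: ge0_le_integral => //.
    - by move=> x _; rewrite lee_fin tent_ge0.
    - by apply/measurable_EFinP; exact: measurable_indic.
    - move=> x _; rewrite lee_fin indicE mem_setE in_itv/=.
      have [->|/tent_supp] := eqVneq (tent x) 0; first by case: (_ && _).
      by rewrite -ler_norml => /ltW ->; exact: tent_le1.
  rewrite integral_indic// setIT.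
  have m2 : mu `[(-1)%R, 1%R]%classic = 2%:E.
    by rewrite lebesgue_measure_itv/= lte_fin (lt_trans (ltrN10 R) ltr01) -EFinD opprK.
  by rewrite [X in (X <= _)%E]m2.
have h2 : ((4^-1)%:E <= kint)%E.
  apply: (@le_trans _ _ (\int[mu]_x ((2^-1)%:E * (\1_(`[0, 2^-1]%classic : set R) x)%:E))%E).
    rewrite ge0_integralZl//; first last.
    - by apply/measurable_EFinP; exact: measurable_indic.
    rewrite integral_indic// setIT.
    have m2 : mu `[0%R, 2^-1%R]%classic = (2^-1)%:E.
      by rewrite lebesgue_measure_itv/= lte_fin invr_gt0 ltr0n oppr0 adde0.
    by rewrite [X in (_ * X)%E]m2 -EFinM lee_fin; lra.
  apply: ge0_le_integral => //.
  - by apply/measurable_EFinP; apply: measurable_funM => //; exact: measurable_indic.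
  - move=> x _; rewrite -EFinM lee_fin indicE mem_setE in_itv/=.
    have [/andP[x0 x1]|_] := boolP (0 <= x <= 2^-1); last by rewrite mulr0 tent_ge0.
    rewrite mulr1 /tent ramp1 ?rampE//; lra.
have f : kint \is a fin_num by rewrite ge0_fin_numE ?(le_lt_trans h1)// ?ltry// (le_trans _ h2)// lee_fin.
rewrite /kpos fineK//; split => //.
by rewrite -lte_fin fineK// (lt_le_trans _ h2)// lte_fin.
Qed.

Lemma kpos_gt0 : 0 < kpos. Proof. by case: kintE_gt0. Qed.
Lemma kintE : kint = kpos%:E. Proof. by case: kintE_gt0. Qed.

Definition kern (h : R * R) : R := tent h.1 * tent h.2 / kpos ^+ 2.
Lemma kern_ge0 h : 0 <= kern h.
Proof. by rewrite /kern !mulr_ge0 ?tent_ge0// invr_ge0 sqr_ge0. Qed.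
Lemma kern_le h : kern h <= (kpos ^+ 2)^-1.
Proof.
rewrite /kern -[leRHS]mul1r ler_wpM2r ?invr_ge0 ?sqr_ge0// -[leRHS]mulr1.
by apply: ler_pM; rewrite ?tent_ge0 ?tent_le1.
Qed.
Lemma kern_supp h : kern h != 0 -> `|h.1| < 1 /\ `|h.2| < 1.
Proof.
by rewrite /kern !mulf_eq0 !negb_or => /andP[/andP[h1 h2] _]; split; exact: tent_supp.
Qed.
Lemma measurable_kern : measurable_fun setT (kern : MR * MR -> MR).
Proof.
apply: measurable_funM => //; apply: measurable_funM; apply: measurableT_comp => //; exact: measurable_tent.
Qed.
Lemma cvg_kern (u v : nat -> R) a b : u @ \oo --> a -> v @ \oo --> b -> (fun n => kern (u n, v n)) @ \oo --> kern (a, b).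
Proof.
move=> ua vb; apply: cvgM; last exact: cvg_cst.
apply: cvgM.
  exact: (cvg_comp _ _ ua (@continuous_tent a)).
exact: (cvg_comp _ _ vb (@continuous_tent b)).
Qed.

Lemma kern_int : (\int[mu2]_h (kern h)%:E = 1)%E.
Proof.
rewrite int2E; first last.
- by move=> h; rewrite lee_fin kern_ge0.
- by apply/measurable_EFinP; exact: measurable_kern.
have k0 := kpos_gt0.
have mt : measurable_fun setT (fun x : MR => (tent x)%:E) by apply/measurable_EFinP; exact: measurable_tent.
transitivity (\int[mu]_x ((tent x)%:E * (kpos^-1)%:E))%E.
  apply: eq_integral => x _.
  transitivity (\int[mu]_y ((tent x / kpos ^+ 2)%:E * (tent y)%:E))%E.
    by apply: eq_integral => y _; rewrite -EFinM /kern/=; congr (_%:E); rewrite mulrAC.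
  rewrite ge0_integralZl; first last.
  - by rewrite lee_fin divr_ge0 ?tent_ge0// sqr_ge0.
  - by move=> y _; rewrite lee_fin tent_ge0.
  - exact: mt.
  - exact: measurableT.
  rewrite -/kint kintE -!EFinM; congr (_%:E); field; by rewrite gt_eqF.
rewrite ge0_integralZr; first last.
- by rewrite lee_fin invr_ge0 ltW.
- by move=> y _; rewrite lee_fin tent_ge0.
- exact: mt.
- exact: measurableT.
by rewrite -/kint kintE -EFinM divff// gt_eqF.
Qed.

(** The mass of the kernel composed with the differential at a zero is 1 /
|J|; the factor |J| of the area formula cancels it. *)
Lemma kern_lin (a b c d : R) : a * d - b * c != 0 ->
  (\int[mu2]_h (kern ((a * h.1 + b * h.2)%R, (c * h.1 + d * h.2)%R))%:E = (`|a * d - b * c|^-1)%:E)%E.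
Proof.
move=> D0.
have mb : measurable_fun setT (fun h : MR * MR => (kern h)%:E) by apply/measurable_EFinP; exact: measurable_kern.
have b0 h : (0 <= (kern h)%:E)%E by rewrite lee_fin kern_ge0.
have := @linear_integral2 R (fun h => (kern h)%:E) a b c d D0 mb b0.
rewrite -[RHS]/(\int[mu]_x \int[mu]_y (kern (x, y))%:E)%E -(int2E mb b0) kern_int.
rewrite -(@int2E R (fun h => (kern ((a * h.1 + b * h.2)%R, (c * h.1 + d * h.2)%R))%:E)).
- set I := integral _ _ _.
  have I0 : (0 <= I)%E by apply: integral_ge0.
  case: I I0 => [r| |] // r0; last by rewrite gt0_muley ?lte_fin ?normr_gt0.
  rewrite -EFinM => -[E]; congr (_%:E).
  by rewrite -[RHS]mulr1 -E mulKf// normr_eq0.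
- apply: (measurableT_comp mb); apply: measurable_fun_pair; exact: measurable_lin.
- by [].
Qed.

End Kernel.

(** * Zeros of an expanding map in a cell *)

Section Cell.
Context {R : realType}.
Notation mu := (@lebesgue_measure R).
Notation MR := (measurableTypeR R).
Notation mu2 := (@plane R).

Definition maxnorm (z : R * R) := Num.max `|z.1| `|z.2|.

(** The setting of a single cell: at the points of K, (g1, g2) has the
derivative matrix with rows (la, lb) and (lc, ld), of determinant J; the
weight psi is supported in the compact set K, on which the map expands
distances by lam at least, so that K contains at most one point of each fibre.
*)
Context (g1 g2 J psi la lb lc ld : R * R -> R) (K : set (R * R)) (lam B : R).
Hypothesis mg1 : measurable_fun setT (g1 : MR * MR -> MR).
Hypothesis mg2 : measurable_fun setT (g2 : MR * MR -> MR).
Hypothesis mJ : measurable_fun setT (J : MR * MR -> MR).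
Hypothesis mpsi : measurable_fun setT (psi : MR * MR -> MR).
Hypothesis cg1 : continuous g1.
Hypothesis cg2 : continuous g2.
Hypothesis cJ : continuous J.
Hypothesis cpsi : continuous psi.
Hypothesis psi0 : forall z, 0 <= psi z.
Hypothesis psiK : forall z, psi z != 0 -> K z.
Hypothesis WB : forall z, psi z * `|J z| <= B.
Hypothesis cK : compact K.
Hypothesis KJ : forall z, K z -> J z != 0.
Hypothesis JE : forall z, J z = la z * ld z - lb z * lc z.
Hypothesis lam0 : 0 < lam.
Hypothesis lip : forall z z', K z -> K z' ->
  lam * maxnorm (z.1 - z'.1, z.2 - z'.2) <= maxnorm (g1 z - g1 z', g2 z - g2 z').
Let e (n : nat) : R := n.+1%:R^-1.
Hypothesis dif1 : forall z (h : R * R), K z ->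
  (fun n => (g1 (z.1 + e n * h.1, z.2 + e n * h.2) - g1 z) / e n) @ \oo --> la z * h.1 + lb z * h.2.
Hypothesis dif2 : forall z (h : R * R), K z ->
  (fun n => (g2 (z.1 + e n * h.1, z.2 + e n * h.2) - g2 z) / e n) @ \oo --> lc z * h.1 + ld z * h.2.

Let e0 n : 0 < e n. Proof. by rewrite invr_gt0. Qed.
Let W z := psi z * `|J z|.
Let W0 z : 0 <= W z. Proof. by rewrite mulr_ge0. Qed.
Let mW : measurable_fun setT (W : MR * MR -> MR).
Proof. by apply: measurable_funM => //; apply: measurableT_comp. Qed.
Let B0 : 0 <= B. Proof. by apply: (le_trans _ (WB (0, 0))); rewrite mulr_ge0. Qed.

(** The kernel of width e_n probes the points where (g1, g2) is close to - c.
Near a zero of (g1, g2) + c its mass against |J| is almost 1, so that this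
approximates the sum of psi over the zeros. *)
Definition smoothed (n : nat) (c : R * R) : \bar R :=
  (\int[mu2]_z ((e n ^- 2) * (W z * kern ((g1 z + c.1) / e n, (g2 z + c.2) / e n)))%:E)%E.

Let mint n : measurable_fun setT (fun p : (MR * MR) * (MR * MR) =>
  ((e n ^- 2) * (W p.2 * kern ((g1 p.2 + p.1.1) / e n, (g2 p.2 + p.1.2) / e n)))%:E).
Proof.
apply/measurable_EFinP; apply: measurable_funM => //; apply: measurable_funM.
  exact: measurableT_comp.
apply: (measurableT_comp measurable_kern); apply: measurable_fun_pair; apply: measurable_funM => //;
  apply: measurable_funD.
- exact: (measurableT_comp mg1).
- exact: (measurableT_comp measurable_fst).
- exact: (measurableT_comp mg2).
- exact: (measurableT_comp measurable_snd).
Qed.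

Let int0 n c z : (0 <= ((e n ^- 2) * (W z * kern ((g1 z + c.1) / e n, (g2 z + c.2) / e n)))%:E)%E.
Proof.
rewrite lee_fin; apply: mulr_ge0; first by rewrite invr_ge0 sqr_ge0.
by apply: mulr_ge0; [exact: W0|exact: kern_ge0].
Qed.

Let mint1 n c : measurable_fun setT (fun z : MR * MR =>
  ((e n ^- 2) * (W z * kern ((g1 z + c.1) / e n, (g2 z + c.2) / e n)))%:E).
Proof. exact: (measurableT_comp (mint n) (measurable_pair1 c)). Qed.

Lemma measurable_smoothed n : measurable_fun setT (smoothed n : MR * MR -> \bar R).
Proof.
have H := measurable_fun_fubini_tonelli_F (m2 := mu2) (fun p : (MR * MR) * (MR * MR) =>
  ((e n ^- 2) * (W p.2 * kern ((g1 p.2 + p.1.1) / e n, (g2 p.2 + p.1.2) / e n)))%:E) (mint n) (fun p => int0 n p.1 p.2).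
exact: H.
Qed.

Lemma smoothed_ge0 n c : (0 <= smoothed n c)%E.
Proof. by apply: integral_ge0 => z _; exact: int0. Qed.

Let near_pt n c z : W z * kern ((g1 z + c.1) / e n, (g2 z + c.2) / e n) != 0 ->
  [/\ K z, `|g1 z + c.1| < e n & `|g2 z + c.2| < e n].
Proof.
rewrite mulf_eq0 negb_or => /andP[]; rewrite /W mulf_eq0 negb_or => /andP[p0 _] /kern_supp/=.
rewrite !normrM normfV (gtr0_norm (e0 n)) !ltr_pdivrMr// !mul1r => -[h1 h2].
by split => //; exact: psiK.
Qed.

Let close_pts n c z z' : K z -> K z' -> `|g1 z + c.1| <= e n -> `|g2 z + c.2| <= e n ->
  `|g1 z' + c.1| <= e n -> `|g2 z' + c.2| <= e n ->
  `|z.1 - z'.1| <= 2 * e n / lam /\ `|z.2 - z'.2| <= 2 * e n / lam.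
Proof.
move=> Kz Kz' h1 h2 h3 h4.
have H : lam * maxnorm (z.1 - z'.1, z.2 - z'.2) <= 2 * e n.
  apply: le_trans (lip Kz Kz') _; rewrite /maxnorm/= ge_max; apply/andP; split.
    rewrite (_ : g1 z - g1 z' = (g1 z + c.1) - (g1 z' + c.1)); last by ring.
    by apply: le_trans (ler_normB _ _) _; rewrite mulr_natl mulr2n lerD.
  rewrite (_ : g2 z - g2 z' = (g2 z + c.2) - (g2 z' + c.2)); last by ring.
  by apply: le_trans (ler_normB _ _) _; rewrite mulr_natl mulr2n lerD.
have {}H : maxnorm (z.1 - z'.1, z.2 - z'.2) <= 2 * e n / lam by rewrite ler_pdivlMr// mulrC.
by move: H; rewrite /maxnorm/= ge_max => /andP[].
Qed.

Let box (a b r : R) : set (MR * MR) := `[a - r, a + r]%classic `*` `[b - r, b + r]%classic.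
Let mbox (a b r : R) : measurable (box a b r). Proof. by apply: measurableX; exact: measurable_itv. Qed.
Let box_area (a b r : R) : 0 <= r -> mu2 (box a b r) = ((2 * r) ^+ 2)%:E.
Proof.
move=> r0; rewrite /box planeX; [|exact: measurable_itv|exact: measurable_itv].
have E x : mu `[(x - r)%R, (x + r)%R]%classic = (2 * r)%:E.
  rewrite lebesgue_measure_itv/= lte_fin; case: ltP => h.
    by rewrite -EFinD; congr (_%:E); ring.
  have -> : r = 0 by apply/eqP; rewrite eq_le r0 andbT; lra.
    by rewrite mulr0.
by rewrite [X in (X * _)%E]E [X in (_ * X)%E]E -EFinM expr2.
Qed.
Let in_box (a b r : R) (z : R * R) : `|z.1 - a| <= r -> `|z.2 - b| <= r -> box a b r z.
Proof. by rewrite !ler_distl => /andP[h1 h2] /andP[h3 h4]; split; rewrite /= in_itv/= ?h1 ?h2 ?h3 ?h4. Qed.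

Let kb : R := (@kpos R ^+ 2)^-1.
Let kb0 : 0 <= kb. Proof. by rewrite invr_ge0 sqr_ge0. Qed.

Let Cb : R := B * kb * (4 / lam) ^+ 2.

(** All points of K seen by the kernel lie, by expansion, in a box of side of
order e_n, whose area compensates the factor e_n^-2. *)
Lemma smoothed_bound n c : (smoothed n c <= Cb%:E)%E.
Proof.
have Cb0 : 0 <= Cb by apply: mulr_ge0; [exact: mulr_ge0|exact: sqr_ge0].
have [[z0 hz0]|none] := pselect (exists z0, [/\ K z0, `|g1 z0 + c.1| < e n & `|g2 z0 + c.2| < e n]); last first.
  rewrite /smoothed (_ : (fun z => _) = cst 0%E); first by rewrite integral0 lee_fin.
  apply/funext => z /=; have [->|/near_pt h] := eqVneq (W z * kern ((g1 z + c.1) / e n, (g2 z + c.2) / e n)) 0.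
    by rewrite mulr0.
  by exfalso; apply: none; exists z.
case: hz0 => Kz0 h1 h2.
apply: (@le_trans _ _ (\int[mu2]_z ((e n ^- 2 * (B * kb))%:E * (\1_(box z0.1 z0.2 (2 * e n / lam)) z)%:E))%E).
  apply: ge0_le_integral => //.
  - apply/measurable_EFinP; apply: measurable_funM => //; exact: measurable_indic.
  - move=> z _; rewrite -EFinM lee_fin.
    have [->|/near_pt[Kz h3 h4]] := eqVneq (W z * kern ((g1 z + c.1) / e n, (g2 z + c.2) / e n)) 0.
      by rewrite mulr0 !mulr_ge0 ?indicE// invr_ge0 exprn_ge0// ltW.
    have [b1 b2] := close_pts Kz Kz0 (ltW h3) (ltW h4) (ltW h1) (ltW h2).
    rewrite indicE mem_set; last exact: in_box.
    rewrite mulr1 ler_wpM2l ?invr_ge0 ?exprn_ge0 ?(ltW (e0 n))//.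
    by apply: ler_pM; [exact: W0|exact: kern_ge0|exact: WB|exact: kern_le].
rewrite ge0_integralZl; first last.
- by rewrite lee_fin !mulr_ge0// invr_ge0 exprn_ge0// ltW.
- by move=> z _; rewrite lee_fin indicE.
- by apply/measurable_EFinP; exact: measurable_indic.
- exact: measurableT.
rewrite integral_indic; [|exact: measurableT|exact: mbox].
rewrite setIT [X in (_ * X)%E](@box_area z0.1 z0.2 (2 * e n / lam)); last first.
  by rewrite !mulr_ge0 ?invr_ge0 ?(ltW lam0) ?(ltW (e0 n)).
rewrite -EFinM lee_fin /Cb le_eqVlt; apply/orP; left; apply/eqP.
by field; rewrite !gt_eqF.
Qed.

Let Z (c : R * R) : set (R * R) := [set z | g1 z = - c.1 /\ g2 z = - c.2].

Let uniqZ c z z' : Z c z -> K z -> Z c z' -> K z' -> z = z'.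
Proof.
move=> [h1 h2] Kz [h3 h4] Kz'.
have := lip Kz Kz'; rewrite h1 h2 h3 h4 !subrr /maxnorm/= normr0 maxxx.
rewrite pmulr_rle0// ge_max !normr_le0 !subr_eq0 => /andP[/eqP e1 /eqP e2].
by case: z z' e1 e2 {h1 h2 h3 h4 Kz Kz'} => [x y] [x' y'] /= -> ->.
Qed.

Let esumZ1 c z0 : Z c z0 -> K z0 -> (\esum_(z in Z c) (psi z)%:E = (psi z0)%:E)%E.
Proof.
move=> Zz0 Kz0; rewrite (esumID [set z0]); last by move=> z _; rewrite lee_fin.
rewrite [X in (_ + X)%E]esum1 ?adde0; last first.
  move=> z [Zz /= nz]; have [-> //|pz] := eqVneq (psi z) 0.
  by exfalso; apply: nz; exact: (uniqZ Zz (psiK pz) Zz0 Kz0).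
rewrite (_ : _ `&` _ = [set z0]); first by rewrite esum_set1// lee_fin.
by apply/setIidPr => z /= ->.
Qed.

Let esumZ0 c : (forall z, Z c z -> K z -> False) -> (\esum_(z in Z c) (psi z)%:E = 0)%E.
Proof.
move=> none; apply: esum1 => z Zz; have [-> //|pz] := eqVneq (psi z) 0.
by exfalso; exact: (none z Zz (psiK pz)).
Qed.

Let cvg_e : e @ \oo --> (0 : R).
Proof. exact: cvg_harmonic. Qed.

Let cvg_pt (z h : R * R) (f : R * R -> R) : continuous f -> (fun n => f (z.1 + e n * h.1, z.2 + e n * h.2)) @ \oo --> f z.
Proof.
move=> cf.
have c1 (a b : R) : (fun n => a + e n * b) @ \oo --> a.
  rewrite -[X in _ --> X]addr0 -[X in _ --> _ + X](mul0r b).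
  apply: cvgD; first exact: cvg_cst.
  by apply: cvgM; [exact: cvg_e|exact: cvg_cst].
have : (fun n => (z.1 + e n * h.1, z.2 + e n * h.2)) @ \oo --> (z.1, z.2).
  exact: (cvg_pair (c1 z.1 h.1) (c1 z.2 h.2)).
rewrite -surjective_pairing => H.
exact: (cvg_comp _ _ H (cf z)).
Qed.

(** If K contains no zero, compactness keeps the map away from - c and the
kernel eventually sees nothing. Otherwise substitute z = z0 + e_n h around the
zero z0: the integrand tends to the kernel composed with the differential at
z0, and expansion keeps its support in a fixed box. *)
Lemma cell_cvg c : smoothed n c @[n --> \oo] --> (\esum_(z in Z c) (psi z)%:E)%E.
Proof.
have [[z0 [Zz0 Kz0]]|none] := pselect (exists z0, Z c z0 /\ K z0); last first.
  rewrite esumZ0; last by move=> z Zz Kz; apply: none; exists z.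
  have [[k Kk]|K0] := pselect (K !=set0); last first.
    apply: cvg_near_cst; apply: nearW => n; rewrite /smoothed.
    rewrite (_ : (fun z => _) = cst 0%E); first by rewrite integral0.
    apply/funext => z /=; have [->|/near_pt[Kz _ _]] := eqVneq (W z * kern ((g1 z + c.1) / e n, (g2 z + c.2) / e n)) 0.
      by rewrite mulr0.
    by exfalso; apply: K0; exists z.
  pose f z := `|g1 z + c.1| + `|g2 z + c.2|.
  have cf : continuous f.
    move=> z; apply: cvgD.
      apply: (@continuous_comp _ _ _ (fun z => g1 z + c.1) (fun x : R => `|x|)); last exact: norm_continuous.
      by apply: cvgD; [exact: cg1|exact: cvg_cst].
    apply: (@continuous_comp _ _ _ (fun z => g2 z + c.2) (fun x : R => `|x|)); last exact: norm_continuous.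
    by apply: cvgD; [exact: cg2|exact: cvg_cst].
  have [m mK mmin] := compact_EVT_min (ex_intro _ k Kk) cK (continuous_subspaceT cf).
  have fm0 : 0 < f m.
    rewrite lt_neqAle eq_sym addr_ge0// andbT; apply/negP; rewrite paddr_eq0// !normr_eq0 => /andP[/eqP h1 /eqP h2].
    apply: none; exists m; split; last by rewrite -inE.
    by split; apply/eqP; rewrite -addr_eq0 ?h1 ?h2.
  apply: cvg_near_cst; near=> n; rewrite /smoothed.
  rewrite (_ : (fun z => _) = cst 0%E); first by rewrite integral0.
  apply/funext => z /=; have [->|/near_pt[Kz h1 h2]] := eqVneq (W z * kern ((g1 z + c.1) / e n, (g2 z + c.2) / e n)) 0.
    by rewrite mulr0.
  exfalso; have := mmin z (mem_set Kz); rewrite leNgt => /negP; apply.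
  have en : e n < f m / 2.
    by near: n; apply: (cvgr_lt 0 cvg_e); rewrite divr_gt0.
  have fz : f z = `|g1 z + c.1| + `|g2 z + c.2| by [].
  by rewrite fz; lra.
rewrite (esumZ1 Zz0 Kz0).
case: (Zz0) => zc1 zc2.
pose F n (h : MR * MR) : \bar R := (W (z0.1 + e n * h.1, z0.2 + e n * h.2) *
   kern ((g1 (z0.1 + e n * h.1, z0.2 + e n * h.2) - g1 z0) / e n, (g2 (z0.1 + e n * h.1, z0.2 + e n * h.2) - g2 z0) / e n))%:E.
have HE n : smoothed n c = (\int[mu2]_h F n h)%E.
  rewrite /smoothed (@subst2 R (e n) z0); [|exact: e0|exact: mint1|exact: int0].
  rewrite -ge0_integralZl; first last.
  - by rewrite lee_fin sqr_ge0.
  - by move=> h _; exact: int0.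
  - by apply: (measurableT_comp (mint1 n c)); exact: measurable_affine2.
  - exact: measurableT.
  apply: eq_integral => h _; rewrite -EFinM /F zc1 zc2 !opprK; congr (_%:E).
  by rewrite mulrA mulfV ?mul1r// expf_neq0// gt_eqF.
under eq_fun do rewrite HE.
have J0 : la z0 * ld z0 - lb z0 * lc z0 != 0 by rewrite -JE; exact: KJ.
pose f h := (W z0 * kern (la z0 * h.1 + lb z0 * h.2, lc z0 * h.1 + ld z0 * h.2))%:E.
have <- : (\int[mu2]_h f h = (psi z0)%:E)%E.
  under eq_integral do rewrite /f EFinM.
  rewrite ge0_integralZl; first last.
  - by rewrite lee_fin.
  - by move=> h _; rewrite lee_fin kern_ge0.
  - apply/measurable_EFinP; apply: (measurableT_comp measurable_kern); apply: measurable_fun_pair; exact: measurable_lin.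
  - exact: measurableT.
  rewrite kern_lin// -EFinM; congr (_%:E).
  by rewrite /W JE mulfK// normr_eq0.
apply: (@dominated_cvg _ _ _ mu2 setT measurableT F f (fun h => (B * kb)%:E * (\1_(box 0 0 lam^-1) h)%:E)%E).
- move=> n; rewrite /F.
  apply/measurable_EFinP; apply: measurable_funM.
    by apply: (measurableT_comp mW); exact: measurable_affine2.
  apply: (measurableT_comp measurable_kern); apply: measurable_fun_pair; apply: measurable_funM => //;
    apply: measurable_funB => //.
    by apply: (measurableT_comp mg1); exact: measurable_affine2.
  by apply: (measurableT_comp mg2); exact: measurable_affine2.
- move=> h _; apply: cvg_EFin; first exact: nearW.
  apply: cvgM.
    apply: cvg_pt => z; apply: cvgM; first exact: cpsi.
    apply: (@continuous_comp _ _ _ J (fun x : R => `|x|)); [exact: cJ|exact: norm_continuous].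
  by apply: cvg_kern; [exact: dif1|exact: dif2].
- by [].
- apply/integrableP; split.
    by apply/measurable_EFinP; apply: measurable_funM => //; exact: measurable_indic.
  have Eab : (fun h : MR * MR => `|(B * kb)%:E * (\1_(box 0 0 lam^-1) h)%:E|)%E = (fun h => (B * kb)%:E * (\1_(box 0 0 lam^-1) h)%:E)%E.
    by apply/funext => h; rewrite gee0_abs// mule_ge0// ?lee_fin ?mulr_ge0// indicE.
  rewrite Eab.
  rewrite ge0_integralZl; first last.
  + by rewrite lee_fin mulr_ge0.
  + by move=> z _; rewrite lee_fin indicE.
  + by apply/measurable_EFinP; exact: measurable_indic.
  + exact: measurableT.
  rewrite integral_indic; [|exact: measurableT|exact: mbox].
  rewrite setIT.
  have li0 : 0 <= lam^-1 by rewrite invr_ge0 ltW.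
  by rewrite [X in (_ * X)%E](box_area 0 0 li0) -EFinM ltry.
- move=> n h _; rewrite /F gee0_abs; last first.
    by rewrite lee_fin; apply: mulr_ge0; [exact: W0|exact: kern_ge0].
  set w := (_, _); set b := kern _; rewrite -EFinM lee_fin.
  have [->|nz] := eqVneq (W w * b) 0; first by rewrite !mulr_ge0// indicE.
  have /near_pt[Kw h1 h2] : W w * kern ((g1 w + c.1) / e n, (g2 w + c.2) / e n) != 0.
    by move: nz; rewrite /b zc1 zc2 !opprK.
  have H : lam * maxnorm (w.1 - z0.1, w.2 - z0.2) <= e n.
    apply: le_trans (lip Kw Kz0) _; rewrite /maxnorm/= ge_max; apply/andP; split.
      by rewrite (_ : _ - _ = g1 w + c.1) ?ltW// zc1 opprK.
    by rewrite (_ : _ - _ = g2 w + c.2) ?ltW// zc2 opprK.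
  have {}H : maxnorm (w.1 - z0.1, w.2 - z0.2) <= e n / lam by rewrite ler_pdivlMr// mulrC.
  have en0 := e0 n.
  move: H; rewrite /maxnorm/w/= ![_ + _ * _ - _]addrAC !subrr !add0r !normrM (gtr0_norm en0) -maxr_pMr ?(ltW en0)//.
  rewrite ler_pM2l// ge_max => /andP[b1 b2].
  rewrite indicE mem_set; last by apply: in_box; rewrite subr0.
  by rewrite mulr1; apply: ler_pM => //; [exact: kern_ge0|exact: WB|exact: kern_le].
Unshelve. all: by end_near. Qed.

Variables (phi : R * R -> R) (Bp : R).
Hypothesis mphi : measurable_fun setT (phi : MR * MR -> MR).
Hypothesis cphi : continuous phi.
Hypothesis phi0 : forall c, 0 <= phi c.
Hypothesis phiB : forall c, phi c <= Bp.
Hypothesis iphi : (\int[mu2]_c (phi c)%:E < +oo)%E.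

Let mphiE : measurable_fun setT (fun c : MR * MR => (phi c)%:E).
Proof. exact/measurable_EFinP. Qed.

Let lhs_cvg : (\int[mu2]_c (smoothed n c * (phi c)%:E))%E @[n --> \oo] --> (\int[mu2]_c ((\esum_(z in Z c) (psi z)%:E) * (phi c)%:E))%E.
Proof.
have Cb0 : 0 <= Cb by apply: mulr_ge0; [exact: mulr_ge0|exact: sqr_ge0].
apply: (@dominated_cvg _ _ _ mu2 setT measurableT _ _ (fun c => Cb%:E * (phi c)%:E)%E).
- by move=> n; apply: emeasurable_funM; [exact: measurable_smoothed|exact: mphiE].
- by move=> c _; apply: cvgeZr => //; exact: cell_cvg.
- by [].
- apply/integrableP; split; first exact: emeasurable_funM.
  have -> : (fun c => `|Cb%:E * (phi c)%:E|)%E = (fun c => Cb%:E * (phi c)%:E)%E.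
    by apply/funext => c; rewrite gee0_abs// mule_ge0// lee_fin.
  rewrite ge0_integralZl; first last.
  + by rewrite lee_fin.
  + by move=> c _; rewrite lee_fin.
  + exact: mphiE.
  + exact: measurableT.
  by apply: lte_mul_pinfty => //; rewrite lee_fin.
- move=> n c _; rewrite gee0_abs; last by rewrite mule_ge0 ?smoothed_ge0// lee_fin.
  by apply: lee_wpmul2r; [rewrite lee_fin|exact: smoothed_bound].
Qed.

Let Bp0 : 0 <= Bp. Proof. exact: le_trans (phi0 (0, 0)) (phiB _). Qed.

Let lhsE n : (\int[mu2]_c (smoothed n c * (phi c)%:E) =
  \int[mu2]_z \int[mu2]_h (W z * kern h * phi (- g1 z + e n * h.1, - g2 z + e n * h.2)%R)%:E)%E.
Proof.
transitivity (\int[mu2]_c \int[mu2]_z (((e n ^- 2) * (W z * kern ((g1 z + c.1) / e n, (g2 z + c.2) / e n)))%:E * (phi c)%:E))%E.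
  apply: eq_integral => c _; rewrite ge0_integralZr; first by [].
  - exact: measurableT.
  - exact: mint1.
  - by move=> z _; exact: int0.
  - by rewrite lee_fin.
pose F (p : (MR * MR) * (MR * MR)) := (((e n ^- 2) * (W p.2 * kern ((g1 p.2 + p.1.1) / e n, (g2 p.2 + p.1.2) / e n)))%:E * (phi p.1)%:E)%E.
have mF : measurable_fun setT F.
  by apply: emeasurable_funM; [exact: mint|exact: (measurableT_comp mphiE)].
have F0 p : (0 <= F p)%E by apply: mule_ge0; [exact: int0|rewrite lee_fin].
have := fubini_tonelli (m1 := mu2) (m2 := mu2) F mF F0.
rewrite /F/= => ->.
apply: eq_integral => z _.
rewrite (@subst2 R (e n) (- g1 z, - g2 z)); first last.
- by move=> c; apply: mule_ge0; [exact: int0|rewrite lee_fin].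
- exact: (measurableT_comp mF (measurable_pair2 z)).
- exact: e0.
rewrite -ge0_integralZl; first last.
- by rewrite lee_fin sqr_ge0.
- by move=> h _; apply: mule_ge0; [exact: int0|rewrite lee_fin].
- apply: (measurableT_comp (f := fun c => F (c, z))); first exact: (measurableT_comp mF (measurable_pair2 z)).
  exact: measurable_affine2.
- exact: measurableT.
have en : e n != 0 by rewrite gt_eqF.
apply: eq_integral => h _; rewrite -!EFinM/=; congr (_%:E).
rewrite !addNKr ![e n * _ / e n]mulrAC !divff// !mul1r -surjective_pairing.
by rewrite !mulrA mulfV ?mul1r// expf_neq0.
Qed.

Hypothesis iW : (\int[mu2]_z (W z)%:E < +oo)%E.

Let Q n (p : (MR * MR) * (MR * MR)) : \bar R := (W p.1 * kern p.2 * phi (- g1 p.1 + e n * p.2.1, - g2 p.1 + e n * p.2.2)%R)%:E.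

Let mQ n : measurable_fun setT (Q n).
Proof.
apply/measurable_EFinP; apply: measurable_funM.
  apply: measurable_funM; first exact: (measurableT_comp mW).
  exact: (measurableT_comp measurable_kern).
apply: (measurableT_comp mphi); apply: measurable_fun_pair; apply: measurable_funD.
- by apply: measurableT_comp => //; exact: (measurableT_comp mg1).
- by apply: measurable_funM => //; exact: (measurableT_comp measurable_fst).
- by apply: measurableT_comp => //; exact: (measurableT_comp mg2).
- by apply: measurable_funM => //; exact: (measurableT_comp measurable_snd).
Qed.

Let Q0 n p : (0 <= Q n p)%E.
Proof.
rewrite lee_fin; apply: mulr_ge0; last exact: phi0.
by apply: mulr_ge0; [exact: W0|exact: kern_ge0].
Qed.

Let rhs_cvg : (\int[mu2]_z \int[mu2]_h Q n (z, h))%E @[n --> \oo] --> (\int[mu2]_z (W z * phi (- g1 z, - g2 z))%:E)%E.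
Proof.
have Eq n : (\int[mu2]_z \int[mu2]_h Q n (z, h) = \int[(mu2 \x mu2)%E]_p Q n p)%E.
  have H := fubini_tonelli1 (m1 := mu2) (m2 := mu2) (Q n) (mQ n) (Q0 n).
  by apply/esym; exact: H.
under eq_fun do rewrite Eq.
pose q (p : (MR * MR) * (MR * MR)) : \bar R := ((W p.1 * phi (- g1 p.1, - g2 p.1))%:E * (kern p.2)%:E)%E.
have mb : measurable_fun setT (fun h : MR * MR => (kern h)%:E) by apply/measurable_EFinP; exact: measurable_kern.
have mWE : measurable_fun setT (fun h : MR * MR => (W h)%:E) by apply/measurable_EFinP; exact: mW.
have mq0 : measurable_fun setT (fun z : MR * MR => (W z * phi (- g1 z, - g2 z))%:E).
  apply/measurable_EFinP; apply: measurable_funM => //; apply: (measurableT_comp mphi).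
  by apply: measurable_fun_pair; apply: measurableT_comp.
have mq : measurable_fun setT q.
  by apply: emeasurable_funM; [exact: (measurableT_comp mq0)|exact: (measurableT_comp mb)].
have q0 p : (0 <= q p)%E.
  by apply: mule_ge0; rewrite lee_fin ?kern_ge0//; apply: mulr_ge0; [exact: W0|exact: phi0].
have -> : (\int[mu2]_z (W z * phi (- g1 z, - g2 z))%:E = \int[(mu2 \x mu2)%E]_p q p)%E.
  have H := fubini_tonelli1 (m1 := mu2) (m2 := mu2) q mq q0.
  apply/esym/(eq_trans H); apply: eq_integral => z _.
  rewrite /fubini_F /q/= ge0_integralZl; first by rewrite kern_int mule1.
  - exact: measurableT.
  - exact: mb.
  - by move=> h _; rewrite lee_fin kern_ge0.
  - by rewrite lee_fin mulr_ge0.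
pose b (p : (MR * MR) * (MR * MR)) : \bar R := ((W p.1)%:E * (Bp%:E * (kern p.2)%:E))%E.
apply: (@dominated_cvg _ _ _ (mu2 \x mu2)%E setT measurableT _ _ b).
- exact: mQ.
- move=> p _; rewrite /Q /q -EFinM; apply: cvg_EFin; first exact: nearW.
  have -> : W p.1 * phi (- g1 p.1, - g2 p.1) * kern p.2 = W p.1 * kern p.2 * phi (- g1 p.1, - g2 p.1) by ring.
  apply: cvgM; first exact: cvg_cst.
  exact: (@cvg_pt (- g1 p.1, - g2 p.1) p.2 phi cphi).
- by [].
- have mB : measurable_fun setT (fun h : MR * MR => (Bp%:E * (kern h)%:E)%E) by exact: emeasurable_funM.
  apply/integrableP; split.
    by apply: emeasurable_funM; [exact: (measurableT_comp mWE)|exact: (measurableT_comp mB)].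
  have -> : (fun p => `|b p|)%E = b.
    by apply/funext => p; rewrite gee0_abs// !mule_ge0// lee_fin ?kern_ge0.
  have mbb : measurable_fun setT b.
    by apply: emeasurable_funM; [exact: (measurableT_comp mWE)|exact: (measurableT_comp mB)].
  have b0 p : (0 <= b p)%E.
    by apply: mule_ge0; [rewrite lee_fin; exact: W0|apply: mule_ge0; rewrite lee_fin ?kern_ge0].
  have H := fubini_tonelli1 (m1 := mu2) (m2 := mu2) b mbb b0; rewrite [ltLHS]H {H}.
  have -> : fubini_F mu2 b = (fun z => (W z)%:E * Bp%:E)%E.
    apply/funext => z; rewrite /fubini_F /b/= ge0_integralZl; first last.
    + by rewrite lee_fin.
    + by move=> h _; rewrite mule_ge0 ?lee_fin ?kern_ge0.
    + exact: mB.
    + exact: measurableT.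
    rewrite ge0_integralZl; first by rewrite kern_int mule1.
    + exact: measurableT.
    + exact: mb.
    + by move=> h _; rewrite lee_fin kern_ge0.
    + by rewrite lee_fin.
  rewrite ge0_integralZr; first last.
  + by rewrite lee_fin.
  + by move=> z _; rewrite lee_fin.
  + exact: mWE.
  + exact: measurableT.
  rewrite muleC; apply: lte_mul_pinfty => //; by rewrite lee_fin.
- move=> n p _; rewrite gee0_abs; last exact: Q0.
  rewrite /Q /b -!EFinM lee_fin -mulrA ler_wpM2l// mulrC ler_wpM2r ?kern_ge0//.
Qed.

(** The integral of [smoothed] against phi is computed in two ways. By
[cell_cvg] and [smoothed_bound] it tends to the left-hand side; after
exchanging the integrals and substituting c = e_n h - G(z), it tends to the
right-hand side. *)
Lemma cell_integral : (\int[mu2]_c ((\esum_(z in Z c) (psi z)%:E) * (phi c)%:E) =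
  \int[mu2]_z (psi z * `|J z| * phi (- g1 z, - g2 z))%:E)%E.
Proof.
have := lhs_cvg; under eq_fun do rewrite lhsE.
by move=> H; apply: (cvg_unique _ H rhs_cvg); exact: ereal_hausdorff.
Qed.
End Cell.

(** * The area formula *)

Section Esum.
Context {R : realType} {T : choiceType}.

(** The limit passes through each finite partial sum, and both sides are
suprema of partial sums. *)
Lemma esum_nondecreasing_cvg (A : set T) (a : nat -> T -> \bar R) (b : T -> \bar R) :
  (forall j x, A x -> 0 <= a j x)%E -> (forall x, A x -> {homo a ^~ x : i j / (i <= j)%N >-> (i <= j)%E}) ->
  (forall x, A x -> a j x @[j --> \oo] --> b x) ->
  (\esum_(x in A) a j x)%E @[j --> \oo] --> (\esum_(x in A) b x)%E.
Proof.
move=> a0 nda ab.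
have nd : {homo (fun j => \esum_(x in A) a j x) : i j / (i <= j)%N >-> (i <= j)%E}.
  by move=> i j ij; apply: le_esum => x Ax; exact: nda.
have H := ereal_nondecreasing_cvgn nd.
suff -> : (\esum_(x in A) b x = ereal_sup (range (fun j => \esum_(x in A) a j x)))%E by exact: H.
apply/eqP; rewrite eq_le; apply/andP; split.
  apply: ge_ereal_sup => _ [F [finF FA] <-].
  rewrite -(cvg_lim _ H)//.
  have HF : \sum_(x \in F) a j x @[j --> \oo] --> \sum_(x \in F) b x.
    have FE (f : T -> \bar R) : \sum_(x \in F) f x =
        \sum_(x <- finmap.enum_fset (fset_set F) | x \in finmap.enum_fset (fset_set F)) f x.
      by rewrite fsbig_finite// big_seq.
    rewrite FE; under eq_fun do rewrite FE.
    apply: cvg_nnesum => x; rewrite in_fset_set// inE => /FA Ax.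
      by apply: nearW => j; exact: a0.
    exact: ab.
  rewrite -(cvg_lim _ HF)//; apply: lee_lim.
  - by apply/cvg_ex; exists (\sum_(x \in F) b x).
  - by apply/cvg_ex; eexists; exact: H.
  - by apply: nearW => j; apply: esum_ge; exists F.
apply: ge_ereal_sup => _ [j _ <-]; apply: le_esum => x Ax.
rewrite (cvg_unique _ (ab x Ax) (ereal_nondecreasing_cvgn (nda x Ax))); last exact: ereal_hausdorff.
by apply: ereal_sup_ubound; exists j.
Qed.

Lemma counting_esum (A : set T) : counting A = (\esum_(x in A) 1%:E)%E :> \bar R.
Proof.
have fs1 (F : set T) : finite_set F -> (\sum_(x \in F) (1 : R)%:E)%E = ((size (finmap.enum_fset (fset_set F)))%:R)%:E :> \bar R.
  move=> finF; rewrite fsbig_finite//= sumEFin; congr (_%:E).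
  by rewrite finmap.card_fset_sum1 natr_sum.
have [finA|infA] := pselect (finite_set A).
  by rewrite /counting asboolT// esum_fset// fs1.
rewrite /counting asboolF//; apply/esym/eqyP => r r0.
have [B BA nB] := infinite_set_fset (Num.trunc r).+1 infA.
move: BA; set S := (X in X `<=` A) => BA.
have finS : finite_set S by exact: finite_fset.
apply: esum_ge; exists S; first by split.
rewrite fs1// lee_fin /S set_fsetK; apply: (@le_trans _ _ (Num.trunc r).+1%:R).
  by rewrite ltW// truncnS_gt.
by rewrite ler_nat.
Qed.

End Esum.

Section Area.
Context {R : realType}.
Notation mu := (@lebesgue_measure R).
Notation MR := (measurableTypeR R).
Notation mu2 := (@plane R).

Lemma continuous_bound (f : R * R -> R) (M : R) : continuous f -> 0 <= M ->
  exists B, forall z, maxnorm z <= M -> `|f z| <= B.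
Proof.
move=> cf M0; pose K : set (R * R) := `[- M, M]%classic `*` `[- M, M]%classic.
have KE z : maxnorm z <= M -> K z.
  by rewrite /maxnorm ge_max !ler_norml => /andP[h1 h2]; split; rewrite /= in_itv.
have cK : compact K by apply: compact_setX; exact: segment_compact.
have K0 : K !=set0 by exists (0, 0); apply: KE; rewrite /maxnorm/= normr0 maxxx.
have cn : continuous (fun z => `|f z|).
  by move=> z; apply: (@continuous_comp _ _ _ f (fun x : R => `|x|)); [exact: cf|exact: norm_continuous].
have [m mK mmax] := compact_EVT_max K0 cK (continuous_subspaceT cn).
by exists `|f m| => z /KE Kz; apply: mmax; exact: mem_set.
Qed.

Lemma maxnorm_ge0 (z : R * R) : 0 <= maxnorm z. Proof. by rewrite /maxnorm le_max normr_ge0. Qed.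
Lemma maxnorm1 (z : R * R) : `|z.1| <= maxnorm z. Proof. by rewrite /maxnorm le_max lexx. Qed.
Lemma maxnorm2 (z : R * R) : `|z.2| <= maxnorm z. Proof. by rewrite /maxnorm le_max lexx orbT. Qed.

(** A map of the plane with continuous derivative matrix and a quadratic
Taylor remainder, uniform on bounded sets: the form in which polynomial maps
enter. *)
Context (g1 g2 la lb lc ld : R * R -> R) (s : R).
Hypothesis s2 : s ^+ 2 = 1.
Hypothesis mg1 : measurable_fun setT (g1 : MR * MR -> MR).
Hypothesis mg2 : measurable_fun setT (g2 : MR * MR -> MR).
Let J z := la z * ld z - lb z * lc z.
Hypothesis mJ : measurable_fun setT (J : MR * MR -> MR).
Hypothesis cg1 : continuous g1.
Hypothesis cg2 : continuous g2.
Hypothesis cla : continuous la.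
Hypothesis clb : continuous lb.
Hypothesis clc : continuous lc.
Hypothesis cld : continuous ld.
Hypothesis quad : forall M, 0 <= M -> exists C, forall z h, maxnorm z <= M -> maxnorm h <= 1 ->
  `|g1 (z.1 + h.1, z.2 + h.2) - g1 z - (la z * h.1 + lb z * h.2)| <= C * maxnorm h ^+ 2 /\
  `|g2 (z.1 + h.1, z.2 + h.2) - g2 z - (lc z * h.1 + ld z * h.2)| <= C * maxnorm h ^+ 2.

Let cJ : continuous J.
Proof.
by move=> z; apply: cvgB; apply: cvgM; [exact: cla|exact: cld|exact: clb|exact: clc].
Qed.

Let bounds (M : R) : 0 <= M -> exists B C : R, [/\ 0 < B, 0 < C,
  forall z, maxnorm z <= M -> [/\ `|la z| <= B, `|lb z| <= B, `|lc z| <= B, `|ld z| <= B & `|J z| <= B] &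
  forall z h, maxnorm z <= M -> maxnorm h <= 1 ->
  `|g1 (z.1 + h.1, z.2 + h.2) - g1 z - (la z * h.1 + lb z * h.2)| <= C * maxnorm h ^+ 2 /\
  `|g2 (z.1 + h.1, z.2 + h.2) - g2 z - (lc z * h.1 + ld z * h.2)| <= C * maxnorm h ^+ 2].
Proof.
move=> M0.
have [Ba ba] := continuous_bound cla M0.
have [Bb bb] := continuous_bound clb M0.
have [Bc bc] := continuous_bound clc M0.
have [Bd bd] := continuous_bound cld M0.
have [BJ bJ] := continuous_bound cJ M0.
have [C hC] := quad M0.
have z0 : maxnorm (0 : R, 0 : R) <= M by rewrite /maxnorm/= normr0 maxxx.
have a0 := le_trans (normr_ge0 _) (ba _ z0); have b0 := le_trans (normr_ge0 _) (bb _ z0).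
have c0 := le_trans (normr_ge0 _) (bc _ z0); have d0 := le_trans (normr_ge0 _) (bd _ z0).
have J0 := le_trans (normr_ge0 _) (bJ _ z0).
exists (Ba + Bb + Bc + Bd + BJ + 1), (`|C| + 1); split.
- by lra.
- by rewrite ltr_wpDl.
- move=> z hz; have := ba z hz; have := bb z hz; have := bc z hz; have := bd z hz; have := bJ z hz.
  by move=> hd hc hb ha hJ; split; lra.
- move=> z h hz hh; have [h1 h2] := hC z h hz hh.
  have E : C * maxnorm h ^+ 2 <= (`|C| + 1) * maxnorm h ^+ 2.
    by rewrite ler_wpM2r ?sqr_ge0//; have := ler_norm C; lra.
  by split; apply: le_trans E.
Qed.

Let mJn : measurable_fun setT ((fun z => `|J z|) : MR * MR -> MR).
Proof. exact: (measurableT_comp (@normr_measurable R setT) mJ). Qed.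

(** The convergence for every c is recorded together with the integrated
identity because it makes the sum over the fibre measurable in c. *)
Definition area_formula_for (psi : R * R -> R) : Prop :=
  (forall c, smoothed g1 g2 J psi n c @[n --> \oo] --> (\esum_(z in [set z | (g1 z = - c.1)%R /\ (g2 z = - c.2)%R]) (psi z)%:E)%E) /\
  (forall (phi : R * R -> R) (Bp : R), measurable_fun setT (phi : MR * MR -> MR) -> continuous phi ->
    (forall c, 0 <= phi c) -> (forall c, phi c <= Bp) -> (\int[mu2]_c (phi c)%:E < +oo)%E ->
    (\int[mu2]_c ((\esum_(z in [set z | (g1 z = - c.1)%R /\ (g2 z = - c.2)%R]) (psi z)%:E) * (phi c)%:E) =
     \int[mu2]_z (psi z * `|J z| * phi (- g1 z, - g2 z))%:E)%E).

Lemma area_sum (I : finType) (psi : I -> R * R -> R) : (forall i z, 0 <= psi i z) ->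
  (forall i, measurable_fun setT (psi i : MR * MR -> MR)) ->
  (forall i, area_formula_for (psi i)) -> area_formula_for (fun z => \sum_i psi i z).
Proof.
move=> p0 mp H.
have esE c : (\esum_(z in [set z | (g1 z = - c.1)%R /\ (g2 z = - c.2)%R]) (\sum_i psi i z)%:E =
   \sum_i \esum_(z in [set z | (g1 z = - c.1)%R /\ (g2 z = - c.2)%R]) (psi i z)%:E)%E.
  under eq_esum do rewrite -sumEFin.
  by rewrite esum_sum// => i j _ _; rewrite lee_fin.
split.
- move=> c; rewrite esE.
  have HE n : smoothed g1 g2 J (fun z => \sum_i psi i z) n c = (\sum_i smoothed g1 g2 J (psi i) n c)%E.
    rewrite /smoothed -ge0_integral_sum; first last.
    + move=> i z _; rewrite lee_fin mulr_ge0// ?invr_ge0 ?exprn_ge0 ?invr_ge0//.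
      by apply: mulr_ge0; [exact: mulr_ge0|exact: kern_ge0].
    + move=> i; apply/measurable_EFinP; apply: measurable_funM => //; apply: measurable_funM.
        by apply: measurable_funM; [exact: mp|exact: mJn].
      apply: (measurableT_comp measurable_kern); apply: measurable_fun_pair; apply: measurable_funM => //;
        exact: measurable_funD.
    + exact: measurableT.
    apply: eq_integral => z _; rewrite sumEFin; congr (_%:E).
    by rewrite !mulr_suml mulr_sumr.
  under eq_fun do rewrite HE.
  apply: cvg_nnesum => i _; last exact: (H i).1.
  apply: nearW => n; apply: smoothed_ge0 => z; exact: p0.
- move=> phi Bp mphi cphi phi0 phiB iphi.
  under eq_integral do rewrite esE.
  have es0 i (c : R * R) : (0 <= \esum_(z in [set z | (g1 z = - c.1)%R /\ (g2 z = - c.2)%R]) (psi i z)%:E)%E.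
    by apply: esum_ge0 => z _; rewrite lee_fin.
  transitivity (\int[mu2]_c \sum_i ((\esum_(z in [set z | (g1 z = - c.1)%R /\ (g2 z = - c.2)%R]) (psi i z)%:E) * (phi c)%:E))%E.
    by apply: eq_integral => c _; rewrite ge0_sume_distrl.
  rewrite ge0_integral_sum; first last.
  + by move=> i c _; rewrite mule_ge0// lee_fin.
  + move=> i; apply: emeasurable_funM; last exact/measurable_EFinP.
    apply: (emeasurable_fun_cvg (fun n => smoothed g1 g2 J (psi i) n)) => [n|c _].
      by apply: measurable_smoothed.
    exact: (H i).1.
  + exact: measurableT.
  under eq_bigr do rewrite (proj2 (H _) phi Bp)//.
  rewrite -ge0_integral_sum; first last.
  + by move=> i z _; rewrite lee_fin !mulr_ge0.
  + move=> i; apply/measurable_EFinP; apply: measurable_funM.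
      by apply: measurable_funM; [exact: mp|exact: mJn].
    by apply: (measurableT_comp mphi); apply: measurable_fun_pair; apply: measurableT_comp.
  + exact: measurableT.
  by apply: eq_integral => z _; rewrite sumEFin !mulr_suml.
Qed.

(** Continuous weights that increase to the indicator of s J > 0. On the
support of the weight of index j, J is bounded away from 0 and z is bounded.
*)
Definition sign_ramp (j : nat) (x : R) := ramp (j.+1%:R * x - 1).
Definition ball_ramp (j : nat) (x : R) := ramp (j.+2%:R - `|x|).
Definition sign_weight (j : nat) (z : R * R) := sign_ramp j (s * J z) * (ball_ramp j z.1 * ball_ramp j z.2).

Let ramp_ne0 (x : R) : ramp x != 0 -> 0 < x.
Proof. by apply: contra_neqT; rewrite -leNgt; exact: ramp0. Qed.

Lemma sign_weight_ge0 j z : 0 <= sign_weight j z.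
Proof. by apply: mulr_ge0; [exact: ramp_ge0|apply: mulr_ge0; exact: ramp_ge0]. Qed.

Let sign_weight_supp j z : sign_weight j z != 0 -> j.+1%:R^-1 <= s * J z /\ maxnorm z <= j.+2%:R.
Proof.
move=> pz; have : (sign_ramp j (s * J z) != 0) && ((ball_ramp j z.1 != 0) && (ball_ramp j z.2 != 0)).
  by rewrite -!negb_or -!mulf_eq0.
move=> /andP[/ramp_ne0 h1 /andP[/ramp_ne0 h2 /ramp_ne0 h3]]; split.
  by rewrite -[leLHS]mul1r ler_pdivrMr// mulrC -subr_ge0 ltW.
by rewrite /maxnorm ge_max -!(subr_ge0 `|_|) !ltW.
Qed.

Let sign_weight_le1 j z : sign_weight j z <= 1.
Proof.
rewrite /sign_weight -[leRHS]mulr1; apply: ler_pM; [exact: ramp_ge0|apply: mulr_ge0; exact: ramp_ge0|exact: ramp_le1|].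
by rewrite -[leRHS]mulr1; apply: ler_pM; [exact: ramp_ge0|exact: ramp_ge0|exact: ramp_le1|exact: ramp_le1].
Qed.

Let continuous_sign_weight j : continuous (sign_weight j).
Proof.
move=> z; apply: cvgM.
  apply: (@continuous_comp _ _ _ (fun z => j.+1%:R * (s * J z) - 1) ramp); last exact: continuous_ramp.
  apply: cvgB; last exact: cvg_cst.
  by apply: cvgM; [exact: cvg_cst|apply: cvgM; [exact: cvg_cst|exact: cJ]].
have cc (f : R * R -> R) : continuous f -> continuous (fun z => ball_ramp j (f z)).
  move=> cf w; apply: (@continuous_comp _ _ _ (fun z => j.+2%:R - `|f z|) ramp); last exact: continuous_ramp.
  apply: cvgB; first exact: cvg_cst.
  by apply: (@continuous_comp _ _ _ f (fun x : R => `|x|)); [exact: cf|exact: norm_continuous].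
by apply: cvgM; apply: cc => ?; [exact: cvg_fst|exact: cvg_snd].
Qed.

Lemma measurable_sign_weight j : measurable_fun setT (sign_weight j : MR * MR -> MR).
Proof.
apply: measurable_funM.
  apply: (measurableT_comp measurable_ramp); apply: measurable_funB => //.
  by apply: measurable_funM => //; apply: measurable_funM.
by apply: measurable_funM; apply: (measurableT_comp measurable_ramp); apply: measurable_funB => //;
  apply: measurableT_comp => //.
Qed.

Let e (n : nat) : R := n.+1%:R^-1.

Let quad_cvg (g l m : R * R -> R) (C : R) z (h : R * R) :
  (forall h, maxnorm h <= 1 -> `|g (z.1 + h.1, z.2 + h.2) - g z - (l z * h.1 + m z * h.2)| <= C * maxnorm h ^+ 2) ->
  (fun n => (g (z.1 + e n * h.1, z.2 + e n * h.2) - g z) / e n) @ \oo --> l z * h.1 + m z * h.2.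
Proof.
move=> H.
have ce : e @ \oo --> (0 : R) by exact: cvg_harmonic.
have e0 n : 0 < e n by rewrite invr_gt0.
apply/cvgrPdist_le => eps eps0.
have ne n : maxnorm (e n * h.1, e n * h.2) = e n * maxnorm h.
  by rewrite /maxnorm/= !normrM !(gtr0_norm (e0 n)) -maxr_pMr ?(ltW (e0 n)).
pose b := `|C| * maxnorm h ^+ 2 + maxnorm h + 1.
have b0 : 0 < b by rewrite ltr_wpDl// addr_ge0 ?maxnorm_ge0// mulr_ge0 ?sqr_ge0.
near=> n.
have en : e n * b < Num.min eps 1.
  rewrite -ltr_pdivlMr//; near: n; apply: (cvgr_lt 0 ce).
  by rewrite divr_gt0// lt_min eps0 ltr01.
have en1 : e n * b < eps by apply: lt_le_trans en _; rewrite ge_min lexx.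
have en2 : e n * b < 1 by apply: lt_le_trans en _; rewrite ge_min lexx orbT.
have k0 : 0 <= `|C| * maxnorm h ^+ 2 by rewrite mulr_ge0 ?sqr_ge0.
have nh : maxnorm (e n * h.1, e n * h.2) <= 1.
  rewrite ne; apply: le_trans (ltW en2); rewrite ler_wpM2l ?(ltW (e0 n))// /b; have := maxnorm_ge0 h; lra.
have := H _ nh; rewrite ne/= => {}H.
rewrite distrC.
have -> : (g (z.1 + e n * h.1, z.2 + e n * h.2) - g z) / e n - (l z * h.1 + m z * h.2) =
  (g (z.1 + e n * h.1, z.2 + e n * h.2) - g z - (l z * (e n * h.1) + m z * (e n * h.2))) / e n.
  by field; rewrite gt_eqF.
rewrite normrM normfV (gtr0_norm (e0 n)) ler_pdivrMr//; apply: le_trans H _.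
rewrite (_ : C * _ = e n * (e n * (C * maxnorm h ^+ 2))); last by ring.
rewrite [eps * _]mulrC ler_wpM2l ?(ltW (e0 n))//.
apply: le_trans (ltW en1); rewrite ler_wpM2l ?(ltW (e0 n))// /b.
have : C * maxnorm h ^+ 2 <= `|C| * maxnorm h ^+ 2 by rewrite ler_wpM2r ?sqr_ge0// ler_norm.
have := maxnorm_ge0 h; lra.
Unshelve. all: by end_near. Qed.

Let s1 : `|s| = 1.
Proof. by apply/eqP; rewrite -sqrp_eq1// -normrX s2 normr1. Qed.

(** The partition of unity of [tent_sum] cuts the weight into cells of side d.
There |J| >= 1 / (j + 1), so the derivative expands distances by l0 at least;
for small d the quadratic remainder cannot spoil more than half of this, and
the map expands by l0 / 2, as a cell requires. *)
Lemma area_sign_weight j : area_formula_for (sign_weight j).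
Proof.
have M0 : (0 : R) <= j.+2%:R by [].
have [B [C [B0 C0 hB hC]]] := bounds M0.
(* by Cramer's rule, the derivative having entries bounded by B *)
pose l0 : R := (j.+1%:R * (2 * B))^-1.
have l00 : 0 < l0 by rewrite invr_gt0 !mulr_gt0.
(* chosen for 2 d <= 1 and 2 d C <= l0 / 2 *)
pose d : R := (2 + 4 * C / l0)^-1.
have d0' : 0 < 2 + 4 * C / l0 by rewrite ltr_pwDl// divr_ge0 ?mulr_ge0// ltW.
have d0 : 0 < d by rewrite invr_gt0.
have d1 : 2 * d <= 1.
  by rewrite /d ler_pdivrMr// mul1r lerDl divr_ge0 ?mulr_ge0 ?ltW.
have d2 : 2 * d * C <= l0 / 2.
  rewrite /d mulrAC ler_pdivrMr// (_ : _ / 2 * _ = l0 + 2 * C); last by field; rewrite gt_eqF.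
  by rewrite lerDr ltW.
pose N := (Num.trunc (j.+2%:R / d)).+1.
have hN : j.+2%:R / d <= N%:R by rewrite ltW// truncnS_gt.
pose k := (2 * N).+1.
pose pc (i : 'I_k * 'I_k) (z : R * R) := sign_weight j z * (tent (z.1 / d - (i.1%:R - N%:R)) * tent (z.2 / d - (i.2%:R - N%:R))).
have pcE : sign_weight j = (fun z => \sum_i pc i z).
  apply/funext => z; rewrite /pc -mulr_sumr.
  have [->|/sign_weight_supp[_ hz]] := eqVneq (sign_weight j z) 0; first by rewrite mul0r.
  rewrite -[LHS]mulr1; congr (_ * _).
  rewrite -(pair_bigA _ (fun i i' : 'I_k => tent (z.1 / d - (i%:R - N%:R)) * tent (z.2 / d - (i'%:R - N%:R))))/=.
  under eq_bigr do rewrite -mulr_sumr.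
  rewrite -mulr_suml !tent_sum ?mulr1//; rewrite normrM normfV (gtr0_norm d0) (le_trans _ hN)// ler_pM2r ?invr_gt0//.
    exact: le_trans (maxnorm2 z) hz.
  exact: le_trans (maxnorm1 z) hz.
rewrite pcE; apply: area_sum.
- by move=> i z; apply: mulr_ge0; [exact: sign_weight_ge0|apply: mulr_ge0; exact: tent_ge0].
- move=> i; rewrite /pc; apply: measurable_funM; first exact: measurable_sign_weight.
  apply: measurable_funM; apply: (measurableT_comp measurable_tent); apply: measurable_funB => //; exact: measurable_funM.
move=> i.
pose K : set (R * R) := [set z | [/\ `|z.1 - d * (i.1%:R - N%:R)| <= d, `|z.2 - d * (i.2%:R - N%:R)| <= d,
   maxnorm z <= j.+2%:R & j.+1%:R^-1 <= s * J z]].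
have KJ z : K z -> j.+1%:R^-1 <= `|J z|.
  by case=> _ _ _ h; apply: le_trans h _; apply: le_trans (ler_norm _) _; rewrite normrM s1 mul1r.
have cK : compact K.
  pose a1 : R := d * (i.1%:R - N%:R); pose a2 : R := d * (i.2%:R - N%:R).
  pose b : R := j.+2%:R.
  pose K1 : set (R * R) := (`[a1 - d, a1 + d]%classic `*` `[a2 - d, a2 + d]%classic).
  pose K2 : set (R * R) := (`[- b, b]%classic `*` `[- b, b]%classic).
  pose K3 : set (R * R) := (fun z => s * J z) @^-1` [set x | j.+1%:R^-1 <= x].
  have -> : K = K3 `&` (K2 `&` K1).
    apply/seteqP; split => z.
      move=> [h1 h2 h3 h4]; split => //; move: h1 h2 h3; rewrite !ler_distl /maxnorm ge_max !ler_norml.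
      by move=> h1 h2 /andP[h3 h5]; split; split; rewrite /= in_itv.
    move=> [h1 [[/= h2 h3] [/= h4 h5]]]; move: h2 h3 h4 h5; rewrite !in_itv/= => h2 h3 h4 h5.
    by split => //; rewrite ?ler_distl// /maxnorm ge_max !ler_norml h2 h3.
  apply: (@subclosed_compact _ _ K1) => //; last by move=> z [_ []].
    apply: closedI; last apply: closedI.
    - apply: closed_comp; last exact: closed_ge.
      by move=> z _; apply: cvgM; [exact: cvg_cst|exact: cJ].
    - by apply: compact_closed => //; apply: compact_setX; exact: segment_compact.
    - by apply: compact_closed => //; apply: compact_setX; exact: segment_compact.
  by apply: compact_setX; exact: segment_compact.
have pcK z : pc i z != 0 -> K z.
  rewrite /pc mulf_eq0 negb_or => /andP[/sign_weight_supp[h1 h2]].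
  rewrite mulf_eq0 negb_or => /andP[/tent_supp h3 /tent_supp h4].
  have A (x y : R) : `|x / d - y| < 1 -> `|x - d * y| <= d.
    move=> h; rewrite (_ : x - d * y = d * (x / d - y)); last by field; rewrite gt_eqF.
    by rewrite normrM (gtr0_norm d0) -[leRHS]mulr1 ler_wpM2l ?ltW.
  by split => //; exact: A.
have lip z z' : K z -> K z' ->
    l0 / 2 * maxnorm (z.1 - z'.1, z.2 - z'.2) <= maxnorm (g1 z - g1 z', g2 z - g2 z').
  move=> Kz Kz'; have Jz' := KJ _ Kz'; case: Kz => [h1 h2 h3 h4]; case: Kz' => [h1' h2' h3' h4'].
  pose h : R * R := (z.1 - z'.1, z.2 - z'.2); rewrite -/h.
  have nh : maxnorm h <= 2 * d.
    have A (x y t : R) : `|x - t| <= d -> `|y - t| <= d -> `|x - y| <= 2 * d.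
      move=> hx hy; rewrite (_ : x - y = (x - t) - (y - t)); last by ring.
      by apply: le_trans (ler_normB _ _) _; rewrite mulr_natl mulr2n lerD.
    by rewrite /maxnorm /h ge_max/=; apply/andP; split; [exact: A h1 h1'|exact: A h2 h2'].
  have nh0 := maxnorm_ge0 h.
  have [q1 q2] := hC z' h h3' (le_trans nh d1).
  have [ba bb bc bd _] := hB z' h3'.
  move: q1 q2; rewrite !(addrC _ (_ - _)) !subrK -surjective_pairing.
  set u := la z' * _ + _; set v := lc z' * _ + _; set G := maxnorm (g1 z - g1 z', g2 z - g2 z') => q1 q2.
  have Q : C * maxnorm h ^+ 2 <= l0 / 2 * maxnorm h.
    rewrite expr2 mulrA ler_wpM2r//; apply: le_trans d2; rewrite mulrC ler_wpM2r//; exact: ltW.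
  have E1 : J z' * h.1 = ld z' * u - lb z' * v by rewrite /J /u /v; ring.
  have E2 : J z' * h.2 = la z' * v - lc z' * u by rewrite /J /u /v; ring.
  have U : `|u| <= G + l0 / 2 * maxnorm h.
    rewrite (_ : u = (g1 z - g1 z') - (g1 z - g1 z' - u)); last by ring.
    apply: le_trans (ler_normB _ _) _; apply: lerD; first exact: (maxnorm1 (g1 z - g1 z', g2 z - g2 z')).
    exact: le_trans q1 Q.
  have V : `|v| <= G + l0 / 2 * maxnorm h.
    rewrite (_ : v = (g2 z - g2 z') - (g2 z - g2 z' - v)); last by ring.
    apply: le_trans (ler_normB _ _) _; apply: lerD; first exact: (maxnorm2 (g1 z - g1 z', g2 z - g2 z')).
    exact: le_trans q2 Q.
  set X := G + _ in U V.
  have bnd (p q x : R) : `|p| <= B -> `|q| <= B -> J z' * x = p * u - q * v \/ J z' * x = p * v - q * u -> l0 * `|x| <= X.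
    move=> hp hq HE.
    have : `|J z' * x| <= 2 * B * X.
      have t (a b : R) : `|a| <= B -> `|b| <= X -> `|a * b| <= B * X by move=> ha hb; rewrite normrM ler_pM.
      by case: HE => ->; apply: le_trans (ler_normB _ _) _; rewrite -mulrA mulr_natl mulr2n lerD// t.
    rewrite normrM => HH.
    have : j.+1%:R^-1 * `|x| <= 2 * B * X by apply: le_trans HH; rewrite ler_wpM2r.
    move=> HH'; rewrite /l0 (_ : _ * `|x| = j.+1%:R^-1 * `|x| / (2 * B)); last first.
      by rewrite [in LHS]invfM mulrAC.
    by rewrite ler_pdivrMr; [rewrite [leRHS]mulrC|exact: mulr_gt0].
  have HX : l0 * maxnorm h <= X.
    rewrite /maxnorm maxr_pMr ?(ltW l00)// ge_max; apply/andP; split.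
      by apply: (bnd (ld z') (lb z')) => //; left.
    by apply: (bnd (la z') (lc z')) => //; right.
  rewrite -(lerD2r (l0 / 2 * maxnorm h)); apply: le_trans HX.
  by rewrite -mulrDl -splitr.
have pc0 z : 0 <= pc i z.
  by apply: mulr_ge0; [exact: sign_weight_ge0|apply: mulr_ge0; exact: tent_ge0].
have WB z : pc i z * `|J z| <= B.
  have [->|pz] := eqVneq (pc i z) 0; first by rewrite mul0r ltW.
  have [_ _ h _] := pcK z pz; have [_ _ _ _ bJ] := hB z h.
  rewrite -[leRHS]mul1r; apply: ler_pM => //.
  rewrite /pc -[leRHS]mulr1; apply: ler_pM; [exact: sign_weight_ge0|apply: mulr_ge0; exact: tent_ge0|exact: sign_weight_le1|].
  by rewrite -[leRHS]mulr1; apply: ler_pM; [exact: tent_ge0|exact: tent_ge0|exact: tent_le1|exact: tent_le1].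
have mpc : measurable_fun setT (pc i : MR * MR -> MR).
  rewrite /pc; apply: measurable_funM; first exact: measurable_sign_weight.
  apply: measurable_funM; apply: (measurableT_comp measurable_tent); apply: measurable_funB => //; exact: measurable_funM.
have cpc : continuous (pc i).
  move=> z; apply: cvgM; first exact: continuous_sign_weight.
  have cc (f : R * R -> R) (y : R) : continuous f -> continuous (fun z => tent (f z / d - y)).
    move=> cf w; apply: (@continuous_comp _ _ _ (fun z => f z / d - y) tent); last exact: continuous_tent.
    by apply: cvgB; [apply: cvgM; [exact: cf|exact: cvg_cst]|exact: cvg_cst].
  by apply: cvgM; apply: cc => ?; [exact: cvg_fst|exact: cvg_snd].
have KJ0 z : K z -> J z != 0 by move=> /KJ h; rewrite -normr_gt0; apply: lt_le_trans h; rewrite invr_gt0.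
have l02 : 0 < l0 / 2 by rewrite divr_gt0.
have D1 z (h : R * R) : K z ->
  (fun n => (g1 (z.1 + e n * h.1, z.2 + e n * h.2) - g1 z) / e n) @ \oo --> la z * h.1 + lb z * h.2.
  by move=> [_ _ hz _]; apply: (@quad_cvg g1 la lb C) => h' hh'; have [] := hC z h' hz hh'.
have D2 z (h : R * R) : K z ->
  (fun n => (g2 (z.1 + e n * h.1, z.2 + e n * h.2) - g2 z) / e n) @ \oo --> lc z * h.1 + ld z * h.2.
  by move=> [_ _ hz _]; apply: (@quad_cvg g2 lc ld C) => h' hh'; have [] := hC z h' hz hh'.
split.
  move=> c; exact: (@cell_cvg R g1 g2 J (pc i) la lb lc ld K (l0 / 2) B).
move=> phi Bp mphi cphi phi0 phiB iphi.
apply: (@cell_integral R g1 g2 J (pc i) la lb lc ld K (l0 / 2) B _ _ _ _ _ _ _ _ _ _ _ _ _ _ _ _ _ _ phi Bp) => //.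
pose Q : set (MR * MR) := `[- j.+2%:R, j.+2%:R]%classic `*` `[- j.+2%:R, j.+2%:R]%classic.
have mQ : measurable Q by apply: measurableX; exact: measurable_itv.
apply: (@le_lt_trans _ _ (\int[mu2]_z (B%:E * (\1_Q z)%:E))%E).
  apply: ge0_le_integral => //.
  - by move=> z _; rewrite lee_fin mulr_ge0.
  - by apply/measurable_EFinP; apply: measurable_funM => //; apply: measurableT_comp.
  - by apply/measurable_EFinP; apply: measurable_funM => //; exact: measurable_indic.
  - move=> z _; rewrite -EFinM lee_fin.
    have [->|pz] := eqVneq (pc i z) 0; first by rewrite mul0r indicE; apply: mulr_ge0; [exact: ltW|].
    have [_ _ hz _] := pcK z pz.
    rewrite indicE (_ : z \in Q = true); first by rewrite mulr1; exact: WB.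
    apply: mem_set.
    by move: hz; rewrite /maxnorm ge_max !ler_norml => /andP[? ?]; split; rewrite /= in_itv.
rewrite ge0_integralZl; first last.
- by rewrite lee_fin ltW.
- by move=> z _; rewrite lee_fin indicE.
- by apply/measurable_EFinP; exact: measurable_indic.
- exact: measurableT.
rewrite integral_indic; [|exact: measurableT|exact: mQ].
rewrite setIT [X in (_ * X)%E](planeX (measurable_itv _) (measurable_itv _)).
apply: lte_mul_pinfty => //; first by rewrite lee_fin ltW.
have E x : (mu `[(- x)%R, x%R]%classic < +oo)%E.
  have := @lebesgue_measure_itv R `[(- x)%R, x%R]; rewrite /= => E.
  by rewrite [ltLHS]E; case: ifP => _; rewrite ?ltry// -EFinB ltry.
by apply: lte_mul_pinfty; [exact: measure_ge0|rewrite ge0_fin_numE ?measure_ge0//; exact: E|exact: E].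
Qed.

Let sign_ramp_le i j x : (i <= j)%N -> sign_ramp i x <= sign_ramp j x.
Proof.
move=> ij; have [x0|x0] := leP x 0.
  rewrite /sign_ramp !ramp0 ?subr_le0//; [|]; by rewrite (le_trans _ ler01)// mulr_ge0_le0.
by apply: ramp_le; rewrite lerD2r ler_wpM2r ?ler_nat// ltW.
Qed.

Let ball_ramp_le i j x : (i <= j)%N -> ball_ramp i x <= ball_ramp j x.
Proof. by move=> ij; apply: ramp_le; rewrite lerD2r ler_nat. Qed.

Lemma sign_weight_le i j z : (i <= j)%N -> sign_weight i z <= sign_weight j z.
Proof.
move=> ij; apply: ler_pM; [exact: ramp_ge0|apply: mulr_ge0; exact: ramp_ge0|exact: sign_ramp_le|].
by apply: ler_pM; [exact: ramp_ge0|exact: ramp_ge0|exact: ball_ramp_le|exact: ball_ramp_le].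
Qed.

Lemma sign_weight_cvg z : sign_weight j z @[j --> \oo] --> ((0 < s * J z)%R%:R : R).
Proof.
have big (x : R) : \forall j \near \oo, x <= j.+1%:R.
  near=> j; apply: (@le_trans _ _ (Num.trunc x).+1%:R); first by rewrite ltW// truncnS_gt.
  by rewrite ler_nat ltnS; near: j; exact: nbhs_infty_ge.
have [h|h] := ltP 0 (s * J z); last first.
  apply: cvg_near_cst; apply: nearW => j.
  rewrite /sign_weight /sign_ramp ramp0 ?mul0r// subr_le0 (le_trans _ ler01)// mulr_ge0_le0//.
apply: cvg_near_cst; near=> j.
rewrite /sign_weight /sign_ramp ramp1; last first.
  rewrite lerBrDr -ler_pdivrMr//; near: j; exact: big.
rewrite /ball_ramp !ramp1 ?mul1r//.
- rewrite -natr1 -addrA [1 - _]addrC addrA lerDr subr_ge0; near: j; exact: big.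
- rewrite -natr1 -addrA [1 - _]addrC addrA lerDr subr_ge0; near: j; exact: big.
Unshelve. all: by end_near. Qed.

Let Z (c : R * R) : set (R * R) := [set z | (g1 z = - c.1)%R /\ (g2 z = - c.2)%R].

Definition fiber_count (c : R * R) : \bar R := counting [set z | Z c z /\ (0 < s * J z)%R].

Lemma fiber_count_cvg c : (\esum_(z in Z c) (sign_weight j z)%:E)%E @[j --> \oo] --> fiber_count c.
Proof.
rewrite /fiber_count counting_esum.
have -> : (\esum_(z in [set z | Z c z /\ (0 < s * J z)%R]) 1%:E = \esum_(z in Z c) ((0 < s * J z)%R%:R : R)%:E)%E.
  rewrite esum_mkcond [RHS]esum_mkcond; apply: eq_esum => z _.
  have [zZ|zZ] := boolP (z \in Z c); last first.
    by rewrite ifF//; apply/negP; rewrite inE => -[h _]; move: zZ; rewrite notin_setE; exact.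
  have [h|h] := boolP (0 < s * J z).
    by rewrite ifT// inE; split=> //; move: zZ; rewrite inE.
  by rewrite ifF//; apply/negP; rewrite inE => -[_ h']; rewrite h' in h.
apply: esum_nondecreasing_cvg.
- by move=> j x _; rewrite lee_fin sign_weight_ge0.
- by move=> x _ i j ij; rewrite lee_fin sign_weight_le.
- by move=> x _; apply: cvg_EFin; [exact: nearW|exact: sign_weight_cvg].
Qed.

Let es0 j c : (0 <= \esum_(z in Z c) (sign_weight j z)%:E)%E.
Proof. by apply: esum_ge0 => z _; rewrite lee_fin sign_weight_ge0. Qed.

Let mes j : measurable_fun setT ((fun c => \esum_(z in Z c) (sign_weight j z)%:E)%E : MR * MR -> \bar R).
Proof.
apply: (emeasurable_fun_cvg (fun n => smoothed g1 g2 J (sign_weight j) n)) => [n|c _].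
  by apply: measurable_smoothed => //; [exact: measurable_sign_weight|exact: sign_weight_ge0].
exact: (area_sign_weight j).1.
Qed.

(** Monotone convergence on both sides of [area_sign_weight]. *)
Theorem area_formula (phi : R * R -> R) (Bp : R) : measurable_fun setT (phi : MR * MR -> MR) -> continuous phi ->
    (forall c, 0 <= phi c) -> (forall c, phi c <= Bp) -> (\int[mu2]_c (phi c)%:E < +oo)%E ->
  (\int[mu2]_c (fiber_count c * (phi c)%:E) = \int[mu2]_z (Num.max 0 (s * J z) * phi (- g1 z, - g2 z))%:E)%E.
Proof.
move=> mphi cphi phi0 phiB iphi.
have L : (\int[mu2]_c ((\esum_(z in Z c) (sign_weight j z)%:E) * (phi c)%:E))%E @[j --> \oo] --> (\int[mu2]_c (fiber_count c * (phi c)%:E))%E.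
  have HL c : ((\esum_(z in Z c) (sign_weight j z)%:E) * (phi c)%:E)%E @[j --> \oo] --> (fiber_count c * (phi c)%:E)%E.
    by apply: cvgeZr => //; exact: fiber_count_cvg.
  rewrite (_ : (fun c => fiber_count c * (phi c)%:E)%E = (fun c => limn (fun j => (\esum_(z in Z c) (sign_weight j z)%:E) * (phi c)%:E)%E)); last first.
    by apply/funext => c; apply/esym/cvg_lim => //; exact: HL.
  apply: cvg_monotone_convergence => //.
  - by move=> j; apply: emeasurable_funM; [exact: mes|exact/measurable_EFinP].
  - by move=> j c _; rewrite mule_ge0// lee_fin.
  - move=> c _ i j ij; apply: lee_wpmul2r; first by rewrite lee_fin.
    by apply: le_esum => z _; rewrite lee_fin sign_weight_le.
have mphig : measurable_fun setT ((fun z => phi (- g1 z, - g2 z)) : MR * MR -> MR).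
  by apply: (measurableT_comp mphi); apply: measurable_fun_pair; apply: measurableT_comp.
have Rr : (\int[mu2]_z (sign_weight j z * `|J z| * phi (- g1 z, - g2 z))%:E)%E @[j --> \oo] -->
    (\int[mu2]_z (Num.max 0 (s * J z) * phi (- g1 z, - g2 z))%:E)%E.
  have HL z : (sign_weight j z * `|J z| * phi (- g1 z, - g2 z))%:E @[j --> \oo] --> (Num.max 0 (s * J z) * phi (- g1 z, - g2 z))%:E.
    apply: cvg_EFin; first exact: nearW.
    apply: cvgM; last exact: cvg_cst.
    have -> : Num.max 0 (s * J z) = (0 < s * J z)%R%:R * `|J z|.
      have -> : `|J z| = `|s * J z| by rewrite normrM s1 mul1r.
      have [h|h] := ltP 0 (s * J z); first by rewrite mulr1n mul1r gtr0_norm.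
      by rewrite mulr0n mul0r.
    by apply: cvgM; [exact: sign_weight_cvg|exact: cvg_cst].
  rewrite (_ : (fun z => (Num.max 0 (s * J z) * phi (- g1 z, - g2 z))%:E) =
    (fun z => limn (fun j => (sign_weight j z * `|J z| * phi (- g1 z, - g2 z))%:E))); last first.
    by apply/funext => z; apply/esym/cvg_lim => //; exact: HL.
  apply: cvg_monotone_convergence => //.
  - move=> j; apply/measurable_EFinP; apply: measurable_funM => //.
    by apply: measurable_funM; [exact: measurable_sign_weight|exact: mJn].
  - by move=> j z _; rewrite lee_fin; apply: mulr_ge0 => //; apply: mulr_ge0 => //; exact: sign_weight_ge0.
  - move=> z _ i j ij; rewrite lee_fin; apply: ler_wpM2r => //; apply: ler_wpM2r => //; exact: sign_weight_le.
have E j := (area_sign_weight j).2 phi Bp mphi cphi phi0 phiB iphi.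
apply: (cvg_unique _ L); first exact: ereal_hausdorff.
by rewrite /= -/Z in E *; under eq_fun do rewrite E.
Qed.

End Area.

(** * Independent complex Gaussians *)

Section Joint.
Context {R : realType} d (T : measurableType d) (P : probability T R).
Context d1 d2 (D1 : measurableType d1) (D2 : measurableType d2) (X : T -> D1) (Y : T -> D2).
Hypothesis mX : measurable_fun setT X.
Hypothesis mY : measurable_fun setT Y.
Hypothesis indep : forall A B, measurable A -> measurable B ->
  P (X @^-1` A `&` Y @^-1` B) = (P (X @^-1` A) * P (Y @^-1` B))%E.

Let mXY : measurable_fun setT (fun w => (X w, Y w)).
Proof. exact: measurable_fun_pair. Qed.

Let Xf : {mfun T >-> D1} := HB.pack X (@isMeasurableFun.Build _ _ _ _ X mX).
Let Yf : {mfun T >-> D2} := HB.pack Y (@isMeasurableFun.Build _ _ _ _ Y mY).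
Let XYf : {mfun T >-> (D1 * D2)%type} := HB.pack (fun w => (X w, Y w)) (@isMeasurableFun.Build _ _ _ _ (fun w => (X w, Y w)) mXY).

Lemma integral_law (f : D1 -> \bar R) (nu : {measure set D1 -> \bar R}) :
  (forall A, measurable A -> P (X @^-1` A) = nu A) ->
  measurable_fun setT f -> (forall x, 0 <= f x)%E ->
  (\int[P]_w f (X w) = \int[nu]_x f x)%E.
Proof.
move=> h mf f0; have := @ge0_integral_distribution _ _ _ _ _ P Xf f mf f0.
rewrite /comp/= => <-; apply: eq_measure_integral => A mA _.
exact: h.
Qed.

(** The joint law is the product of the two laws, and Tonelli's theorem
applies in either order. *)
Lemma joint_integral (f : D1 * D2 -> \bar R) : measurable_fun setT f -> (forall x, 0 <= f x)%E ->
  (\int[P]_w f (X w, Y w) = \int[P]_u \int[P]_w f (X u, Y w))%E /\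
  (\int[P]_w f (X w, Y w) = \int[P]_w \int[P]_u f (X u, Y w))%E.
Proof.
move=> mf f0.
have E : (\int[P]_w f (X w, Y w) = \int[distribution P Xf \x distribution P Yf]_z f z)%E.
  have := @ge0_integral_distribution _ _ _ _ _ P XYf f mf f0.
  rewrite /comp/= => <-; apply: eq_measure_integral => A mA _.
  by apply/esym; apply: product_measure_unique.
have m1 x : measurable_fun setT (fun y => f (x, y)) by apply: (measurableT_comp mf); exact: measurable_pair1.
have m2 y : measurable_fun setT (fun x => f (x, y)) by apply: (measurableT_comp mf); exact: measurable_pair2.
split.
  rewrite E fubini_tonelli1// (@ge0_integral_distribution _ _ _ _ _ P Xf); first last.
  - by move=> x; apply: integral_ge0.
  - exact: measurable_fun_fubini_tonelli_F.
  apply: eq_integral => x _ /=.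
  by rewrite /fubini_F (@ge0_integral_distribution _ _ _ _ _ P Yf (fun y => f (X x, y)) (m1 _)).
rewrite E fubini_tonelli2// (@ge0_integral_distribution _ _ _ _ _ P Yf); first last.
- by move=> x; apply: integral_ge0.
- exact: measurable_fun_fubini_tonelli_G.
apply: eq_integral => y _ /=.
by rewrite /fubini_G (@ge0_integral_distribution _ _ _ _ _ P Xf (fun x => f (x, Y y)) (m2 _)).
Qed.

End Joint.

Section Cylinders.
Context {R : realType} d (T : measurableType d) (P : probability T R).
Context (I : finType) d' (D : measurableType d') (X : I -> T -> D).
Hypothesis mX : forall i, measurable_fun setT (X i).
Hypothesis indep : mutually_independent P X.

(** A pi-system that generates the events depending on the coordinates in J
only. *)
Definition cylinders (J : {set I}) : set (set T) :=
  [set A | exists2 B : I -> set D, (forall i, measurable (B i)) & A = \bigcap_(i in [set` J]) (X i @^-1` B i)].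

Lemma measurable_preim i B : measurable B -> measurable (X i @^-1` B).
Proof. by move=> mB; rewrite -[X in measurable X]setTI; exact: mX. Qed.

Lemma cylinders_measurable J : cylinders J `<=` measurable.
Proof.
move=> _ [B mB ->]; apply: fin_bigcap_measurable; first exact: finite_finset.
by move=> i _; exact: measurable_preim.
Qed.

Lemma cylinders_setI J : setI_closed (cylinders J).
Proof.
move=> _ _ [B mB ->] [B' mB' ->]; exists (fun i => B i `&` B' i).
  by move=> i; exact: measurableI.
by rewrite -bigcapI; apply: eq_bigcapr => i _; rewrite preimage_setI.
Qed.

Lemma cylinders_setT J : cylinders J setT.
Proof.
exists (fun=> setT); first by [].
by apply/seteqP; split.
Qed.

Lemma cylinders_preim (J : {set I}) i B : i \in J -> measurable B -> <<s cylinders J >> (X i @^-1` B).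
Proof.
move=> iJ mB; apply: sub_sigma_algebra.
exists (fun k => if k == i then B else setT); first by move=> k; case: ifP.
apply/seteqP; split=> [w Bw k _|w /(_ i)]; first by rewrite /preimage/=; case: eqP => // ->.
by rewrite /preimage/= eqxx; apply.
Qed.

Lemma sigma_cylinders_measurable J : <<s cylinders J >> `<=` measurable.
Proof. exact: (smallest_sub (@sigma_algebra_measurable _ T) (@cylinders_measurable J)). Qed.

(** The product rule holds on cylinders by hypothesis, and two finite measures
that agree on a pi-system agree on the sigma-algebra that it generates. *)
Lemma cylinders_indep (J : {set I}) i A B : i \notin J -> <<s cylinders J >> A -> measurable B ->
  P (X i @^-1` B `&` A) = (P (X i @^-1` B) * P A)%E.
Proof.
move=> iJ sA mB.
have mD := measurable_preim i mB.
have p0 : 0 <= fine (P (X i @^-1` B)) by rewrite fine_ge0.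
pose m2 := mscale (NngNum p0) P.
have E : P (X i @^-1` B) = (fine (P (X i @^-1` B)))%:E by rewrite fineK// fin_num_measure.
rewrite setIC E.
suff H : forall C, cylinders J C -> mrestr P mD C = m2 C.
  have g_cover : \bigcup_k (fun _ : nat => @setT T) k = setT by rewrite bigcup_const//; exists 0%N.
  have fin (k : nat) : (mrestr P mD setT < +oo)%E.
    rewrite /mrestr setTI; apply: le_lt_trans (probability_le1 _ mD) _; exact: ltry.
  exact: (@g_sigma_algebra_measure_unique _ R T (cylinders J) (@cylinders_measurable J) (fun=> setT)
    (fun=> cylinders_setT J) g_cover (mrestr P mD) (mscale (NngNum p0) P) (@cylinders_setI J) H fin A sA).
move=> _ [C mC ->]; rewrite /mrestr /m2 /mscale/= -E.
pose C' k := if k == i then B else C k.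
have mC' k : measurable (C' k) by rewrite /C'; case: ifP.
have C'J k : k \in J -> C' k = C k.
  by move=> kJ; rewrite /C' ifN//; apply: contraNneq iJ => <-.
have := indep (i |: J) mC'.
have C'i : C' i = B by rewrite /C' eqxx.
rewrite big_setU1//= C'i.
have -> : (\prod_(k in J) P (X k @^-1` C' k) = P (\bigcap_(k in [set` J]) (X k @^-1` C k)))%E.
  by rewrite indep//; apply: eq_bigr => k kJ; rewrite C'J.
move=> <-; congr (P _); apply/seteqP; split => [w [h1 h2] k|w h].
  rewrite /= in_setU1 => /orP[/eqP ->|kJ]; first by rewrite C'i.
  by rewrite C'J//; exact: h1.
split.
  by move=> k /= kJ; rewrite -C'J//; apply: h; rewrite /= in_setU1 kJ orbT.
by have := h i; rewrite /= setU11 C'i; apply.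
Qed.

End Cylinders.

Section GaussianFamily.
Context {R : realType} d (T : measurableType d) (P : probability T R).
Notation MR := (measurableTypeR R).
Notation C := (MR * MR)%type.
Notation E := (C * C * C)%type.
Notation gam := (@gam R).
Context (I : finType) (Z : I -> T -> R[i]) (v : I -> R).
Hypothesis v0 : forall i, 0 < v i.
Hypothesis gZ : forall i, complex_gaussian P (Z i) (v i).
Hypothesis iZ : mutually_independent P (fun i w => re_im (Z i w)).

Definition zpair i (w : T) : C := (complex.Re (Z i w), complex.Im (Z i w)).

Let mRe i : measurable_fun setT (fun w => complex.Re (Z i w) : MR).
Proof. by case: (gZ i) => -[h _] _ _; exact: h. Qed.
Let mIm i : measurable_fun setT (fun w => complex.Im (Z i w) : MR).
Proof. by case: (gZ i) => _ -[h _] _; exact: h. Qed.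
Lemma measurable_zpair i : measurable_fun setT (zpair i).
Proof. by apply: measurable_fun_pair; [exact: mRe|exact: mIm]. Qed.
Lemma zpair_indep : mutually_independent P zpair.
Proof. exact: iZ. Qed.

Lemma zpair_integral i (f : C -> \bar R) : measurable_fun setT f -> (forall x, 0 <= f x)%E ->
  (\int[P]_w f (zpair i w) = \int[gam]_x \int[gam]_y f ((Num.sqrt (v i) * x)%R, (Num.sqrt (v i) * y)%R))%E.
Proof.
move=> mf f0; case: (gZ i) => -[_ lRe] [_ lIm] iRI.
have ind A B : measurable A -> measurable B ->
  P ((fun w => complex.Re (Z i w) : MR) @^-1` A `&` (fun w => complex.Im (Z i w) : MR) @^-1` B) =
  (P ((fun w => complex.Re (Z i w) : MR) @^-1` A) * P ((fun w => complex.Im (Z i w) : MR) @^-1` B))%E.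
  move=> mA mB; have := iRI (finset.setTfor bool) (fun b : bool => if b then A else B).
  have -> : (\prod_(b in finset.setTfor bool) P ((fun w => if b then complex.Re (Z i w) else complex.Im (Z i w)) @^-1` (if b then A else B)) =
     P ((fun w => complex.Re (Z i w)) @^-1` A) * P ((fun w => complex.Im (Z i w)) @^-1` B))%E.
    rewrite (eq_bigl xpredT); last by move=> b; rewrite finset.inE.
    by rewrite big_bool.
  move=> <-; last by case.
  congr (P _); apply/seteqP; split => [w [h1 h2] []//|w h].
  by split; [have := h true|have := h false]; apply; rewrite /= finset.inE.
have [-> _] := joint_integral (@mRe i) (@mIm i) ind mf f0.
have m1 x : measurable_fun setT (fun y => f (x, y)) by apply: (measurableT_comp mf); exact: measurable_pair1.
under eq_integral => u _.
  rewrite (@integral_law _ _ _ P _ _ _ (@mIm i) (fun y => f (complex.Re (Z i u), y)) (normal_prob 0 (Num.sqrt (v i / 2))) lIm (m1 _))//.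
  rewrite normal_integral//.
  over.
have mg : measurable_fun setT (fun x : MR => \int[gam]_y f (x, (Num.sqrt (v i) * y)%R))%E.
  apply: (measurable_fun_fubini_tonelli_F (m2 := gam) (fun p : MR * MR => f (p.1, (Num.sqrt (v i) * p.2)%R))) => //.
  by apply: (measurableT_comp mf); apply: measurable_fun_pair => //; apply: measurable_funM.
rewrite (@integral_law _ _ _ P _ _ _ (@mRe i) (fun x => \int[gam]_y f (x, (Num.sqrt (v i) * y)%R))%E (normal_prob 0 (Num.sqrt (v i / 2))) lRe mg).
  by apply: (normal_integral (v0 i) mg) => x; apply: integral_ge0.
by move=> x; apply: integral_ge0.
Qed.

Context (vR vI : I -> E).
Let e0 : E := ((0, 0), (0, 0), (0, 0)).
Definition vscale (a : R) (x : E) : E := vadd a x e0.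
(** A real-linear function of the coefficients in l: vR i and vI i are the
images of the real and the imaginary unit of the coefficient i. *)
Definition gsum (l : seq I) (w : T) : E :=
  foldr (fun i acc => vadd (complex.Re (Z i w)) (vR i) (vadd (complex.Im (Z i w)) (vI i) acc)) e0 l.
Definition gweights (l : seq I) : seq E :=
  flatten [seq [:: vscale (Num.sqrt (v i)) (vR i); vscale (Num.sqrt (v i)) (vI i)] | i <- l].

(** The sample space with the sigma-algebra of the coefficients in J; the
identity map into it is a random element that carries these coefficients and
is independent of the others. *)
Definition observed (J : {set I}) := g_sigma_algebraType (cylinders zpair J).

Lemma measurable_observed J : measurable_fun setT (id : T -> observed J).
Proof.
move=> _ A mA; rewrite setTI; apply: sigma_cylinders_measurable mA; exact: measurable_zpair.
Qed.

Lemma observed_zpair (J : {set I}) i : i \in J -> measurable_fun setT (zpair i : observed J -> C).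
Proof.
by move=> iJ _ A mA; rewrite setTI; exact: cylinders_preim.
Qed.

Lemma measurable_gsum (J : {set I}) l : {subset l <= J} -> measurable_fun setT (gsum l : observed J -> E).
Proof.
elim: l => [|i l IH] lJ; first exact: measurable_cst.
have mi := observed_zpair (lJ i (mem_head _ _)).
rewrite /=; apply: measurable_vadd; first exact: (measurableT_comp measurable_fst mi).
apply: measurable_vadd; first exact: (measurableT_comp measurable_snd mi).
by apply: IH => k kl; apply: lJ; rewrite inE kl orbT.
Qed.

Lemma observed_integral (J : {set I}) i (f : C * observed J -> \bar R) : i \notin J ->
  measurable_fun setT f -> (forall x, 0 <= f x)%E ->
  (\int[P]_w f (zpair i w, w) = \int[P]_u \int[P]_w f (zpair i u, w))%E /\
  (\int[P]_w f (zpair i w, w) = \int[P]_w \int[P]_u f (zpair i u, w))%E.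
Proof.
move=> iJ mf f0.
apply: (@joint_integral _ _ _ P _ _ _ _ (zpair i) (id : T -> observed J)) => //.
- exact: measurable_zpair.
- exact: measurable_observed.
- move=> A B mA mB; exact: (cylinders_indep measurable_zpair zpair_indep iJ mB mA).
Qed.

(** Integrate the coefficients out one at a time, each being independent of
those that remain. *)
Lemma gsum_integral l (f : E -> \bar R) : uniq l -> measurable_fun setT f -> (forall x, 0 <= f x)%E ->
  (\int[P]_w f (gsum l w) = Egauss (gweights l) f)%E.
Proof.
elim: l f => [|i l IH] f /=.
  by move=> _ mf f0; rewrite integral_cst// [X in (_ * X)%E]probability_setT mule1.
move=> /andP[il ul] mf f0.
pose J : {set I} := [set k in l].
have iJ : i \notin J by rewrite inE.
pose F (p : C * observed J) := f (vadd p.1.1 (vR i) (vadd p.1.2 (vI i) (gsum l p.2))).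
have mF : measurable_fun setT F.
  apply: (measurableT_comp mf); apply: measurable_vadd; first exact: (measurableT_comp measurable_fst).
  apply: measurable_vadd; first exact: (measurableT_comp measurable_snd).
  apply: (measurableT_comp (@measurable_gsum J l _)) => //; by move=> k kl; rewrite inE.
have F0 x : (0 <= F x)%E by exact: f0.
have [H _] := observed_integral iJ mF F0.
rewrite [LHS]H; rewrite /F/=.
have mv1 a b : measurable_fun setT (fun x : E => f (vadd a (vR i) (vadd b (vI i) x))).
  by apply: (measurableT_comp mf); apply: measurable_vadd => //; apply: measurable_vadd.
under eq_integral => u _ do rewrite (IH (fun e => f (vadd (complex.Re (Z i u)) (vR i) (vadd (complex.Im (Z i u)) (vI i) e))))//.
have mH : measurable_fun setT (fun x : C => Egauss (gweights l) (fun w => f (vadd x.1 (vR i) (vadd x.2 (vI i) w)))).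
  apply: (@measurable_Egauss _ _ _ _ (fun p : C * E => f (vadd p.1.1 (vR i) (vadd p.1.2 (vI i) p.2)))) => //.
  apply: (measurableT_comp mf); apply: measurable_vadd; first exact: (measurableT_comp measurable_fst).
  by apply: measurable_vadd => //; exact: (measurableT_comp measurable_snd).
rewrite (@zpair_integral i (fun x : C => Egauss (gweights l) (fun w => f (vadd x.1 (vR i) (vadd x.2 (vI i) w)))) mH); last first.
  by move=> x; exact: Egauss_ge0.
apply: eq_integral => x _; apply: eq_integral => y _.
congr (Egauss _ _); apply/funext => w; congr f.
rewrite /vscale /vadd/= /e0; congr (_, _, _); congr (_, _); ring.
Qed.

End GaussianFamily.

(** * Harmonic polynomials as maps of the plane *)

Section PolyPlane.
Context {R : realType}.
Notation MR := (measurableTypeR R).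
Notation mu2 := (@plane R).
Implicit Types p q : {poly R[i]}.

Definition cpx (z : R * R) : R[i] := Complex z.1 z.2.
Definition hre p (z : R * R) : R := complex.Re p.[cpx z].
Definition him p (z : R * R) : R := complex.Im p.[cpx z].

Lemma hre_MXaddC p c z : hre (p * 'X + c%:P) z = hre p z * z.1 - him p z * z.2 + complex.Re c.
Proof. by rewrite /hre /him hornerMXaddC; case: (p.[_]) => x y; case: c. Qed.
Lemma him_MXaddC p c z : him (p * 'X + c%:P) z = hre p z * z.2 + him p z * z.1 + complex.Im c.
Proof. by rewrite /hre /him hornerMXaddC; case: (p.[_]) => x y; case: c. Qed.
Lemma hre_deriv p c z : hre (p * 'X + c%:P)^`() z = hre p z + (hre p^`() z * z.1 - him p^`() z * z.2).
Proof.
rewrite /hre /him derivMXaddC hornerD hornerM hornerX.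
by case: (p.[_]) => x y; case: (p^`().[_]).
Qed.
Lemma him_deriv p c z : him (p * 'X + c%:P)^`() z = him p z + (hre p^`() z * z.2 + him p^`() z * z.1).
Proof.
rewrite /hre /him derivMXaddC hornerD hornerM hornerX.
by case: (p.[_]) => x y; case: (p^`().[_]).
Qed.

Lemma continuous_horner p : continuous (hre p) /\ continuous (him p).
Proof.
elim/poly_ind: p => [|p c [IH1 IH2]].
  by rewrite /hre /him; under eq_fun do rewrite horner0; under [X in _ /\ continuous X]eq_fun do rewrite horner0;
    split => z; exact: cvg_cst.
split=> z.
  rewrite (_ : hre _ = fun z => hre p z * z.1 - him p z * z.2 + complex.Re c); last first.
    by apply/funext => w; exact: hre_MXaddC.
  by apply: cvgD; [apply: cvgB; apply: cvgM; [exact: IH1|exact: cvg_fst|exact: IH2|exact: cvg_snd]|exact: cvg_cst].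
rewrite (_ : him _ = fun z => hre p z * z.2 + him p z * z.1 + complex.Im c); last first.
  by apply/funext => w; exact: him_MXaddC.
by apply: cvgD; [apply: cvgD; apply: cvgM; [exact: IH1|exact: cvg_snd|exact: IH2|exact: cvg_fst]|exact: cvg_cst].
Qed.

Lemma measurable_horner p : measurable_fun setT (hre p : MR * MR -> MR) /\ measurable_fun setT (him p : MR * MR -> MR).
Proof.
elim/poly_ind: p => [|p c [IH1 IH2]].
  rewrite (_ : hre 0 = cst 0); last by apply/funext => z; rewrite /hre horner0.
  rewrite (_ : him 0 = cst 0); last by apply/funext => z; rewrite /him horner0.
  by split; exact: measurable_cst.
rewrite (_ : hre (p * 'X + c%:P) = fun z => hre p z * z.1 - him p z * z.2 + complex.Re c); last first.
  by apply/funext => w; exact: hre_MXaddC.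
rewrite (_ : him (p * 'X + c%:P) = fun z => hre p z * z.2 + him p z * z.1 + complex.Im c); last first.
  by apply/funext => w; exact: him_MXaddC.
split; apply: measurable_funD => //.
  by apply: measurable_funB; exact: measurable_funM.
by apply: measurable_funD; exact: measurable_funM.
Qed.

Let padd (z h : R * R) : R * R := (z.1 + h.1, z.2 + h.2).

(** By induction on p: the remainder of p X + c is that of p, multiplied by z
+ h, plus the product of h with the differential of p at h. *)
Lemma horner_quadratic p M : 0 <= M -> exists2 C, 0 <= C & forall z h, maxnorm z <= M -> maxnorm h <= 1 ->
  `|hre p (padd z h) - hre p z - (hre p^`() z * h.1 - him p^`() z * h.2)| <= C * maxnorm h ^+ 2 /\
  `|him p (padd z h) - him p z - (hre p^`() z * h.2 + him p^`() z * h.1)| <= C * maxnorm h ^+ 2.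
Proof.
move=> M0; elim/poly_ind: p => [|p c [C C0 IH]].
  exists 0 => // z h _ _.
  have h0 w : hre 0 w = 0 by rewrite /hre horner0.
  have k0 w : him 0 w = 0 by rewrite /him horner0.
  by rewrite deriv0 !h0 !k0 !mul0r ?addr0 !subrr normr0.
have [c1 c2] := continuous_horner p^`().
have [B1 hB1] := continuous_bound c1 M0; have [B2 hB2] := continuous_bound c2 M0.
have z00 : maxnorm (0 : R, 0 : R) <= M by rewrite /maxnorm/= normr0 maxxx.
have B10 := le_trans (normr_ge0 _) (hB1 _ z00); have B20 := le_trans (normr_ge0 _) (hB2 _ z00).
exists (2 * (C * (M + 1)) + 2 * (B1 + B2)).
  by rewrite addr_ge0 ?mulr_ge0 ?addr_ge0.
move=> z h hz hh; have [] := IH z h hz hh; rewrite !hre_MXaddC !him_MXaddC !hre_deriv !him_deriv.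
have := hB1 z hz; have := hB2 z hz.
set al := hre p^`() z; set be := him p^`() z; set A := hre p z; set B := him p z.
set A' := hre p (padd z h); set B' := him p (padd z h); set N := maxnorm h.
move=> hbe hal.
set eA := A' - A - _ => heA; set eB := B' - B - _ => heB.
have Eq3 (x1 x2 x3 x4 : R) : `|x1 + x2 + x3 + x4| <= `|x1| + `|x2| + `|x3| + `|x4|.
  by apply: le_trans (ler_normD _ _) _; rewrite lerD2r; apply: le_trans (ler_normD _ _) _; rewrite lerD2r ler_normD.
have zh1 : `|z.1 + h.1| <= M + 1.
  by apply: le_trans (ler_normD _ _) _; apply: lerD; [apply: le_trans hz; exact: maxnorm1|apply: le_trans hh; exact: maxnorm1].
have zh2 : `|z.2 + h.2| <= M + 1.
  by apply: le_trans (ler_normD _ _) _; apply: lerD; [apply: le_trans hz; exact: maxnorm2|apply: le_trans hh; exact: maxnorm2].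
have bE e x : `|e| <= C * N ^+ 2 -> `|x| <= M + 1 -> `|e * x| <= C * (M + 1) * N ^+ 2.
  by move=> he hx; rewrite normrM mulrAC ler_pM.
have lin x y : `|x| <= N -> `|y| <= N -> forall u v, `|u| <= B1 -> `|v| <= B2 -> `|(u * x + v * y)| <= (B1 + B2) * N.
  move=> hx hy u v hu hv; apply: le_trans (ler_normD _ _) _; rewrite mulrDl !normrM.
  by apply: lerD; rewrite ler_pM.
have h1 := maxnorm1 h; have h2 := maxnorm2 h.
have bL x y : `|x| <= (B1 + B2) * N -> `|y| <= N -> `|x * y| <= (B1 + B2) * N ^+ 2.
  by move=> hx hy; rewrite normrM expr2 mulrA ler_pM.
have l1 : `|al * h.1 - be * h.2| <= (B1 + B2) * N by rewrite -mulNr; apply: lin => //; rewrite normrN.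
have l2 : `|al * h.2 + be * h.1| <= (B1 + B2) * N by exact: lin.
have fin (x1 x2 x3 x4 : R) : `|x1| <= C * (M + 1) * N ^+ 2 -> `|x2| <= C * (M + 1) * N ^+ 2 ->
   `|x3| <= (B1 + B2) * N ^+ 2 -> `|x4| <= (B1 + B2) * N ^+ 2 ->
   `|x1 + x2 + x3 + x4| <= (2 * (C * (M + 1)) + 2 * (B1 + B2)) * N ^+ 2.
  move=> e1 e2 e3 e4; apply: le_trans (Eq3 _ _ _ _) _.
  rewrite (_ : _ * N ^+ 2 = C * (M + 1) * N ^+ 2 + C * (M + 1) * N ^+ 2 + (B1 + B2) * N ^+ 2 + (B1 + B2) * N ^+ 2).
    by rewrite !lerD.
  by ring.
rewrite /padd/=; split.
  rewrite (_ : _ - _ = eA * (z.1 + h.1) + - eB * (z.2 + h.2) + (al * h.1 - be * h.2) * h.1 + (al * h.2 + be * h.1) * (- h.2)).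
    by apply: fin; [exact: bE|apply: bE => //; rewrite normrN|exact: bL|apply: bL => //; rewrite normrN].
  by rewrite /eA /eB; ring.
rewrite (_ : _ - _ = eA * (z.2 + h.2) + eB * (z.1 + h.1) + (al * h.1 - be * h.2) * h.2 + (al * h.2 + be * h.1) * h.1).
  by apply: fin; [exact: bE|exact: bE|exact: bL|exact: bL].
by rewrite /eA /eB; ring.
Qed.

Lemma jacobian_harmonicD p q c z :
  jacobian_det (harmonic_fun (p + c%:P) q) z = jacobian_det (harmonic_fun p q) z.
Proof.
have h1 := jacobian_det_harmonic (p + c%:P) q z; have h2 := jacobian_det_harmonic p q z.
have h : (p + c%:P)^`() = p^`() by rewrite derivD derivC addr0.
by apply: (@complexI R); apply: (etrans h1); apply: (etrans _ (esym h2)); rewrite h.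
Qed.

Section Harmonic.
Variables p q : {poly R[i]}.
Let mreal := measurable_horner.
Definition hg1 (z : R * R) := hre p z + hre q z.
Definition hg2 (z : R * R) := him p z - him q z.
(** The partial derivatives of p + conj q, by the Cauchy-Riemann equations. *)
Definition hla (z : R * R) := hre p^`() z + hre q^`() z.
Definition hlb (z : R * R) := - (him p^`() z + him q^`() z).
Definition hlc (z : R * R) := him p^`() z - him q^`() z.
Definition hld (z : R * R) := hre p^`() z - hre q^`() z.
Definition hJ (z : R * R) := hla z * hld z - hlb z * hlc z.

Lemma hJE z : hJ z = (hre p^`() z ^+ 2 + him p^`() z ^+ 2) - (hre q^`() z ^+ 2 + him q^`() z ^+ 2).
Proof. by rewrite /hJ /hla /hld /hlb /hlc; ring. Qed.

Lemma jacobian_hJ z : jacobian_det (harmonic_fun p q) (cpx z) = hJ z.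
Proof.
apply: (@complexI R); rewrite jacobian_det_harmonic hJE !sqr_normc /hre /him.
case: (p^`().[_]) => x y; case: (q^`().[_]) => x' y' /=.
by apply/eqP; rewrite eq_complex /=; apply/andP; split; apply/eqP; ring.
Qed.

Lemma harmonic_quad M : 0 <= M -> exists C, forall z h, maxnorm z <= M -> maxnorm h <= 1 ->
  `|hg1 (z.1 + h.1, z.2 + h.2) - hg1 z - (hla z * h.1 + hlb z * h.2)| <= C * maxnorm h ^+ 2 /\
  `|hg2 (z.1 + h.1, z.2 + h.2) - hg2 z - (hlc z * h.1 + hld z * h.2)| <= C * maxnorm h ^+ 2.
Proof.
move=> M0; have [C1 C10 H1] := horner_quadratic p M0; have [C2 C20 H2] := horner_quadratic q M0.
exists (C1 + C2) => z h hz hh; have [a1 b1] := H1 z h hz hh; have [a2 b2] := H2 z h hz hh.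
move: a1 b1 a2 b2; rewrite /padd /hg1 /hg2 /hla /hlb /hlc /hld.
set zh := (_, _); set x1 := (X in `|X| <= _ -> _) => a1; set x2 := (X in `|X| <= _ -> _) => b1.
set y1 := (X in `|X| <= _ -> _) => a2; set y2 := (X in `|X| <= _ -> _) => b2.
split.
  rewrite (_ : _ - _ = x1 + y1); last by rewrite /x1 /y1; ring.
  by apply: le_trans (ler_normD _ _) _; rewrite [leRHS]mulrDl; exact: lerD.
rewrite (_ : _ - _ = x2 - y2); last by rewrite /x2 /y2; ring.
by apply: le_trans (ler_normB _ _) _; rewrite [leRHS]mulrDl; exact: lerD.
Qed.

Lemma fiber_count_harmonic (s : R) (c : R * R) :
  fiber_count hg1 hg2 hla hlb hlc hld s c =
  counting [set z : R[i] | p.[z] + (q.[z])^* + cpx c = 0 /\ 0 < s * jacobian_det (harmonic_fun p q) z].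
Proof.
rewrite /fiber_count !counting_esum.
set A := [set z | _]; set B := [set z | _].
have -> : B = cpx @` A.
  have key z : (p.[cpx z] + (q.[cpx z])^* + cpx c = 0) <-> (hg1 z = - c.1 /\ hg2 z = - c.2).
    rewrite /hg1 /hg2 /hre /him /cpx; case: (p.[_]) => a b; case: (q.[_]) => e f /=.
    split=> [/eqP|[h1 h2]].
      by rewrite eq_complex/= !addr_eq0 => /andP[/eqP -> /eqP ->].
    by apply/eqP; rewrite eq_complex/= h1 h2 !addNr eqxx.
  apply/seteqP; split.
    move=> [x y] [h1 h2]; exists (x, y) => //; split; first exact/key.
    by rewrite -/(hJ (x, y)) -jacobian_hJ.
  move=> _ [z [/key h1 h2] <-]; split => //.
  by rewrite jacobian_hJ.
rewrite esum_image//.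
by move=> [x y] [x' y'] _ _ [-> ->].
Qed.

Let cre r := (continuous_horner r).1.
Let cim r := (continuous_horner r).2.
Let chg1 : continuous hg1. Proof. by move=> z; apply: cvgD; exact: cre. Qed.
Let chg2 : continuous hg2. Proof. by move=> z; apply: cvgB; exact: cim. Qed.
Let chla : continuous hla. Proof. by move=> z; apply: cvgD; exact: cre. Qed.
Let chlb : continuous hlb. Proof. by move=> z; apply: cvgN; apply: cvgD; exact: cim. Qed.
Let chlc : continuous hlc. Proof. by move=> z; apply: cvgB; exact: cim. Qed.
Let chld : continuous hld. Proof. by move=> z; apply: cvgB; exact: cre. Qed.
Let mhg1 : measurable_fun setT (hg1 : MR * MR -> MR).
Proof. by apply: measurable_funD; exact: (mreal _).1. Qed.
Let mhg2 : measurable_fun setT (hg2 : MR * MR -> MR).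
Proof. by apply: measurable_funB; exact: (mreal _).2. Qed.
Lemma measurable_hJ : measurable_fun setT (hJ : MR * MR -> MR).
Proof.
rewrite (_ : hJ = fun z => (hre p^`() z ^+ 2 + him p^`() z ^+ 2) - (hre q^`() z ^+ 2 + him q^`() z ^+ 2)).
  by apply: measurable_funB; apply: measurable_funD; apply: measurable_funX;
   first [exact: (mreal _).1|exact: (mreal _).2].
by apply/funext => z; exact: hJE.
Qed.

Lemma harmonic_sign_weight_cvg (s : R) j c : s ^+ 2 = 1 ->
  smoothed hg1 hg2 hJ (sign_weight hla hlb hlc hld s j) n c @[n --> \oo] -->
  (\esum_(z in [set z | (hg1 z = - c.1)%R /\ (hg2 z = - c.2)%R]) (sign_weight hla hlb hlc hld s j z)%:E)%E.
Proof. move=> s2. exact: (area_sign_weight s2 mhg1 mhg2 measurable_hJ chg1 chg2 chla chlb chlc chld harmonic_quad j).1. Qed.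

Lemma harmonic_fiber_cvg (s : R) c : s ^+ 2 = 1 ->
  (\esum_(z in [set z | (hg1 z = - c.1)%R /\ (hg2 z = - c.2)%R]) (sign_weight hla hlb hlc hld s j z)%:E)%E @[j --> \oo] -->
  fiber_count hg1 hg2 hla hlb hlc hld s c.
Proof. move=> s2. exact: fiber_count_cvg. Qed.

Lemma harmonic_area (s : R) (phi : R * R -> R) (Bp : R) : s ^+ 2 = 1 ->
  measurable_fun setT (phi : MR * MR -> MR) -> continuous phi ->
  (forall c, 0 <= phi c) -> (forall c, phi c <= Bp) -> (\int[mu2]_c (phi c)%:E < +oo)%E ->
  (\int[mu2]_c (fiber_count hg1 hg2 hla hlb hlc hld s c * (phi c)%:E) =
   \int[mu2]_z (Num.max 0 (s * hJ z) * phi (- hg1 z, - hg2 z))%:E)%E.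
Proof.
move=> s2 mphi cphi phi0 phiB iphi.
exact: (area_formula s2 mhg1 mhg2 measurable_hJ chg1 chg2 chla chlb chlc chld harmonic_quad mphi cphi phi0 phiB iphi).
Qed.

End Harmonic.
End PolyPlane.

(** * Measurability of random polynomials *)

Section RandomPoly.
Context {R : realType}.
Notation MR := (measurableTypeR R).
Notation C := (MR * MR)%type.
Notation mu2 := (@plane R).

Section ComplexMeasurable.
Context d (D : measurableType d).

Definition cmeasurable (f : D -> R[i]) : Prop :=
  measurable_fun setT (fun x => complex.Re (f x) : MR) /\ measurable_fun setT (fun x => complex.Im (f x) : MR).

Lemma cmeasurable_cst c : cmeasurable (fun=> c).
Proof. by split; exact: measurable_cst. Qed.
Lemma cmeasurableD f g : cmeasurable f -> cmeasurable g -> cmeasurable (fun x => f x + g x).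
Proof.
move=> [f1 f2] [g1 g2]; split.
  rewrite (_ : (fun x => _) = fun x => complex.Re (f x) + complex.Re (g x)); first exact: measurable_funD.
  by apply/funext => x; case: (f x) => ? ?; case: (g x).
rewrite (_ : (fun x => _) = fun x => complex.Im (f x) + complex.Im (g x)); first exact: measurable_funD.
by apply/funext => x; case: (f x) => ? ?; case: (g x).
Qed.
Lemma cmeasurableM f g : cmeasurable f -> cmeasurable g -> cmeasurable (fun x => f x * g x).
Proof.
move=> [f1 f2] [g1 g2]; split.
  rewrite (_ : (fun x => _) = fun x => complex.Re (f x) * complex.Re (g x) - complex.Im (f x) * complex.Im (g x)).
    by apply: measurable_funB; exact: measurable_funM.
  by apply/funext => x; case: (f x) => ? ?; case: (g x).
rewrite (_ : (fun x => _) = fun x => complex.Re (f x) * complex.Im (g x) + complex.Im (f x) * complex.Re (g x)).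
  by apply: measurable_funD; exact: measurable_funM.
by apply/funext => x; case: (f x) => ? ?; case: (g x).
Qed.
Lemma cmeasurableX f k : cmeasurable f -> cmeasurable (fun x => f x ^+ k).
Proof.
move=> mf; elim: k => [|k IH]; first by under eq_fun do rewrite expr0; exact: cmeasurable_cst.
by under eq_fun do rewrite exprS; exact: cmeasurableM.
Qed.
Lemma cmeasurable_sum N (f : nat -> D -> R[i]) : (forall k, (k < N)%N -> cmeasurable (f k)) -> cmeasurable (fun x => \sum_(k < N) f k x).
Proof.
elim: N => [|N IH] H; first by under eq_fun do rewrite big_ord0; exact: cmeasurable_cst.
under eq_fun do rewrite big_ord_recr/=.
by apply: cmeasurableD; [apply: IH => k kN; apply: H; rewrite ltnS ltnW|exact: H].
Qed.

Lemma horner_deriv_poly N (E : nat -> R[i]) z :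
  (\poly_(k < N) E k)^`().[z] = \sum_(k < N) E k * (z ^+ k.-1 *+ k).
Proof.
rewrite poly_def raddf_sum horner_sum; apply: eq_bigr => k _.
by rewrite /= derivZ derivXn hornerZ hornerMn hornerXn.
Qed.

Lemma measurable_poly N (c : nat -> D -> R[i]) (zeta : D -> C) : (forall k, (k < N)%N -> cmeasurable (c k)) ->
  measurable_fun setT zeta ->
  [/\ measurable_fun setT (fun x => hre (\poly_(k < N) c k x) (zeta x) : MR),
      measurable_fun setT (fun x => him (\poly_(k < N) c k x) (zeta x) : MR),
      measurable_fun setT (fun x => hre (\poly_(k < N) c k x)^`() (zeta x) : MR) &
      measurable_fun setT (fun x => him (\poly_(k < N) c k x)^`() (zeta x) : MR)].
Proof.
move=> mc mz.
have cz : cmeasurable (fun x => cpx (zeta x)).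
  by split; [exact: (measurableT_comp measurable_fst mz)|exact: (measurableT_comp measurable_snd mz)].
have [h1 h2] : cmeasurable (fun x => (\poly_(k < N) c k x).[cpx (zeta x)]).
  under eq_fun do rewrite horner_poly.
  by apply: (@cmeasurable_sum N (fun k x => c k x * cpx (zeta x) ^+ k)) => k kN; apply: cmeasurableM; [exact: mc|exact: cmeasurableX].
have [h3 h4] : cmeasurable (fun x => (\poly_(k < N) c k x)^`().[cpx (zeta x)]).
  under eq_fun do rewrite horner_deriv_poly.
  apply: (@cmeasurable_sum N (fun k x => c k x * (cpx (zeta x) ^+ k.-1 *+ k))) => k kN; apply: cmeasurableM; first exact: mc.
  under eq_fun do rewrite -mulr_natl.
  by apply: cmeasurableM; [exact: cmeasurable_cst|exact: cmeasurableX].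
by split.
Qed.

End ComplexMeasurable.

Definition gauss_pdf (c : R * R) : R := expR (- (c.1 ^+ 2 + c.2 ^+ 2)) / pi.
Lemma gauss_pdf_ge0 c : 0 <= gauss_pdf c. Proof. by rewrite divr_ge0 ?expR_ge0 ?pi_ge0. Qed.
Lemma gauss_pdf_le c : gauss_pdf c <= pi^-1.
Proof.
rewrite /gauss_pdf -[leRHS]mul1r ler_wpM2r ?invr_ge0 ?pi_ge0//.
by rewrite -expR0 ler_expR oppr_le0 addr_ge0 ?sqr_ge0.
Qed.
Lemma continuous_gauss_pdf : continuous gauss_pdf.
Proof.
move=> z; apply: cvgM; last exact: cvg_cst.
apply: (@continuous_comp _ _ _ (fun c : R * R => - (c.1 ^+ 2 + c.2 ^+ 2)) expR); last exact: continuous_expR.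
by apply: cvgN; apply: cvgD; apply: cvgM; first [exact: cvg_fst|exact: cvg_snd].
Qed.
Lemma measurable_gauss_pdf : measurable_fun setT (gauss_pdf : C -> MR).
Proof. exact: measurable_gauss2. Qed.
Lemma gam_integral_plane (f : C -> \bar R) : measurable_fun setT f -> (forall x, 0 <= f x)%E ->
  (\int[gam]_x \int[gam]_y f (x, y) = \int[mu2]_c (f c * (gauss_pdf c)%:E))%E.
Proof.
move=> mf f0; rewrite gam_integral2// int2E//.
- by apply: emeasurable_funM => //; apply/measurable_EFinP; exact: measurable_gauss_pdf.
- by move=> x; rewrite mule_ge0// lee_fin gauss_pdf_ge0.
Qed.
Lemma gauss_pdf_fin : (\int[mu2]_c (gauss_pdf c)%:E < +oo)%E.
Proof.
have := @gam_integral_plane (fun=> 1%E) (measurable_cst _) (fun=> lee01).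
under [X in _ = X -> _]eq_integral do rewrite mul1e.
have I1 : (\int[@gam R]__ 1 = 1 :> \bar R)%E.
  by rewrite integral_cst// mul1e; exact: probability_setT.
move=> H; rewrite -[ltLHS]H; under eq_integral do rewrite I1.
by rewrite I1 ltry.
Qed.

End RandomPoly.

(** * The Kac-Rice identity *)

Section Model.
Context {R : realType} d (T : measurableType d) (P : probability T R).
Notation MR := (measurableTypeR R).
Notation C := (MR * MR)%type.
Notation E := (C * C * C)%type.
Notation mu2 := (@plane R).
Context (n m : nat) (a b : nat -> T -> R[i]).
Hypothesis model : truncated_model P n m a b.

Definition coef (i : 'I_n.+1 + 'I_m.+1) : T -> R[i] :=
  match i with inl k => a k | inr k => b k end.
Definition variance_of (i : 'I_n.+1 + 'I_m.+1) : R :=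
  match i with inl k => 'C(n, k)%:R | inr k => 'C(n, k)%:R end.
Notation I := ('I_n.+1 + 'I_m.+1)%type.

Let mn : (m <= n)%N. Proof. by case/andP: (truncated_degrees model). Qed.

Lemma variance_gt0 i : 0 < variance_of i.
Proof.
case: i => k; rewrite /= ltr0n bin_gt0 -ltnS//.
by apply: leq_trans (ltn_ord k) _; rewrite ltnS.
Qed.
Lemma coef_gaussian i : complex_gaussian P (coef i) (variance_of i).
Proof.
by case: i => k; [apply: (truncated_gaussian_a model)|apply: (truncated_gaussian_b model)]; rewrite -ltnS.
Qed.
Lemma coef_indep : mutually_independent P (fun i w => re_im (coef i w)).
Proof.
have := truncated_independent model; congr mutually_independent.
by apply/funext => i; apply/funext => w; case: i.
Qed.

(** The coefficient that plays the part of the right-hand side c in the area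
formula. *)
Definition i0 : I := inl ord0.
Definition others : seq I := [seq i <- index_enum I | i != i0].
Definition otherset : {set I} := [set k in others].
Lemma i0_others : i0 \notin otherset.
Proof. by rewrite inE mem_filter eqxx. Qed.
Lemma uniq_others : uniq others.
Proof. by rewrite filter_uniq// index_enum_uniq. Qed.
Lemma in_otherset i : i != i0 -> i \in otherset.
Proof. by move=> h; rewrite inE mem_filter h mem_index_enum. Qed.

Notation O := (observed coef otherset).

Definition atail (k : nat) (w : T) : R[i] := if k == 0%N then 0 else a k w.
Definition pw (w : T) : {poly R[i]} := \poly_(k < n.+1) atail k w.
Definition qw (w : T) : {poly R[i]} := \poly_(k < m.+1) b k w.

Lemma cmeasurable_zpair (J : {set I}) i : i \in J -> cmeasurable (coef i : observed coef J -> R[i]).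
Proof.
move=> iJ; have H : measurable_fun setT (zpair coef i : observed coef J -> C) by exact: observed_zpair.
by split; [exact: (measurableT_comp measurable_fst H)|exact: (measurableT_comp measurable_snd H)].
Qed.

Lemma cmeasurable_atail k : (k < n.+1)%N -> cmeasurable (atail k : O -> R[i]).
Proof.
move=> kn; rewrite /atail; case: k kn => [|k] kn; first exact: cmeasurable_cst.
exact: (@cmeasurable_zpair otherset (inl (Ordinal kn)) (in_otherset _)).
Qed.
Lemma cmeasurable_b k : (k < m.+1)%N -> cmeasurable (b k : O -> R[i]).
Proof.
by move=> km; exact: (@cmeasurable_zpair otherset (inr (Ordinal km)) (in_otherset _)).
Qed.

Lemma cmeasurable_comp d1 d2 (D1 : measurableType d1) (D2 : measurableType d2) (f : D2 -> R[i]) (g : D1 -> D2) :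
  cmeasurable f -> measurable_fun setT g -> cmeasurable (fun x => f (g x)).
Proof. by move=> [f1 f2] mg; split; [exact: (measurableT_comp f1)|exact: (measurableT_comp f2)]. Qed.

Notation G1 w := (hg1 (pw w) (qw w)).
Notation G2 w := (hg2 (pw w) (qw w)).
Notation JW w := (hJ (pw w) (qw w)).

Lemma measurable_field d1 (D : measurableType d1) (om : D -> O) (zeta : D -> C) :
  measurable_fun setT om -> measurable_fun setT zeta ->
  [/\ measurable_fun setT (fun x => G1 (om x) (zeta x) : MR),
      measurable_fun setT (fun x => G2 (om x) (zeta x) : MR) &
      measurable_fun setT (fun x => JW (om x) (zeta x) : MR)].
Proof.
move=> mo mz.
have [p1 p2 p3 p4] := @measurable_poly R _ D n.+1 (fun k x => atail k (om x)) zeta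
  (fun k kn => cmeasurable_comp (cmeasurable_atail kn) mo) mz.
have [q1 q2 q3 q4] := @measurable_poly R _ D m.+1 (fun k x => b k (om x)) zeta
  (fun k kn => cmeasurable_comp (cmeasurable_b kn) mo) mz.
split; [exact: measurable_funD|exact: measurable_funB|].
rewrite (_ : (fun x => _) = fun x => (hre (pw (om x))^`() (zeta x) ^+ 2 + him (pw (om x))^`() (zeta x) ^+ 2)
  - (hre (qw (om x))^`() (zeta x) ^+ 2 + him (qw (om x))^`() (zeta x) ^+ 2)).
  by apply: measurable_funB; apply: measurable_funD; exact: measurable_funX.
by apply/funext => x; exact: hJE.
Qed.

Variable s : R.
Hypothesis s2 : s ^+ 2 = 1.

(** The zeros are counted as a function of the constant term and of a sample
in which it is not observed. *)
Definition zero_count (p : C * O) : \bar R :=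
  fiber_count (G1 p.2) (G2 p.2) (hla (pw p.2) (qw p.2)) (hlb (pw p.2) (qw p.2)) (hlc (pw p.2) (qw p.2)) (hld (pw p.2) (qw p.2)) s p.1.

Lemma zero_count_ge0 p : (0 <= zero_count p)%E.
Proof. by rewrite /zero_count /fiber_count counting_esum esum_ge0. Qed.

(** The count is a double limit of integrals that depend measurably on the
parameters: the width of the kernel tends to 0, then the weights increase to
the indicator. *)
Lemma measurable_zero_count : measurable_fun setT zero_count.
Proof.
pose ps j (p : C * O) := sign_weight (hla (pw p.2) (qw p.2)) (hlb (pw p.2) (qw p.2)) (hlc (pw p.2) (qw p.2)) (hld (pw p.2) (qw p.2)) s j.
pose Z (p : C * O) := [set z : R * R | (G1 p.2 z = - p.1.1)%R /\ (G2 p.2 z = - p.1.2)%R].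
apply: (emeasurable_fun_cvg (fun j (p : C * O) => (\esum_(z in Z p) (ps j p z)%:E)%E)) => [j|p _]; last first.
  exact: harmonic_fiber_cvg.
apply: (emeasurable_fun_cvg (fun k (p : C * O) => smoothed (G1 p.2) (G2 p.2) (JW p.2) (ps j p) k p.1)) => [k|p _]; last first.
  exact: harmonic_sign_weight_cvg.
pose F (x : (C * O) * C) := (k.+1%:R^-1 ^- 2 * (ps j x.1 x.2 * `|JW x.1.2 x.2| *
   kern ((G1 x.1.2 x.2 + x.1.1.1) / k.+1%:R^-1, (G2 x.1.2 x.2 + x.1.1.2) / k.+1%:R^-1)))%:E.
have mO : measurable_fun setT (fun x : (C * O) * C => x.1.2) by exact: (measurableT_comp measurable_snd measurable_fst).
have mC : measurable_fun setT (fun x : (C * O) * C => x.1.1) by exact: (measurableT_comp measurable_fst measurable_fst).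
have mz : measurable_fun setT (fun x : (C * O) * C => x.2) by exact: measurable_snd.
have [m1 m2 mJ] := measurable_field mO mz.
have mz1 := measurableT_comp measurable_fst mz.
have mz2 := measurableT_comp measurable_snd mz.
have mF : measurable_fun setT F.
  apply/measurable_EFinP; apply: measurable_funM => //; apply: measurable_funM.
    apply: measurable_funM; last exact: (measurableT_comp (@normr_measurable R setT) mJ).
    apply: measurable_funM.
      apply: (measurableT_comp measurable_ramp); apply: measurable_funB => //.
      by apply: measurable_funM => //; exact: measurable_funM.
    by apply: measurable_funM; apply: (measurableT_comp measurable_ramp); apply: measurable_funB => //;
      exact: (measurableT_comp (@normr_measurable R setT)).
  apply: (measurableT_comp measurable_kern); apply: measurable_fun_pair; apply: measurable_funM => //;
    apply: measurable_funD => //.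
    exact: (measurableT_comp measurable_fst mC).
  exact: (measurableT_comp measurable_snd mC).
apply: (measurable_fun_fubini_tonelli_F (m2 := mu2) F mF) => x.
rewrite lee_fin; apply: mulr_ge0; first by rewrite invr_ge0 sqr_ge0.
by apply: mulr_ge0; [apply: mulr_ge0 => //; exact: sign_weight_ge0|exact: kern_ge0].
Qed.

Lemma zero_countE w : counting [set z | random_harmonic n m a b w z = 0 /\ 0 < s * jacobian_det (random_harmonic n m a b w) z]
  = zero_count (zpair coef i0 w, w).
Proof.
apply: (eq_trans _ (esym (fiber_count_harmonic (pw w) (qw w) s (zpair coef i0 w)))).
apply: (congr1 counting).
pose p := \poly_(k < n.+1) a k w.
have pE : p = pw w + (a 0%N w)%:P.
  apply/polyP => k; rewrite coefD !coef_poly coefC /atail.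
  by case: k => [|k]; rewrite ?add0r// addr0.
have c0 : cpx (zpair coef i0 w) = a 0%N w by rewrite /cpx /zpair/=; case: (a 0%N w).
have zE z : random_harmonic n m a b w z = (pw w).[z] + ((qw w).[z])^* + a 0%N w.
  by rewrite /random_harmonic /harmonic_fun -/p pE hornerD hornerC addrAC.
have jE z : jacobian_det (random_harmonic n m a b w) z = jacobian_det (harmonic_fun (pw w) (qw w)) z.
  by rewrite /random_harmonic -/p pE; exact: jacobian_harmonicD.
apply/seteqP; split => z [h1 h2]; split.
- by rewrite c0 -zE.
- by rewrite -jE.
- by rewrite zE -c0.
- by rewrite jE.
Qed.

Definition plane_term (w : T) (z : C) : R := Num.max 0 (s * JW w z) * gauss_pdf (- G1 w z, - G2 w z).

Lemma plane_term_ge0 w z : 0 <= plane_term w z.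
Proof. by rewrite mulr_ge0 ?gauss_pdf_ge0// le_max lexx. Qed.

Lemma measurable_plane_term : measurable_fun setT (fun x : T * C => (plane_term x.1 x.2)%:E).
Proof.
have mo : @measurable_fun _ _ (T * C)%type O setT (fun x => x.1).
  exact: (measurableT_comp (measurable_observed coef_gaussian (J := otherset)) (@measurable_fst _ _ T C)).
have [m1 m2 mJ] := measurable_field mo (@measurable_snd _ _ _ _).
apply/measurable_EFinP; apply: measurable_funM.
  by apply: measurable_maxr => //; exact: measurable_funM.
by apply: (measurableT_comp measurable_gauss_pdf); apply: measurable_fun_pair; apply: measurableT_comp.
Qed.

(** Given the other coefficients, the constant term is a standard complex
Gaussian, and the area formula against its density gives the integral over the
plane; Tonelli's theorem then exchanges it with the expectation. *)
Lemma expected_count :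
  (\int[P]_w counting [set z | random_harmonic n m a b w z = 0%R /\ (0 < s * jacobian_det (random_harmonic n m a b w) z)%R]
   = \int[mu2]_z \int[P]_w (plane_term w z)%:E)%E.
Proof.
under eq_integral do rewrite zero_countE.
have [_ H] := observed_integral coef_gaussian coef_indep i0_others measurable_zero_count zero_count_ge0.
rewrite [LHS]H {H}.
have mzc w : measurable_fun setT (fun c : C => zero_count (c, w)).
  exact: (measurableT_comp measurable_zero_count (measurable_pair2 (w : O))).
transitivity (\int[P]_w \int[mu2]_z (plane_term w z)%:E)%E; last first.
  have := @fubini_tonelli _ _ _ _ R P mu2 (fun x : T * C => (plane_term x.1 x.2)%:E) measurable_plane_term.
  by apply => x; rewrite lee_fin plane_term_ge0.
apply: eq_integral => w _.
have H := @zpair_integral _ _ _ _ _ _ _ variance_gt0 coef_gaussian i0 (fun c => zero_count (c, w)) (mzc w) (fun c => zero_count_ge0 _).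
rewrite [LHS]H {H}.
have v1 : Num.sqrt (variance_of i0) = 1 by rewrite /= bin0 sqrtr1.
rewrite v1; under eq_integral do under eq_integral do rewrite !mul1r.
have H := gam_integral_plane (mzc w) (fun c => zero_count_ge0 (c, w)).
rewrite [LHS]H {H}.
exact: (harmonic_area (pw w) (qw w) s2 measurable_gauss_pdf continuous_gauss_pdf gauss_pdf_ge0 gauss_pdf_le gauss_pdf_fin).
Qed.

End Model.

(** * Covariances at a point *)

Section Radial.
Context {R : realType} d (T : measurableType d) (P : probability T R).
Notation MR := (measurableTypeR R).
Notation C := (MR * MR)%type.
Notation E := (C * C * C)%type.
Notation T3 := (R * R * R)%type.

Lemma gsum_coord (I : finType) (Z : I -> T -> R[i]) (vR vI : I -> E) (pr : E -> R) l w :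
  (forall x v u, pr (vadd x v u) = x * pr v + pr u) -> pr ((0, 0), (0, 0), (0, 0)) = 0 ->
  pr (gsum Z vR vI l w) = \sum_(i <- l) (complex.Re (Z i w) * pr (vR i) + complex.Im (Z i w) * pr (vI i)).
Proof.
move=> pl p0; elim: l => [|i l IH]; first by rewrite big_nil.
by rewrite big_cons /= !pl IH addrA.
Qed.

Context (n m : nat) (a b : nat -> T -> R[i]).
Hypothesis model : truncated_model P n m a b.
Notation I := ('I_n.+1 + 'I_m.+1)%type.

Let ReD (u v : R[i]) : complex.Re (u + v) = complex.Re u + complex.Re v. Proof. by case: u; case: v. Qed.
Let ImD (u v : R[i]) : complex.Im (u + v) = complex.Im u + complex.Im v. Proof. by case: u; case: v. Qed.
Lemma Re_sum (J : Type) (r : seq J) (F : J -> R[i]) : complex.Re (\sum_(i <- r) F i) = \sum_(i <- r) complex.Re (F i).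
Proof. exact: (big_morph _ ReD). Qed.
Lemma Im_sum (J : Type) (r : seq J) (F : J -> R[i]) : complex.Im (\sum_(i <- r) F i) = \sum_(i <- r) complex.Im (F i).
Proof. exact: (big_morph _ ImD). Qed.

Section AtPoint.
Variable z : R * R.
Let t := z.1 ^+ 2 + z.2 ^+ 2.
Hypothesis t0 : 0 < t.
Definition xk (k : nat) : R := complex.Re (cpx z ^+ k).
Definition yk (k : nat) : R := complex.Im (cpx z ^+ k).
Lemma xk_yk k : xk k ^+ 2 + yk k ^+ 2 = t ^+ k.
Proof.
elim: k => [|k IH]; first by rewrite /xk /yk !expr0/= expr0n expr1n addr0.
rewrite [RHS]exprS -IH /xk /yk (exprS (cpx z)); case: (cpx z ^+ k) => x y; rewrite /cpx/= /t; ring.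
Qed.

(** The images, in G(z), z p'(z) and the conjugate of z q'(z), of the real
unit (here) and of the imaginary unit (in [vIm]) of a coefficient. *)
Definition vRe (i : I) : E := match i with
  | inl k => ((xk k, yk k), (k%:R * xk k, k%:R * yk k), (0, 0))
  | inr k => ((xk k, - yk k), (0, 0), (k%:R * xk k, - (k%:R * yk k))) end.
Definition vIm (i : I) : E := match i with
  | inl k => ((- yk k, xk k), (- (k%:R * yk k), k%:R * xk k), (0, 0))
  | inr k => ((- yk k, - xk k), (0, 0), (- (k%:R * yk k), - (k%:R * xk k))) end.

Let rho (k : nat) : R := Num.sqrt 'C(n, k)%:R * Num.sqrt (t ^+ k).
(** The weights that remain once the phase of z^k is absorbed in the
coefficient. Taking the conjugate of z q'(z) makes the phase common to all
coordinates. *)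
Definition trip (i : I) : T3 := match i with
  | inl k => (rho k, k%:R * rho k, 0)
  | inr k => (rho k, 0, k%:R * rho k) end.

(** For each coefficient, rotate its real and imaginary parts by the argument
of z^k. *)
Lemma eq_law_weights l : eq_law (gweights (@variance_of R n m) vRe vIm l) (dbl [seq trip i | i <- l]).
Proof.
elim: l => [|i l IH]; first exact: eq_law_refl.
rewrite /gweights /dbl/= -/(gweights _ _ _ l) -/(dbl _).
apply: (eq_law_trans (s2 := [:: vre (trip i), vim (trip i) & gweights (@variance_of R n m) vRe vIm l])); last first.
  by do 2 apply: eq_law_cons.
have tk0 k : Num.sqrt (t ^+ k) != 0 by rewrite gt_eqF// sqrtr_gt0 exprn_gt0.
have tk2 k : Num.sqrt (t ^+ k) ^+ 2 = t ^+ k by rewrite sqr_sqrtr// exprn_ge0// ltW.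
have cs k : (xk k / Num.sqrt (t ^+ k)) ^+ 2 + (yk k / Num.sqrt (t ^+ k)) ^+ 2 = 1.
  by rewrite !expr_div_n -mulrDl xk_yk tk2 divff// -tk2 expf_neq0.
case: i => k.
  have -> : vscale (Num.sqrt (variance_of (inl k : I))) (vRe (inl k : I)) =
     vlin (xk k / Num.sqrt (t ^+ k)) (yk k / Num.sqrt (t ^+ k)) (vre (trip (inl k))) (vim (trip (inl k))).
    by rewrite /vscale /vlin /vadd/= /rho; congr (_, _, _); congr (_, _); field; exact: tk0.
  have -> : vscale (Num.sqrt (variance_of (inl k : I))) (vIm (inl k : I)) =
     vlin (- (yk k / Num.sqrt (t ^+ k))) (xk k / Num.sqrt (t ^+ k)) (vre (trip (inl k))) (vim (trip (inl k))).
    by rewrite /vscale /vlin /vadd/= /rho; congr (_, _, _); congr (_, _); field; exact: tk0.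
  apply: eq_law_givens; [exact: cs|by rewrite sqrrN addrC; exact: cs|by ring].
have -> : vscale (Num.sqrt (variance_of (inr k : I))) (vRe (inr k : I)) =
   vlin (xk k / Num.sqrt (t ^+ k)) (- (yk k / Num.sqrt (t ^+ k))) (vre (trip (inr k))) (vim (trip (inr k))).
  by rewrite /vscale /vlin /vadd/= /rho; congr (_, _, _); congr (_, _); field; exact: tk0.
have -> : vscale (Num.sqrt (variance_of (inr k : I))) (vIm (inr k : I)) =
   vlin (- (yk k / Num.sqrt (t ^+ k))) (- (xk k / Num.sqrt (t ^+ k))) (vre (trip (inr k))) (vim (trip (inr k))).
  by rewrite /vscale /vlin /vadd/= /rho; congr (_, _, _); congr (_, _); field; exact: tk0.
apply: eq_law_givens; [by rewrite sqrrN; exact: cs|by rewrite !sqrrN addrC; exact: cs|by ring].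
Qed.

Lemma sum_others (f : I -> R) : \sum_(i <- others n m) f i =
  \sum_(k < n.+1) (if (k : nat) == 0%N then 0 else f (inl k)) + \sum_(k < m.+1) f (inr k).
Proof.
rewrite /others big_filter big_sumType/= big_mkcond/=; congr (_ + _).
by apply: eq_bigr => k _; rewrite /i0 (inj_eq (inl_inj)) -val_eqE/=; case: eqP.
Qed.

Notation G1 w := (hg1 (pw n a w) (qw m b w)).
Notation G2 w := (hg2 (pw n a w) (qw m b w)).

Lemma gsum_value w : gsum (coef a b) vRe vIm (others n m) w =
  ((G1 w z, G2 w z),
   (complex.Re (cpx z * (pw n a w)^`().[cpx z]), complex.Im (cpx z * (pw n a w)^`().[cpx z])),
   (complex.Re (cpx z * (qw m b w)^`().[cpx z]), - complex.Im (cpx z * (qw m b w)^`().[cpx z]))).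
Proof.
have e1 k : (k%:R * xk k = complex.Re (cpx z * (cpx z ^+ k.-1 *+ k))) /\ (k%:R * yk k = complex.Im (cpx z * (cpx z ^+ k.-1 *+ k))).
  have ReN (u : R[i]) l : complex.Re (u *+ l) = l%:R * complex.Re u.
    by elim: l => [|l IH]; rewrite ?mul0r// mulrS ReD IH -natr1; ring.
  have ImN (u : R[i]) l : complex.Im (u *+ l) = l%:R * complex.Im u.
    by elim: l => [|l IH]; rewrite ?mul0r// mulrS ImD IH -natr1; ring.
  rewrite mulrnAr ReN ImN /xk /yk; case: k => [|k]; first by rewrite !mul0r.
  by rewrite -exprS.
have dE N (F : nat -> R[i]) : cpx z * (\poly_(k < N) F k)^`().[cpx z] = \sum_(k < N) F k * (cpx z * (cpx z ^+ k.-1 *+ k)).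
  by rewrite horner_deriv_poly mulr_sumr; apply: eq_bigr => k _; rewrite mulrCA.
have ReM (u v : R[i]) : complex.Re (u * v) = complex.Re u * complex.Re v + complex.Im u * - complex.Im v.
  by case: u => ? ?; case: v => ? ? /=; ring.
have ImM (u v : R[i]) : complex.Im (u * v) = complex.Re u * complex.Im v + complex.Im u * complex.Re v.
  by case: u => ? ?; case: v => ? ? /=; ring.
have at0 (k : nat) (F : R[i] -> R) : F 0 = 0 -> F (atail a k w) = if k == 0%N then 0 else F (a k w).
  by rewrite /atail; case: eqP.
have gE x : x = (((x.1.1.1, x.1.1.2), (x.1.2.1, x.1.2.2)), (x.2.1, x.2.2)) :> E by case: x => [[[? ?] [? ?]] [? ?]].
rewrite [LHS]gE; congr (_, _, _); congr (_, _).
- rewrite (@gsum_coord _ _ _ _ (fun x => x.1.1.1))// sum_others /hg1 /hre /pw /qw !horner_poly !Re_sum; congr (_ + _); apply: eq_bigr => k _ /=.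
    by rewrite (at0 k (fun u => complex.Re (u * cpx z ^+ k))) ?mul0r// ReM.
  by rewrite ReM.
- rewrite (@gsum_coord _ _ _ _ (fun x => x.1.1.2))// sum_others /hg2 /him /pw /qw !horner_poly !Im_sum -sumrN; congr (_ + _); apply: eq_bigr => k _ /=.
    by rewrite (at0 k (fun u => complex.Im (u * cpx z ^+ k))) ?mul0r// ImM.
  by rewrite ImM !mulrN opprD.
- rewrite (@gsum_coord _ _ _ _ (fun x => x.1.2.1))// sum_others /pw dE Re_sum [X in _ + X]big1 ?addr0; last by move=> k _ /=; rewrite !mulr0 addr0.
  apply: eq_bigr => k _ /=.
  by rewrite (at0 k (fun u => complex.Re (u * (cpx z * (cpx z ^+ k.-1 *+ k))))) ?mul0r// ReM -(e1 k).1 -(e1 k).2.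
- rewrite (@gsum_coord _ _ _ _ (fun x => x.1.2.2))// sum_others /pw dE Im_sum [X in _ + X]big1 ?addr0; last by move=> k _ /=; rewrite !mulr0 addr0.
  apply: eq_bigr => k _ /=.
  by rewrite (at0 k (fun u => complex.Im (u * (cpx z * (cpx z ^+ k.-1 *+ k))))) ?mul0r// ImM -(e1 k).1 -(e1 k).2.
- rewrite (@gsum_coord _ _ _ _ (fun x => x.2.1))// sum_others /qw dE Re_sum big1 ?add0r; last first.
    by move=> k _ /=; rewrite !mulr0 addr0; case: eqP.
  by apply: eq_bigr => k _ /=; rewrite ReM -(e1 k).1 -(e1 k).2.
- rewrite (@gsum_coord _ _ _ _ (fun x => x.2.2))// sum_others /qw dE Im_sum -sumrN big1 ?add0r; last first.
    by move=> k _ /=; rewrite !mulr0 addr0; case: eqP.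
  by apply: eq_bigr => k _ /=; rewrite ImM -(e1 k).1 -(e1 k).2 opprD !mulrN.
Qed.

End AtPoint.
End Radial.

(** * The density of zeros in the squared modulus *)

Section Density.
Context {R : realType}.

Definition partial_moment (n N j : nat) (t : R) : R := \sum_(k < N.+1) k%:R ^+ j * ('C(n, k)%:R * t ^+ k).

(** V is the variance of F(z) at |z|^2 = t, and the S's are the conditional
covariances of z p'(z) and the conjugate of z q'(z) given F(z) = 0, as in
[gauss_value]; the two have covariance 0 before conditioning. The factor 1 / t
turns z p' and z q' into p' and q'. *)
Definition zero_density (s : R) (n m : nat) (t : R) : R :=
  let V := partial_moment n n 0 t + partial_moment n m 0 t in
  let S11 := partial_moment n n 2 t - partial_moment n n 1 t ^+ 2 / V in
  let S22 := partial_moment n m 2 t - partial_moment n m 1 t ^+ 2 / V in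
  let S12 := partial_moment n n 1 t * partial_moment n m 1 t / V in
  posdiff_mean (s * (S11 - S22)) (S11 * S22 - S12 ^+ 2) / (V * t).

Notation mu := (@lebesgue_measure R).
Notation MR := (measurableTypeR R).
Notation C := (MR * MR)%type.
Notation E := (C * C * C)%type.
Notation T3 := (R * R * R)%type.
Notation mu2 := (@plane R).

Lemma partial_moment_ge0 n N j t : 0 <= t -> 0 <= partial_moment n N j t.
Proof. by move=> t0; apply: sumr_ge0 => k _; rewrite !mulr_ge0 ?exprn_ge0. Qed.

Lemma partial_moment0_ge1 n N t : 0 <= t -> 1 <= partial_moment n N 0 t.
Proof.
move=> t0; rewrite /partial_moment big_ord_recl/= bin0 !expr0 !mul1r lerDl.
by apply: sumr_ge0 => k _; rewrite !mulr_ge0 ?exprn_ge0.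
Qed.

Context d (T : measurableType d) (P : probability T R).
Context (n m : nat) (a b : nat -> T -> R[i]).
Hypothesis model : truncated_model P n m a b.
Variable s : R.
Hypothesis s2 : s ^+ 2 = 1.

Lemma sum_pos (F : nat -> R) : \sum_(k < n.+1) (if (k : nat) == 0%N then 0 else F k) = \sum_(k < n.+1) F k - F 0%N.
Proof. by rewrite !big_ord_recl/= add0r addrAC subrr add0r. Qed.

Lemma measurable_gauss_posdiff : measurable_fun setT ((fun w => (expR (- sqn w.1.1) / pi * posdiff s w)%:E) : E -> \bar R).
Proof.
have m11 : measurable_fun setT (fun w : E => w.1.1) by exact: (measurableT_comp measurable_fst measurable_fst).
apply/measurable_EFinP; apply: measurable_funM; last exact: measurable_posdiff.
exact: (measurableT_comp measurable_gauss_pdf m11).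
Qed.

Lemma gauss_posdiff_ge0 (w : E) : (0 <= (expR (- sqn w.1.1) / pi * posdiff s w)%:E)%E.
Proof. by rewrite lee_fin mulr_ge0 ?divr_ge0 ?expR_ge0 ?pi_ge0// le_max lexx. Qed.

(** t J is the difference of |z p'|^2 and |z q'|^2, so that [gauss_value]
applies to the weights of the coefficients other than the constant term, whose
variance is the term 1 added there. *)
Lemma plane_term_value (z : R * R) : 0 < z.1 ^+ 2 + z.2 ^+ 2 ->
  (\int[P]_w (plane_term n m a b s w z)%:E = (zero_density s n m (z.1 ^+ 2 + z.2 ^+ 2) / pi)%:E)%E.
Proof.
set t := _ + _ => t0.
pose f (w : E) : \bar R := (expR (- sqn w.1.1) / pi * posdiff s w)%:E.
have tn0 : t != 0 by rewrite gt_eqF.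
have sqnE (u v : R[i]) : sqn (complex.Re (u * v), complex.Im (u * v)) = (complex.Re u ^+ 2 + complex.Im u ^+ 2) * (complex.Re v ^+ 2 + complex.Im v ^+ 2).
  by rewrite /sqn; case: u => x y; case: v => x' y' /=; ring.
have ptE w : (plane_term n m a b s w z)%:E = ((t^-1)%:E * f (gsum (coef a b) (@vRe R n m z) (@vIm R n m z) (others n m) w))%E.
  rewrite gsum_value /f -EFinM; congr (_%:E).
  rewrite /plane_term /gauss_pdf /posdiff /= hJE.
  set p' := (pw n a w)^`().[cpx z]; set q' := (qw m b w)^`().[cpx z].
  set D := (_ - _ in LHS).
  have -> : sqn (complex.Re (cpx z * p'), complex.Im (cpx z * p')) - sqn (complex.Re (cpx z * q'), - complex.Im (cpx z * q')) = t * D.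
    have -> : sqn (complex.Re (cpx z * q'), - complex.Im (cpx z * q')) = sqn (complex.Re (cpx z * q'), complex.Im (cpx z * q')).
      by rewrite /sqn/= sqrrN.
    by rewrite !sqnE -mulrBr.
  have -> : Num.max 0 (s * (t * D)) = t * Num.max 0 (s * D) by rewrite maxr_pMr ?(ltW t0)// mulr0 mulrCA.
  rewrite /sqn/= !sqrrN; set X := Num.max _ _; set e := expR _ / pi.
  by rewrite [e * _]mulrCA mulKf// mulrC.
under eq_integral do rewrite ptE.
have mf : measurable_fun setT f by exact: measurable_gauss_posdiff.
have f0 w : (0 <= f w)%E by exact: gauss_posdiff_ge0.
rewrite ge0_integralZl; first last.
- by rewrite lee_fin invr_ge0 ltW.
- by move=> w _; exact: f0.
- apply: (measurableT_comp mf).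
  have mo := measurable_observed (coef_gaussian model) (J := otherset n m).
  have mg : measurable_fun setT (gsum (coef a b) (@vRe R n m z) (@vIm R n m z) (others n m) : observed (coef a b) (otherset n m) -> E).
    by apply: measurable_gsum => i il; rewrite inE.
  exact: (measurableT_comp mg mo).
- exact: measurableT.
have H := gsum_integral (variance_gt0 model) (coef_gaussian model) (coef_indep model) (@vRe R n m z) (@vIm R n m z) (uniq_others n m) mf f0.
rewrite [X in (_ * X)%E]H (eq_law_weights t0 _ mf f0).
rewrite [X in (_ * X)%E](gauss_value _ s2) -EFinM; congr (_%:E).
pose rho (k : nat) : R := Num.sqrt 'C(n, k)%:R * Num.sqrt (t ^+ k).
have rho2 k : rho k * rho k = 'C(n, k)%:R * t ^+ k.
  by rewrite /rho mulrACA -!expr2 !sqr_sqrtr// exprn_ge0// ltW.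
set ts := [seq _ | _ <- _].
have gE (g h : T3 -> R) : gram g h ts = \sum_(k < n.+1) (if (k : nat) == 0%N then 0 else g (rho k, k%:R * rho k, 0) * h (rho k, k%:R * rho k, 0))
   + \sum_(k < m.+1) g (rho k, 0, k%:R * rho k) * h (rho k, 0, k%:R * rho k).
  by rewrite /gram /ts big_map sum_others.
have partial_momentE N j (F : nat -> R) : (forall k, F k = k%:R ^+ j * (rho k * rho k)) -> \sum_(k < N.+1) F k = partial_moment n N j t.
  by move=> HF; apply: eq_bigr => k _; rewrite HF rho2.
have E0 N : \sum_(k < N.+1) rho k * rho k = partial_moment n N 0 t.
  by apply: (partial_momentE N 0%N (fun k => rho k * rho k)) => k; rewrite expr0 mul1r.
have E1 N : \sum_(k < N.+1) rho k * (k%:R * rho k) = partial_moment n N 1 t.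
  by apply: (partial_momentE N 1%N (fun k => rho k * (k%:R * rho k))) => k; rewrite expr1; ring.
have E2 N : \sum_(k < N.+1) k%:R * rho k * (k%:R * rho k) = partial_moment n N 2 t.
  by apply: (partial_momentE N 2%N (fun k => k%:R * rho k * (k%:R * rho k))) => k; ring.
have g11 : 1 + gram (fun t : T3 => t.1.1) (fun t : T3 => t.1.1) ts = partial_moment n n 0 t + partial_moment n m 0 t.
  by rewrite gE/= (sum_pos (fun k => rho k * rho k)) !E0 rho2 bin0 expr0; ring.
have g12 : gram (fun t : T3 => t.1.1) (fun t : T3 => t.1.2) ts = partial_moment n n 1 t.
  rewrite gE/= (sum_pos (fun k => rho k * (k%:R * rho k))) E1.
  by rewrite mul0r mulr0 subr0 big1 ?addr0// => k _; rewrite mulr0.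
have g13 : gram (fun t : T3 => t.1.1) (fun t : T3 => t.2) ts = partial_moment n m 1 t.
  by rewrite gE/= big1 ?add0r ?E1// => k _; rewrite mulr0; case: eqP.
have g22 : gram (fun t : T3 => t.1.2) (fun t : T3 => t.1.2) ts = partial_moment n n 2 t.
  rewrite gE/= (sum_pos (fun k => k%:R * rho k * (k%:R * rho k))) E2.
  by rewrite !mul0r subr0 big1 ?addr0// => k _; rewrite mulr0.
have g33 : gram (fun t : T3 => t.2) (fun t : T3 => t.2) ts = partial_moment n m 2 t.
  by rewrite gE/= big1 ?add0r ?E2// => k _; rewrite mulr0; case: eqP.
have g23 : gram (fun t : T3 => t.1.2) (fun t : T3 => t.2) ts = 0.
  rewrite gE/= !big1 ?add0r//; last by move=> k _; rewrite mulr0; case: eqP.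
  by move=> k _; rewrite mul0r.
rewrite g11 g12 g13 g22 g33 g23 sub0r sqrrN /zero_density.
have V0 : partial_moment n n 0 t + partial_moment n m 0 t != 0.
  by rewrite gt_eqF// ltr_wpDr ?partial_moment_ge0 ?ltW// (lt_le_trans ltr01)// partial_moment0_ge1// ltW.
set jv := posdiff_mean _ _; move: (partial_moment n n 0 t + partial_moment n m 0 t) V0 jv => V V0 jv.
by rewrite !invfM; ring.
Qed.

Definition zeros_of (w : T) : set R[i] :=
  [set z | random_harmonic n m a b w z = 0 /\ 0 < s * jacobian_det (random_harmonic n m a b w) z].

(** The integrand depends on |z|^2 only, except at the origin, which is
negligible. Evaluating it at z = sqrt t gives a measurable function of t
without examining the formula. *)
Lemma radial_profile : exists f : MR -> \bar R, [/\ measurable_fun setT f, forall t, (0 <= f t)%E,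
  forall t, 0 < t -> f t = (zero_density s n m t / pi)%:E &
  (\int[P]_w counting (zeros_of w) = pi%:E * \int[mu]_(t in `[0%R, +oo[) f t)%E].
Proof.
rewrite /zeros_of (expected_count model s2).
pose h (z : C) := (\int[P]_w (plane_term n m a b s w z)%:E)%E.
have h0 z : (0 <= h z)%E by apply: integral_ge0 => w _; rewrite lee_fin plane_term_ge0.
have mh : measurable_fun setT h.
  apply: (measurable_fun_fubini_tonelli_G (m1 := P) (fun x : T * C => (plane_term n m a b s x.1 x.2)%:E)).
    exact: (measurable_plane_term model).
  by move=> x; rewrite lee_fin plane_term_ge0.
pose f (t : MR) := h (Num.sqrt t, 0).
have mf : measurable_fun setT f.
  apply: (measurableT_comp mh); apply: measurable_fun_pair => //.
  exact: (continuous_measurable_fun (@sqrt_continuous R)).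
have f0 t : (0 <= f t)%E by exact: h0.
have fE t : 0 < t -> f t = (zero_density s n m t / pi)%:E.
  move=> t0; rewrite /f /h plane_term_value/= ?expr0n ?addr0 ?sqr_sqrtr ?(ltW t0)//.
have mq : measurable_fun setT (fun z : C => f (z.1 ^+ 2 + z.2 ^+ 2)).
  by apply: (measurableT_comp mf); apply: measurable_funD; apply: measurable_funX.
exists f; split => //.
transitivity (\int[mu2]_z f (z.1 ^+ 2 + z.2 ^+ 2)%R)%E.
  apply: ge0_ae_eq_integral; [exact: measurableT|exact: mh|exact: mq|by move=> z _; exact: h0|by move=> z _; exact: f0|].
  exists ([set 0] `*` [set 0] : set C); split.
  - by apply: measurableX; exact: measurable_set1.
  - apply: (etrans (planeX (measurable_set1 _) (measurable_set1 _))).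
    by rewrite [X in (X * _)%E](lebesgue_measure_set1 0) mul0e.
  - move=> z /= hz; apply: contrapT => nz; apply: hz => _.
    have t0 : 0 < z.1 ^+ 2 + z.2 ^+ 2.
      rewrite lt_neqAle eq_sym addr_ge0 ?sqr_ge0// andbT; apply/negP.
      rewrite paddr_eq0 ?sqr_ge0// !sqrf_eq0 => /andP[/eqP z1 /eqP z2].
      by apply: nz; split.
    by rewrite fE// /h plane_term_value.
by rewrite (int2E mq (fun z => f0 _)) (polar_integral mf f0).
Qed.

Lemma measurable_zero_density : measurable_fun (`]0%R, +oo[%classic : set MR) (fun t => (zero_density s n m t)%:E).
Proof.
have [f [mf f0 fE _]] := radial_profile.
apply: (eq_measurable_fun (fun t => pi%:E * f t)%E).
  move=> t; rewrite inE/= in_itv/= andbT => t0.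
  by rewrite fE// -EFinM mulrC divfK// gt_eqF// pi_gt0.
by apply: measurable_funTS; exact: emeasurable_funM.
Qed.

Theorem expected_zeros :
  (\int[P]_w counting (zeros_of w) = \int[mu]_(t in `]0%R, +oo[) (zero_density s n m t)%:E)%E.
Proof.
have [f [mf f0 fE ->]] := radial_profile.
have mf1 : measurable_fun (`]0%R, +oo[%classic : set MR) f by exact: (measurable_funTS mf).
rewrite -(integral_itv_obnd_cbnd mf1).
rewrite -ge0_integralZl; first last.
- by rewrite lee_fin pi_ge0.
- by move=> t _; exact: f0.
- exact: mf1.
- exact: measurable_itv.
apply: eq_integral => t; rewrite inE/= in_itv/= andbT => t0.
by rewrite fE// -EFinM mulrC divfK// gt_eqF// pi_gt0.
Qed.

End Density.

(** * Truncated binomial moments *)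

Section Binomial.
Context {R : realType}.
Implicit Types (t : R) (f : nat -> R).

Definition bsum (n : nat) f t : R := \sum_(k < n.+1) f k * ('C(n, k)%:R * t ^+ k).

Lemma bsum0 f t : bsum 0 f t = f 0%N.
Proof. by rewrite /bsum big_ord_recl big_ord0 bin0 !expr0 !mulr1 addr0. Qed.

(** Pascal's rule, in the form that computes moments by induction on n. *)
Lemma bsumS n f t : bsum n.+1 f t = bsum n f t + t * bsum n (fun k => f k.+1) t.
Proof.
rewrite /bsum big_ord_recl /= bin0 expr0 mulr1.
under eq_bigr => k _ do rewrite /bump/= add1n binS natrD exprS mulrDl mulrDr.
rewrite big_split/= addrA; congr (_ + _).
  rewrite big_ord_recr/= bin_small// mul0r mulr0 addr0 [in RHS]big_ord_recl/= bin0 expr0 mulr1.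
  by congr (_ + _); apply: eq_bigr => k _; rewrite /bump/= add1n exprS.
by rewrite mulr_sumr; apply: eq_bigr => k _; ring.
Qed.

Lemma bsumD n f g t : bsum n (fun k => f k + g k) t = bsum n f t + bsum n g t.
Proof. by rewrite /bsum -big_split/=; apply: eq_bigr => k _; rewrite mulrDl. Qed.
Lemma bsumZ n c f t : bsum n (fun k => c * f k) t = c * bsum n f t.
Proof. by rewrite /bsum mulr_sumr; apply: eq_bigr => k _; ring. Qed.
Lemma eq_bsum n f g t : (forall k, f k = g k) -> bsum n f t = bsum n g t.
Proof. by move=> fg; apply: eq_bigr => k _; rewrite fg. Qed.

Lemma bsum_mom0 n t : bsum n (fun=> 1) t = (1 + t) ^+ n.
Proof.
elim: n => [|n IH]; first by rewrite bsum0 expr0.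
by rewrite bsumS IH exprS mulrDl mul1r.
Qed.
Lemma bsum_mom1 n t : (1 + t) * bsum n (fun k => k%:R) t = n%:R * t * (1 + t) ^+ n.
Proof.
elim: n => [|n IH]; first by rewrite bsum0 mulr0 !mul0r.
rewrite bsumS (@eq_bsum _ (fun k => k.+1%:R) (fun k => k%:R + 1)); last by move=> k; rewrite natr1.
rewrite bsumD bsum_mom0 mulrDr (mulrCA _ t) (mulrDr (1 + t)) IH exprS -(natr1 n); ring.
Qed.
Lemma bsum_mom2 n t : (1 + t) ^+ 2 * bsum n (fun k => k%:R ^+ 2) t = n%:R * t * (1 + n%:R * t) * (1 + t) ^+ n.
Proof.
elim: n => [|n IH]; first by rewrite bsum0 expr0n mulr0 !mul0r.
rewrite bsumS (@eq_bsum _ (fun k => k.+1%:R ^+ 2) (fun k => k%:R ^+ 2 + (2 * k%:R + 1))); last first.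
  by move=> k; rewrite -natr1; ring.
rewrite !bsumD (bsumZ n 2 (fun k => k%:R)) bsum_mom0.
have H1 := bsum_mom1 n t.
rewrite (_ : _ ^+ 2 * _ = (1 + t) * ((1 + t) ^+ 2 * bsum n (fun k => k%:R ^+ 2) t) + 2 * t * (1 + t) * ((1 + t) * bsum n (fun k => k%:R) t) + t * (1 + t) ^+ 2 * (1 + t) ^+ n).
  by rewrite IH H1 [(1 + t) ^+ n.+1]exprS -(natr1 n); ring.
by ring.
Qed.

Context (n : nat) (t : R).
Hypothesis t0 : 0 < t.
Let t1 : 0 < 1 + t. Proof. by rewrite ltr_wpDl. Qed.
Let t1n : 1 + t != 0. Proof. by rewrite gt_eqF. Qed.
(** The success probability of the binomial law [bp], of mean [bmu] and
variance [bvar], whose moments are the sums over k in the density up to the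
factor (1 + t)^n. *)
Definition bx : R := t / (1 + t).
Definition bp (k : nat) : R := 'C(n, k)%:R * t ^+ k / (1 + t) ^+ n.
Definition bmu : R := n%:R * bx.
Definition bvar : R := n%:R * bx * (1 - bx).

Lemma bx_gt0 : 0 < bx. Proof. by rewrite divr_gt0. Qed.
Lemma bx_lt1 : bx < 1. Proof. by rewrite ltr_pdivrMr// mul1r ltrDr. Qed.
Lemma bx1 : 1 - bx = (1 + t)^-1. Proof. by rewrite /bx; field. Qed.
Lemma bp_ge0 k : 0 <= bp k.
Proof. by rewrite divr_ge0 ?exprn_ge0 ?(ltW t1)// mulr_ge0// exprn_ge0// ltW. Qed.

Lemma bpE f : \sum_(k < n.+1) f k * bp k = bsum n f t / (1 + t) ^+ n.
Proof. by rewrite /bsum mulr_suml; apply: eq_bigr => k _; rewrite !mulrA. Qed.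

Let tn0 : (1 + t) ^+ n != 0. Proof. exact: expf_neq0. Qed.

Lemma bp_sum : \sum_(k < n.+1) bp k = 1.
Proof.
rewrite (eq_bigr (fun k : 'I_n.+1 => 1 * bp k)); last by move=> k _; rewrite mul1r.
by rewrite (bpE (fun=> 1)) bsum_mom0 divff.
Qed.
Lemma bp_mean : \sum_(k < n.+1) k%:R * bp k = bmu.
Proof.
rewrite (bpE (fun k => k%:R)); apply: (mulfI t1n); rewrite mulrA bsum_mom1 mulfK//.
by rewrite /bmu /bx; field.
Qed.
Lemma bp_second : \sum_(k < n.+1) k%:R ^+ 2 * bp k = bmu ^+ 2 + bvar.
Proof.
rewrite (bpE (fun k => k%:R ^+ 2)); apply: (mulfI (expf_neq0 2 t1n)); rewrite mulrA bsum_mom2 mulfK//.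
by rewrite /bmu /bvar /bx; field.
Qed.
Lemma bp_variance : \sum_(k < n.+1) (k%:R - bmu) ^+ 2 * bp k = bvar.
Proof.
rewrite (eq_bigr (fun k : 'I_n.+1 => k%:R ^+ 2 * bp k - 2 * bmu * (k%:R * bp k) + bmu ^+ 2 * bp k)); last first.
  by move=> k _; ring.
rewrite big_split/= sumrB/= -!mulr_sumr bp_sum bp_mean bp_second; ring.
Qed.
Lemma bp_centered : \sum_(k < n.+1) (k%:R - bmu) * bp k = 0.
Proof.
rewrite (eq_bigr (fun k : 'I_n.+1 => k%:R * bp k - bmu * bp k)); last by move=> k _; ring.
by rewrite sumrB -mulr_sumr bp_sum bp_mean mulr1 subrr.
Qed.

Context (m : nat).
Hypothesis mn : (m <= n)%N.
(** Mass and first two moments, centred at the full mean, of the binomial law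
truncated at m. *)
Definition bb : R := \sum_(k < m.+1) bp k.
Definition bc1 : R := \sum_(k < m.+1) (k%:R - bmu) * bp k.
Definition bc2 : R := \sum_(k < m.+1) (k%:R - bmu) ^+ 2 * bp k.
(** Divided by (1 + t)^n or its square: V, the difference S11 - S22 and the
determinant S11 S22 - S12^2 of the density; [a2b] and [b2b] are the full and
the truncated second moments. The centred form shows that the terms of order
n^2 cancel in the difference, and those of order n^4 in the determinant. *)
Definition Vb : R := 1 + bb.
Definition Deltab : R := bvar - bc2 - 2 * bmu * bc1 / Vb + bc1 ^+ 2 / Vb.
Definition a2b : R := bmu ^+ 2 + bvar.
Definition b2b : R := bc2 + 2 * bmu * bc1 + bmu ^+ 2 * bb.
Definition Db : R := (b2b * bvar + a2b * (bc2 * bb - bc1 ^+ 2)) / Vb.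

Lemma bp_split f : \sum_(k < n.+1) f k * bp k = \sum_(k < m.+1) f k * bp k + \sum_(m.+1 <= k < n.+1) f k * bp k.
Proof. by rewrite -!(big_mkord xpredT (fun k => f k * bp k)) (big_cat_nat _ (n := m.+1)). Qed.

Lemma bb_ge0 : 0 <= bb. Proof. by apply: sumr_ge0 => k _; exact: bp_ge0. Qed.
Lemma bb_gt0 : 0 < bb.
Proof.
rewrite /bb big_ord_recl/= ltr_pwDl//; last by apply: sumr_ge0 => k _; exact: bp_ge0.
by rewrite /bp bin0 expr0 mulr1 divr_gt0// exprn_gt0.
Qed.
Let tail_ge0 f : (forall k, 0 <= f k) -> 0 <= \sum_(m.+1 <= k < n.+1) f k * bp k.
Proof. by move=> f0; apply: sumr_ge0 => k _; rewrite mulr_ge0// bp_ge0. Qed.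

Lemma bb_tail : 1 - bb = \sum_(m.+1 <= k < n.+1) 1 * bp k.
Proof.
have E : \sum_(k < n.+1) 1 * bp k = 1.
  by rewrite -[RHS]bp_sum; apply: eq_bigr => k _; rewrite mul1r.
have E2 : \sum_(k < m.+1) 1 * bp k = bb by apply: eq_bigr => k _; rewrite mul1r.
by apply/eqP; rewrite subr_eq; apply/eqP; rewrite -[LHS]E (bp_split (fun=> 1)) E2 addrC.
Qed.
Lemma bb_le1 : bb <= 1.
Proof. by rewrite -subr_ge0 bb_tail tail_ge0. Qed.
Lemma bc2_tail : bvar - bc2 = \sum_(m.+1 <= k < n.+1) (k%:R - bmu) ^+ 2 * bp k.
Proof. by rewrite -bp_variance (bp_split (fun k => (k%:R - bmu) ^+ 2)) addrAC subrr add0r. Qed.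
Lemma bc1_tail : - bc1 = \sum_(m.+1 <= k < n.+1) (k%:R - bmu) * bp k.
Proof. by rewrite -[LHS]add0r -[in LHS]bp_centered (bp_split (fun k => k%:R - bmu)) addrAC subrr add0r. Qed.
Lemma b2bE : b2b = \sum_(k < m.+1) k%:R ^+ 2 * bp k.
Proof.
rewrite /b2b /bb /bc1 /bc2 !mulr_sumr -!big_split/=; apply: eq_bigr => k _; ring.
Qed.
Lemma b2_tail : a2b - b2b = \sum_(m.+1 <= k < n.+1) k%:R ^+ 2 * bp k.
Proof. by rewrite b2bE /a2b -bp_second (bp_split (fun k => k%:R ^+ 2)) addrAC subrr add0r. Qed.
Lemma b1E : \sum_(k < m.+1) k%:R * bp k = bc1 + bmu * bb.
Proof. by rewrite /bc1 /bb mulr_sumr -big_split/=; apply: eq_bigr => k _; ring. Qed.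

Lemma bc2_ge0 : 0 <= bc2.
Proof. by apply: sumr_ge0 => k _; rewrite mulr_ge0 ?sqr_ge0 ?bp_ge0. Qed.
Lemma bc2_le : bc2 <= bvar.
Proof. by rewrite -subr_ge0 bc2_tail tail_ge0// => k; exact: sqr_ge0. Qed.
Lemma b2b_ge0 : 0 <= b2b.
Proof. by rewrite b2bE; apply: sumr_ge0 => k _; rewrite mulr_ge0 ?sqr_ge0 ?bp_ge0. Qed.
Lemma b2b_le : b2b <= a2b.
Proof. by rewrite -subr_ge0 b2_tail tail_ge0// => k; exact: sqr_ge0. Qed.

(** The Cauchy-Schwarz inequality for the truncated law. *)
Lemma bc1_sqr : bc1 ^+ 2 <= bb * bc2.
Proof.
have : 0 <= bb * (bb * bc2 - bc1 ^+ 2).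
  rewrite (_ : _ * _ = \sum_(k < m.+1) (bb * (k%:R - bmu) - bc1) ^+ 2 * bp k).
    by apply: sumr_ge0 => k _; rewrite mulr_ge0 ?sqr_ge0 ?bp_ge0.
  rewrite (eq_bigr (fun k : 'I_m.+1 => bb ^+ 2 * ((k%:R - bmu) ^+ 2 * bp k) - 2 * bb * bc1 * ((k%:R - bmu) * bp k) + bc1 ^+ 2 * bp k)).
    rewrite big_split/= sumrB/= -!mulr_sumr -/bb -/bc1 -/bc2; ring.
  by move=> k _; ring.
by rewrite pmulr_rge0 ?bb_gt0// subr_ge0.
Qed.

Let V1 : 1 <= Vb. Proof. by rewrite /Vb lerDl bb_ge0. Qed.
Let V0 : 0 < Vb. Proof. exact: lt_le_trans ltr01 V1. Qed.

(** By [bc1_sqr], the first truncated moment is at most the standard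
deviation, which compensates for the large factor [bmu]. *)
Lemma Deltab_le : `|Deltab| <= 2 * bvar + 2 * bmu * Num.sqrt bvar.
Proof.
have mu0 : 0 <= bmu by rewrite /bmu mulr_ge0// ltW// bx_gt0.
have hc1 : bc1 ^+ 2 <= bvar.
  apply: le_trans bc1_sqr _; rewrite -[leRHS]mul1r.
  by apply: ler_pM; [exact: bb_ge0|exact: bc2_ge0|exact: bb_le1|exact: bc2_le].
have hc1' : `|bc1| <= Num.sqrt bvar by rewrite -sqrtr_sqr ler_wsqrtr.
have Vi : Vb^-1 <= 1 by rewrite invf_le1.
have Vi0 : 0 <= Vb^-1 by rewrite invr_ge0 ltW.
have h1 : `|2 * bmu * bc1 / Vb| <= 2 * bmu * Num.sqrt bvar.
  have m20 : 0 <= 2 * bmu by exact: mulr_ge0.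
  rewrite normrM (ger0_norm Vi0) normrM (ger0_norm m20) -[leRHS]mulr1.
  apply: ler_pM => //; first by apply: mulr_ge0.
  exact: ler_wpM2l.
have h2 : 0 <= bc1 ^+ 2 / Vb <= bvar.
  apply/andP; split; first by rewrite mulr_ge0 ?sqr_ge0.
  by rewrite -[leRHS]mulr1; apply: ler_pM => //; exact: sqr_ge0.
have h3 := bc2_ge0; have h4 := bc2_le.
move: h1 h2; rewrite /Deltab; set u := 2 * bmu * bc1 / Vb; set v := bc1 ^+ 2 / Vb; set w := 2 * bmu * _.
rewrite !ler_norml => /andP[h1 h1'] /andP[h2 h2']; apply/andP; split; lra.
Qed.

Lemma Db_ge0 : 0 <= Db.
Proof.
have v0 : 0 <= bvar by apply: le_trans bc2_le; exact: bc2_ge0.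
have c := bc1_sqr.
apply: divr_ge0; last exact: ltW.
apply: addr_ge0; first by rewrite mulr_ge0// b2b_ge0.
by apply: mulr_ge0; [rewrite /a2b addr_ge0// sqr_ge0|rewrite subr_ge0 mulrC].
Qed.

Lemma Db_le : Db <= 2 * a2b * bvar.
Proof.
have v0 : 0 <= bvar by apply: le_trans bc2_le; exact: bc2_ge0.
have a0 : 0 <= a2b by rewrite /a2b addr_ge0// sqr_ge0.
have Vi : Vb^-1 <= 1 by rewrite invf_le1.
have h1 : b2b * bvar <= a2b * bvar by rewrite ler_wpM2r// b2b_le.
have h2 : a2b * (bc2 * bb - bc1 ^+ 2) <= a2b * bvar.
  rewrite ler_wpM2l//; apply: (@le_trans _ _ (bc2 * bb)); first by rewrite lerBlDr lerDl sqr_ge0.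
  by rewrite -[leRHS]mulr1; apply: ler_pM; [exact: bc2_ge0|exact: bb_ge0|exact: bc2_le|exact: bb_le1].
have N0 : 0 <= b2b * bvar + a2b * (bc2 * bb - bc1 ^+ 2).
  apply: addr_ge0; first by rewrite mulr_ge0// b2b_ge0.
  by rewrite mulr_ge0// subr_ge0 mulrC bc1_sqr.
apply: (@le_trans _ _ (b2b * bvar + a2b * (bc2 * bb - bc1 ^+ 2))).
  by rewrite /Db -[leRHS]mulr1 ler_wpM2l.
by rewrite (_ : 2 * a2b * bvar = a2b * bvar + a2b * bvar); [exact: lerD|ring].
Qed.

Lemma posdiff_mean_scale (c e D : R) : 0 < c -> posdiff_mean (c * e) (c ^+ 2 * D) = c * posdiff_mean e D.
Proof.
move=> c0; rewrite /posdiff_mean.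
have -> : (c * e) ^+ 2 + 4 * (c ^+ 2 * D) = c ^+ 2 * (e ^+ 2 + 4 * D) by ring.
rewrite sqrtrM ?sqr_ge0// sqrtr_sqr gtr0_norm//.
have [->|r0] := eqVneq (Num.sqrt (e ^+ 2 + 4 * D)) 0; first by rewrite !mulr0 invr0 !mulr0.
by field; rewrite r0 gt_eqF.
Qed.

Lemma partial_momentE N j : partial_moment n N j t = (1 + t) ^+ n * \sum_(k < N.+1) k%:R ^+ j * bp k.
Proof.
rewrite /partial_moment mulr_sumr; apply: eq_bigr => k _; rewrite /bp; field; exact: tn0.
Qed.

Lemma zero_density_binomial (s : R) : zero_density s n m t = posdiff_mean (s * Deltab) Db / (Vb * t).
Proof.
have e0 N : \sum_(k < N.+1) k%:R ^+ 0 * bp k = \sum_(k < N.+1) bp k.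
  by apply: eq_bigr => k _; rewrite expr0 mul1r.
have e1 N : \sum_(k < N.+1) k%:R ^+ 1 * bp k = \sum_(k < N.+1) k%:R * bp k.
  by apply: eq_bigr => k _; rewrite expr1.
rewrite /zero_density !partial_momentE !e0 !e1 bp_sum bp_mean bp_second -b2bE b1E -/bb.
set A := (1 + t) ^+ n; have A0 : 0 < A by rewrite exprn_gt0.
have An : A != 0 by rewrite gt_eqF.
have Vn : Vb != 0 by rewrite gt_eqF.
have VE : A * 1 + A * bb = A * Vb by rewrite /Vb mulrDr.
rewrite VE.
have -> : s * (A * (bmu ^+ 2 + bvar) - (A * bmu) ^+ 2 / (A * Vb) - (A * b2b - (A * (bc1 + bmu * bb)) ^+ 2 / (A * Vb))) = A * (s * Deltab).
  by rewrite /Deltab /b2b /Vb; field; rewrite -/Vb Vn An.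
have -> : (A * (bmu ^+ 2 + bvar) - (A * bmu) ^+ 2 / (A * Vb)) * (A * b2b - (A * (bc1 + bmu * bb)) ^+ 2 / (A * Vb)) - (A * bmu * (A * (bc1 + bmu * bb)) / (A * Vb)) ^+ 2 = A ^+ 2 * Db.
  by rewrite /Db /a2b /b2b /Vb; field; rewrite -/Vb Vn An.
rewrite posdiff_mean_scale//; move: (posdiff_mean _ _) => jv.
by field; rewrite Vn An gt_eqF.
Qed.
End Binomial.

(** * Bounds and limit of the density *)

Section DensityBounds.
Context {R : realType}.

Lemma posdiff_mean_ge0 (e D : R) : 0 <= posdiff_mean e D.
Proof. by rewrite /posdiff_mean mulr_ge0 ?sqr_ge0// invr_ge0 sqrtr_ge0. Qed.

(** The value is at most the sum of the absolute values of the two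
eigenvalues, that is sqrt (e^2 + 4 D). *)
Lemma posdiff_mean_le (e D : R) : 0 <= D -> posdiff_mean e D <= `|e| + 2 * Num.sqrt D.
Proof.
move=> D0; rewrite /posdiff_mean; set r := Num.sqrt _.
have r0 : 0 <= r := sqrtr_ge0 _.
have er : `|e| <= r by rewrite -sqrtr_sqr ler_wsqrtr// lerDl mulr_ge0.
have rle : r <= `|e| + 2 * Num.sqrt D.
  rewrite -[leRHS]ger0_norm// -sqrtr_sqr ler_wsqrtr//.
  rewrite sqrrD exprMn sqr_sqrtr// real_normK ?num_real//.
  rewrite (_ : 2 ^+ 2 = 4 :> R); last by ring.
  by rewrite -addrA lerD2l lerDr mulrn_wge0// !mulr_ge0 ?sqrtr_ge0.
apply: le_trans rle.
have [->|rn] := eqVneq r 0; first by rewrite invr0 mulr0.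
have rp : 0 < r by rewrite lt_neqAle eq_sym rn.
rewrite ler_pdivrMr// -expr2.
move: er; rewrite ler_norml => /andP[e1 e2].
rewrite ler_sqr ?nnegrE//; lra.
Qed.

(** The formula is continuous at (0, D0) if D0 > 0; if D0 = 0,
[posdiff_mean_le] squeezes it to 0. *)
Lemma cvg_posdiff_mean (u v : nat -> R) (D0 : R) : (forall n, 0 <= v n) -> 0 <= D0 ->
  u @ \oo --> (0 : R) -> v @ \oo --> D0 -> (fun n => posdiff_mean (u n) (v n)) @ \oo --> Num.sqrt D0 / 2.
Proof.
move=> v0 D00 cu cv.
have [D0E|Dn] := eqVneq D0 0.
  rewrite D0E sqrtr0 mul0r; apply: (@squeeze_cvgr _ _ _ _ (fun=> 0) (fun n => `|u n| + 2 * Num.sqrt (v n))).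
  - by apply: nearW => n; rewrite posdiff_mean_ge0 posdiff_mean_le.
  - exact: cvg_cst.
  - rewrite -[X in _ --> X]addr0; apply: cvgD; first by rewrite -[X in _ --> X](@normr0 _ R); exact: cvg_norm.
    rewrite -[X in _ --> X](mulr0 2); apply: cvgM; first exact: cvg_cst.
    rewrite -[X in _ --> X]sqrtr0 -D0E; exact: (cvg_comp _ _ cv (@sqrt_continuous R D0)).
have Dp : 0 < D0 by rewrite lt_neqAle eq_sym Dn.
have cr : (fun n => Num.sqrt (u n ^+ 2 + 4 * v n)) @ \oo --> 2 * Num.sqrt D0.
  have -> : 2 * Num.sqrt D0 = Num.sqrt (0 * 0 + 4 * D0).
    by rewrite mul0r add0r sqrtrM// (_ : 4 = 2 ^+ 2 :> R) ?sqrtr_sqr ?ger0_norm//; ring.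
  have c : (fun n => u n ^+ 2 + 4 * v n) @ \oo --> 0 * 0 + 4 * D0.
    apply: cvgD; last by apply: cvgM; [exact: cvg_cst|exact: cv].
    under eq_fun do rewrite expr2; exact: cvgM.
  exact: (cvg_comp _ _ c (@sqrt_continuous R _)).
have s0 : 0 < Num.sqrt D0 by rewrite sqrtr_gt0.
have -> : Num.sqrt D0 / 2 = ((2 * Num.sqrt D0 + 0) / 2) ^+ 2 / (2 * Num.sqrt D0).
  by field; rewrite gt_eqF.
apply: cvgM; last by apply: cvgV => //; rewrite gt_eqF// mulr_gt0.
under eq_fun do rewrite expr2; rewrite expr2.
have ch : (fun n => (Num.sqrt (u n ^+ 2 + 4 * v n) + u n) / 2) @ \oo --> (2 * Num.sqrt D0 + 0) / 2.
  by apply: cvgM; [exact: cvgD|exact: cvg_cst].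
exact: cvgM.
Qed.

(** The scale n^(3/2) without real powers. *)
Definition n32 (n : nat) : R := n%:R * Num.sqrt n%:R.
Lemma n32_gt0 n : (0 < n)%N -> 0 < n32 n.
Proof. by move=> n0; rewrite mulr_gt0 ?ltr0n// sqrtr_gt0 ltr0n. Qed.
Lemma n32_sqr n : n32 n ^+ 2 = n%:R ^+ 3.
Proof. by rewrite exprMn sqr_sqrtr// [RHS]exprSr. Qed.

Section Domination.
Variables (n m : nat) (t s : R).
Hypotheses (t0 : 0 < t) (n0 : (0 < n)%N) (mn : (m <= n)%N) (s2 : s ^+ 2 = 1).
Let n1 : 1 <= n%:R :> R. Proof. by rewrite ler1n. Qed.
(* the success and failure probabilities, abstract so that arithmetic
   tactics see two atoms *)
Variables x y : R.
Hypotheses (xE : x = bx t) (yE : y = (1 + t)^-1).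
Let x0 : 0 < x. Proof. by rewrite xE bx_gt0. Qed.
Let xy : x + y = 1. Proof. by rewrite xE yE -bx1// addrC subrK. Qed.
Let y0 : 0 < y. Proof. by rewrite yE invr_gt0 ltr_wpDl. Qed.
Let xt : x = t * y. Proof. by rewrite xE yE. Qed.
Let varE : bvar n t = n%:R * x * y. Proof. by rewrite /bvar bx1// xE yE. Qed.
Let muE : bmu n t = n%:R * x. Proof. by rewrite xE. Qed.
Let y1 : y <= 1. Proof. by rewrite -xy lerDr ltW. Qed.
Let x1 : x <= 1. Proof. by rewrite -xy lerDl ltW. Qed.
Let Vge1 : 1 <= Vb n t m. Proof. by rewrite /Vb lerDl bb_ge0. Qed.

Lemma bvar_le : bvar n t <= n%:R.
Proof.
rewrite varE -mulrA -[leRHS]mulr1 ler_wpM2l// -[leRHS]mulr1.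
by apply: ler_pM; rewrite ?(ltW x0) ?(ltW y0).
Qed.
Lemma bmu_ge0 : 0 <= bmu n t. Proof. by rewrite muE mulr_ge0// ltW. Qed.
Lemma bmu_le : bmu n t <= n%:R.
Proof. by rewrite muE -[leRHS]mulr1 ler_wpM2l. Qed.
Lemma a2b_le : a2b n t <= n%:R ^+ 2 * x.
Proof.
rewrite /a2b varE muE.
rewrite (_ : _ + _ = n%:R * x * (n%:R * x + 1 * y)); last by ring.
rewrite (_ : _ ^+ 2 * x = n%:R * x * (n%:R * x + n%:R * y)); last by rewrite -mulrDr xy; ring.
by rewrite ler_wpM2l ?mulr_ge0 ?(ltW x0)// lerD2l ler_wpM2r ?(ltW y0).
Qed.

Lemma Deltab_bound : `|Deltab n t m| <= 4 * n32 n * x * Num.sqrt y.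
Proof.
apply: le_trans (Deltab_le t0 mn) _.
have sy : Num.sqrt y ^+ 2 = y by rewrite sqr_sqrtr// ltW.
have sy1 : Num.sqrt y <= 1 by rewrite -[leRHS]sqrtr1 ler_wsqrtr.
have sn1 : 1 <= Num.sqrt n%:R :> R by rewrite -[leLHS]sqrtr1 ler_wsqrtr.
have h1 : bvar n t <= n32 n * x * Num.sqrt y.
  rewrite varE -{1}sy /n32 expr2.
  rewrite (_ : _ * x * (_ * _) = n%:R * x * Num.sqrt y * Num.sqrt y); last by ring.
  rewrite (_ : n%:R * _ * x * _ = n%:R * x * Num.sqrt y * Num.sqrt n%:R); last by ring.
  rewrite ler_wpM2l ?mulr_ge0 ?(ltW x0)//; exact: le_trans sy1 sn1.
have h2 : bmu n t * Num.sqrt (bvar n t) <= n32 n * x * Num.sqrt y.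
  have -> : n32 n * x * Num.sqrt y = bmu n t * (Num.sqrt n%:R * Num.sqrt y) by rewrite /n32 muE; ring.
  rewrite ler_wpM2l ?bmu_ge0// -sqrtrM// ler_wsqrtr// varE -mulrA ler_wpM2l//.
  by rewrite -[leRHS]mul1r ler_wpM2r ?(ltW y0).
by rewrite (_ : 4 * _ * _ * _ = 2 * (n32 n * x * Num.sqrt y) + 2 * (n32 n * x * Num.sqrt y)); [rewrite -(mulrA 2 (bmu _ _)); lra|ring].
Qed.

Lemma Db_bound : 2 * Num.sqrt (Db n t m) <= 3 * n32 n * x * Num.sqrt y.
Proof.
have h : 0 <= 3 * n32 n * x * Num.sqrt y by rewrite !mulr_ge0 ?sqrtr_ge0// ltW.
rewrite -[leLHS]ger0_norm ?mulr_ge0 ?sqrtr_ge0// -[leRHS]ger0_norm// -!sqrtr_sqr ler_wsqrtr//.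
rewrite !exprMn sqr_sqrtr ?Db_ge0// -exprMn -/(n32 n) n32_sqr (sqr_sqrtr (ltW y0)).
have hD := Db_le t0 mn; have ha := a2b_le.
have h2 : a2b n t * bvar n t <= n%:R ^+ 2 * x * bvar n t by rewrite ler_wpM2r// varE !mulr_ge0 ?(ltW x0) ?(ltW y0).
have h3 : n%:R ^+ 2 * x * bvar n t = n%:R ^+ 3 * x ^+ 2 * y by rewrite varE; ring.
have h4 : 0 <= n%:R ^+ 3 * x ^+ 2 * y by rewrite !mulr_ge0 ?exprn_ge0 ?sqr_ge0 ?(ltW x0) ?(ltW y0).
rewrite h3 in h2; rewrite -(mulrA 2 (a2b _ _)) in hD.
rewrite (_ : 2 ^+ 2 = 4 :> R); last by ring.
rewrite (_ : 3 ^+ 2 * n%:R ^+ 3 * x ^+ 2 * y = 9 * (n%:R ^+ 3 * x ^+ 2 * y)); last by ring.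
lra.
Qed.

Lemma zero_density_ge0 : 0 <= zero_density s n m t.
Proof.
rewrite zero_density_binomial// mulr_ge0 ?posdiff_mean_ge0// invr_ge0 mulr_ge0 ?(ltW t0)//.
exact: le_trans ler01 Vge1.
Qed.

(** Both terms of [posdiff_mean_le] are of order n^(3/2) x sqrt y, and
dividing by t = x / y leaves n^(3/2) y^(3/2), which is integrable in t. *)
Lemma zero_density_bound : zero_density s n m t <= 7 * n32 n * (y * Num.sqrt y).
Proof.
rewrite zero_density_binomial// ler_pdivrMr; last by rewrite mulr_gt0// (lt_le_trans ltr01).
apply: le_trans (posdiff_mean_le _ (Db_ge0 t0 mn)) _.
have ns : `|s| = 1 by apply/eqP; rewrite -sqrp_eq1// -normrX s2 normr1.
rewrite normrM ns mul1r.
have hV : 7 * n32 n * (y * Num.sqrt y) * t <= 7 * n32 n * (y * Num.sqrt y) * (Vb n t m * t).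
  rewrite ler_wpM2l; last by rewrite -[leLHS]mul1r ler_wpM2r// ltW.
    by [].
  by rewrite !mulr_ge0 ?sqrtr_ge0// ltW.
apply: le_trans hV.
rewrite (_ : 7 * n32 n * _ * t = 4 * n32 n * x * Num.sqrt y + 3 * n32 n * x * Num.sqrt y); last by rewrite xt; ring.
by apply: lerD; [exact: Deltab_bound|exact: Db_bound].
Qed.

End Domination.

Section Tails.
Variables (n m : nat) (t alpha : R).
Hypotheses (t0 : 0 < t) (mn : (m <= n)%N).
Hypotheses (m1 : m%:R <= alpha * n%:R) (m2 : alpha * n%:R < m.+1%:R).
Let x := bx t.

(** Markov's inequality for y^k, whose mean (1 + x (y - 1))^n is at most exp
(n x (y - 1)). *)
Lemma chernoff (y : R) : 0 < y -> (1 <= y -> 1 - bb n t m <= expR (- (n%:R * (alpha * ln y - x * (y - 1))))) /\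
   (y <= 1 -> bb n t m <= expR (- (n%:R * (alpha * ln y - x * (y - 1))))).
Proof.
move=> y0.
have t1 : 0 < 1 + t by rewrite ltr_wpDl.
have yk k : y ^+ k = expR (k%:R * ln y) by rewrite expRM_natl lnK.
pose u k := expR ((k%:R - alpha * n%:R) * ln y).
have uE k : u k = expR (- (alpha * n%:R * ln y)) * y ^+ k.
  by rewrite yk -expRD /u; congr expR; ring.
have tot : \sum_(k < n.+1) u k * bp n t k <= expR (- (n%:R * (alpha * ln y - x * (y - 1)))).
  rewrite (eq_bigr (fun k : 'I_n.+1 => expR (- (alpha * n%:R * ln y)) / (1 + t) ^+ n * (1 * ('C(n, k)%:R * (t * y) ^+ k)))); last first.
    by move=> k _; rewrite uE /bp exprMn mul1r; ring.
  rewrite -mulr_sumr -[X in _ * X]/(bsum n (fun=> 1) (t * y)) bsum_mom0.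
  rewrite (_ : - (n%:R * _) = - (alpha * n%:R * ln y) + n%:R * (x * (y - 1))); last by ring.
  rewrite expRD -mulrA ler_wpM2l ?expR_ge0// expRM_natl mulrC -expr_div_n.
  apply: lerXn2r; rewrite ?nnegrE ?expR_ge0//.
    by rewrite divr_ge0 ?(ltW t1)// addr_ge0// mulr_ge0 ?(ltW t0) ?(ltW y0).
  apply: le_trans (expR_ge1Dx _); rewrite /x /bx le_eqVlt; apply/orP; left; apply/eqP.
  by field; rewrite gt_eqF.
have u0 k : 0 <= u k := expR_ge0 _.
split => y1; apply: le_trans tot.
  have ly : 0 <= ln y by rewrite ln_ge0.
  rewrite (bb_tail t0 mn) (bp_split t mn u) -[leLHS]add0r; apply: lerD.
    by apply: sumr_ge0 => k _; rewrite mulr_ge0// bp_ge0.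
  rewrite big_nat_cond [leRHS]big_nat_cond; apply: ler_sum => k /andP[/andP[mk _] _].
  rewrite ler_wpM2r ?bp_ge0// -expR0 ler_expR mulr_ge0// subr_ge0 ltW//.
  by apply: lt_le_trans m2 _; rewrite ler_nat.
have ly : ln y <= 0 by rewrite ln_le0.
rewrite (bp_split t mn u) -[leLHS]addr0; apply: lerD.
  apply: ler_sum => k _; rewrite -[leLHS]mul1r ler_wpM2r ?bp_ge0// -expR0 ler_expR mulr_le0// subr_le0.
  by apply: le_trans m1; rewrite ler_nat -ltnS.
by apply: sumr_ge0 => k _; rewrite mulr_ge0// bp_ge0.
Qed.

Lemma expR_decay (z : R) : 0 < z -> expR (- z) <= 24 / z ^+ 4.
Proof.
move=> z0; have := expR_ge1Dxn 3 (ltW z0); rewrite (_ : 4`!%:R = 24 :> R)// => h.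
rewrite expRN -[24]invrK -invfM lef_pV2 ?posrE ?expR_gt0 ?mulr_gt0 ?exprn_gt0//.
by apply: le_trans h; rewrite mulrC lerDr.
Qed.

(** The binomial mass on the wrong side of the truncation: what the truncation
removes if the mean n x lies below alpha n, what it keeps otherwise. *)
Definition tail : R := if x < alpha then 1 - bb n t m else bb n t m.

End Tails.

(** Chernoff's bound with y halfway between 1 and alpha / x has a positive
rate by ln y >= 1 - 1 / y, so the tail is smaller than any power of n; the
fourth power absorbs the losses in [density_errors]. *)
Lemma tail_decay (t alpha : R) : 0 < t -> 0 < alpha -> bx t != alpha ->
  exists2 K : R, 0 <= K & forall n m : nat, (0 < n)%N -> (m <= n)%N -> m%:R <= alpha * n%:R -> alpha * n%:R < m.+1%:R ->
  tail n m t alpha * n%:R ^+ 4 <= K.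
Proof.
move=> t0 a0 xa; have x0 := bx_gt0 t0; set x := bx t in x0 xa *.
pose y := (1 + alpha / x) / 2.
have ax0 : 0 < alpha / x by rewrite divr_gt0.
have y0 : 0 < y by rewrite divr_gt0 ?addr_gt0.
pose dl := alpha * ln y - x * (y - 1).
have lny : 1 - y^-1 <= ln y.
  have := expR_ge1Dx (- ln y); rewrite expRN lnK// => h; lra.
have dl0 : 0 < dl.
  have h1 : alpha * (1 - y^-1) <= alpha * ln y by rewrite ler_wpM2l// ltW.
  apply: (@lt_le_trans _ _ (alpha * (1 - y^-1) - x * (y - 1))); last by rewrite /dl lerD2r.
  have -> : alpha * (1 - y^-1) - x * (y - 1) = (alpha - x) ^+ 2 / (2 * (x + alpha)).
    by rewrite /y; field; rewrite !gt_eqF// addr_gt0.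
  apply: divr_gt0; last by rewrite mulr_gt0 ?addr_gt0.
  by rewrite exprn_even_gt0//= subr_eq0 eq_sym.
exists (24 / dl ^+ 4); first by rewrite divr_ge0// exprn_ge0// ltW.
move=> n m n0 mn m1 m2.
have n0' : 0 < n%:R :> R by rewrite ltr0n.
rewrite -ler_pdivlMr ?exprn_gt0//.
have -> : 24 / dl ^+ 4 / n%:R ^+ 4 = 24 / (n%:R * dl) ^+ 4 by rewrite -mulrA -invfM exprMn [dl ^+ 4 * _]mulrC.
apply: le_trans (expR_decay _); last by rewrite mulr_gt0.
have [c1 c2] := chernoff t0 mn m1 m2 y0.
rewrite /tail; case: ltP => h.
  by apply: c1; rewrite /y ler_pdivlMr// mul1r lerD2l ler_pdivlMr// mul1r ltW.
by apply: c2; rewrite /y ler_pdivrMr// mul1r lerD2l ler_pdivrMr// mul1r.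
Qed.

Section PointwiseLimit.
Variables (t alpha s : R) (m : nat -> nat).
Hypotheses (t0 : 0 < t) (a0 : 0 < alpha) (s2 : s ^+ 2 = 1).
Hypothesis mn : forall n, (m n <= n)%N.
Hypothesis m1 : forall n, (m n)%:R <= alpha * n%:R.
Hypothesis m2 : forall n, alpha * n%:R < (m n).+1%:R.
Variables x y : R.
Hypotheses (xE : x = bx t) (yE : y = (1 + t)^-1).
Hypothesis xa : x != alpha.
Let x0 : 0 < x. Proof. by rewrite xE bx_gt0. Qed.
Let y0 : 0 < y. Proof. by rewrite yE invr_gt0 ltr_wpDl. Qed.
Let xt : x = t * y. Proof. by rewrite xE yE. Qed.
Let chi : R := (x < alpha)%R%:R.

(** Each truncated moment is within a power of n times the tail of its full
counterpart if x < alpha, and of 0 if x > alpha. The first one is small in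
both cases, since the full centred moment vanishes. *)
Lemma density_errors n : (0 < n)%N -> let e := tail n (m n) t alpha in
  [/\ `|Deltab n t (m n)| <= n%:R + 3 * (n%:R ^+ 4 * e),
      `|Db n t (m n) - chi * (a2b n t * bvar n t)| <= 3 * (n%:R ^+ 4 * e) &
      `|bb n t (m n) - chi| <= e].
Proof.
move=> n0 e.
have n1 : 1 <= n%:R :> R by rewrite ler1n.
have b0 := bb_ge0 n t0 (m n); have b1 := bb_le1 t0 (mn n).
have e0 : 0 <= e by rewrite /e /tail; case: ifP => _; rewrite ?subr_ge0.
have e1 : e <= 1 by rewrite /e /tail; case: ifP => _; rewrite ?lerBlDr ?lerDl.
have v1 := bvar_le n t0 xE yE.
have mu0 := bmu_ge0 n t0 xE.
have mu1 := bmu_le n t0 xE yE.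
have a2x := a2b_le t0 n0 xE yE.
have x1 : x <= 1 by rewrite xE ltW// bx_lt1.
set N : R := n%:R in n1 v1 mu1 a2x *.
set mu := bmu n t in mu0 mu1 *; set V := Vb n t (m n).
have N20 : 0 <= N ^+ 2 := sqr_ge0 _.
have a21 : a2b n t <= N ^+ 2 by apply: le_trans a2x _; rewrite -[leRHS]mulr1 ler_wpM2l.
have v0 : 0 <= bvar n t := le_trans (bc2_ge0 n t0 (m n)) (bc2_le t0 (mn n)).
have a20 : 0 <= a2b n t by rewrite /a2b addr_ge0// sqr_ge0.
have Vi : V^-1 <= 1 by rewrite invf_le1 /V /Vb ?lerDl// ltr_pwDl.
have Vi0 : 0 <= V^-1 by rewrite invr_ge0 /V /Vb addr_ge0.
have V0 : V != 0 by rewrite /V /Vb gt_eqF// ltr_pwDl.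
have divV (X Y : R) : `|X| <= Y -> `|X / V| <= Y.
  move=> h; apply: le_trans h; rewrite normrM (ger0_norm Vi0) -[leRHS]mulr1 ler_wpM2l//.
have dev (k : nat) : (k <= n)%N -> `|k%:R - mu| <= N.
  move=> kn; have k0 : 0 <= k%:R :> R by []. have k1 : k%:R <= N by rewrite ler_nat.
  by rewrite ler_norml; apply/andP; split; lra.
have low (f : nat -> R) (Y : R) : (forall k, (k <= n)%N -> `|f k| <= Y) -> `|\sum_(k < (m n).+1) f k * bp n t k| <= Y * bb n t (m n).
  move=> hf; apply: le_trans (ler_norm_sum _ _ _) _; rewrite /bb mulr_sumr; apply: ler_sum => k _.
  rewrite normrM (ger0_norm (bp_ge0 _ t0 _)) ler_wpM2r ?bp_ge0// hf//.
  by rewrite (leq_trans _ (mn n))// -ltnS.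
have high (f : nat -> R) (Y : R) : (forall k, (k <= n)%N -> `|f k| <= Y) -> `|\sum_((m n).+1 <= k < n.+1) f k * bp n t k| <= Y * (1 - bb n t (m n)).
  move=> hf; apply: le_trans (ler_norm_sum _ _ _) _; rewrite (bb_tail t0 (mn n)) mulr_sumr big_nat_cond [leRHS]big_nat_cond.
  apply: ler_sum => k /andP[/andP[_ kn] _].
  by rewrite normrM (ger0_norm (bp_ge0 _ t0 _)) mul1r ler_wpM2r ?bp_ge0// hf.
have dev2 (k : nat) : (k <= n)%N -> `|(k%:R - mu) ^+ 2| <= N ^+ 2.
  by move=> kn; rewrite normrX lerXn2r ?nnegrE// dev.
have sq2 (k : nat) : (k <= n)%N -> `|k%:R ^+ 2 : R| <= N ^+ 2.
  by move=> kn; rewrite normrX lerXn2r ?nnegrE// ger0_norm// ler_nat.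
have c1e : `|bc1 n t (m n)| <= N * e.
  rewrite /e /tail -xE; case: ifP => _; last exact: (low (fun k => k%:R - mu) N dev).
  by rewrite -normrN (bc1_tail t0 (mn n)); exact: (high (fun k => k%:R - mu) N dev).
have NeN : N * e <= N by rewrite -[leRHS]mulr1 ler_wpM2l.
have N2N4 : N ^+ 2 * e <= N ^+ 4 * e by rewrite ler_wpM2r// ler_weXn2l.
have c1sq : bc1 n t (m n) ^+ 2 <= N ^+ 2 * e.
  rewrite -real_normK ?num_real// expr2.
  by apply: (@le_trans _ _ (N * e * N)); [apply: ler_pM => //; exact: le_trans NeN|rewrite expr2; lra].
have D1 : `|Deltab n t (m n)| <= N + 3 * (N ^+ 4 * e).
  have p1 : `|2 * mu * bc1 n t (m n) / V| <= 2 * (N ^+ 2 * e).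
    have m20 : 0 <= 2 * mu by exact: mulr_ge0.
    apply: divV; rewrite normrM (ger0_norm m20) -mulrA ler_wpM2l// expr2 -mulrA.
    by apply: ler_pM.
  have p2 : `|bc1 n t (m n) ^+ 2 / V| <= N ^+ 2 * e by apply: divV; rewrite ger0_norm ?sqr_ge0.
  have p3 := bc2_ge0 n t0 (m n); have p4 := bc2_le t0 (mn n).
  have -> : Deltab n t (m n) = (bvar n t - bc2 n t (m n)) + (- (2 * mu * bc1 n t (m n) / V) + bc1 n t (m n) ^+ 2 / V).
    by rewrite /Deltab -/mu -/V; ring.
  apply: le_trans (ler_normD _ _) _; apply: lerD.
    by rewrite ger0_norm ?subr_ge0//; lra.
  apply: le_trans (ler_normD _ _) _; rewrite normrN; lra.
have N3 : N ^+ 2 * e * N <= N ^+ 4 * e.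
  by rewrite mulrAC ler_wpM2r// -exprSr ler_weXn2l.
have N4 : N ^+ 2 * (N ^+ 2 * e) = N ^+ 4 * e by rewrite mulrA -exprD.
split => //.
- rewrite /chi; have Dge := Db_ge0 t0 (mn n).
  have c2g := bc2_ge0 n t0 (m n); have c2l := bc2_le t0 (mn n).
  have b2g := b2b_ge0 n t0 (m n); have b2l := b2b_le t0 (mn n).
  have c1b := bc1_sqr n t0 (m n).
  move: c1sq; rewrite /e /tail -xE; case: ltP => hx; rewrite -/e.
    have ee : e = 1 - bb n t (m n) by rewrite /e /tail -xE hx.
    rewrite -ee => c1sq; rewrite mulr1n mul1r.
    have q1 : `|b2b n t (m n) - a2b n t| <= N ^+ 2 * e.
      by rewrite distrC (b2_tail t0 (mn n)) ee; exact: (high (fun k => k%:R ^+ 2) _ sq2).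
    have q2 : `|bc2 n t (m n) - bvar n t| <= N ^+ 2 * e.
      by rewrite distrC (bc2_tail t0 (mn n)) ee; exact: (high (fun k => (k%:R - mu) ^+ 2) _ dev2).
    have -> : Db n t (m n) - a2b n t * bvar n t = ((b2b n t (m n) - a2b n t) * bvar n t +
        a2b n t * ((bc2 n t (m n) - bvar n t) * bb n t (m n) - bc1 n t (m n) ^+ 2)) / V.
      apply: (mulIf V0); rewrite mulrBl /Db -/V !divfK//.
      by rewrite /V /Vb; ring.
    apply: divV; apply: le_trans (ler_normD _ _) _.
    have r1 : `|(b2b n t (m n) - a2b n t) * bvar n t| <= N ^+ 2 * e * N.
      by rewrite normrM (ger0_norm v0) ler_pM.
    have r2 : `|a2b n t * ((bc2 n t (m n) - bvar n t) * bb n t (m n) - bc1 n t (m n) ^+ 2)| <= N ^+ 2 * (2 * (N ^+ 2 * e)).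
      rewrite normrM (ger0_norm a20) ler_pM//.
      apply: le_trans (ler_normB _ _) _; rewrite mulr_natl mulr2n lerD//; last by rewrite ger0_norm ?sqr_ge0.
      by rewrite normrM (ger0_norm b0) -[leRHS]mulr1 ler_pM.
    rewrite mulrCA N4 in r2; lra.
  have ee : e = bb n t (m n) by rewrite /e /tail -xE ltNge hx.
  rewrite -ee => c1sq; rewrite mulr0n mul0r subr0 ger0_norm//.
  have q1 : b2b n t (m n) <= N ^+ 2 * e.
    by apply: le_trans (ler_norm _) _; rewrite b2bE ee; exact: (low (fun k => k%:R ^+ 2) _ sq2).
  have q2 : bc2 n t (m n) <= N ^+ 2 * e.
    by apply: le_trans (ler_norm _) _; rewrite ee; exact: (low (fun k => (k%:R - mu) ^+ 2) _ dev2).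
  apply: le_trans (ler_norm _) _; apply: divV.
  have r0 : 0 <= bc2 n t (m n) * bb n t (m n) - bc1 n t (m n) ^+ 2 by rewrite subr_ge0 mulrC.
  rewrite ger0_norm; last by apply: addr_ge0; exact: mulr_ge0.
  have r1 : b2b n t (m n) * bvar n t <= N ^+ 2 * e * N by apply: ler_pM.
  have r2 : a2b n t * (bc2 n t (m n) * bb n t (m n) - bc1 n t (m n) ^+ 2) <= N ^+ 2 * (N ^+ 2 * e).
    apply: ler_pM => //; apply: (@le_trans _ _ (bc2 n t (m n) * bb n t (m n))); first by rewrite lerBlDr lerDl sqr_ge0.
    by rewrite -[leRHS]mulr1 ler_pM.
  rewrite N4 in r2; have : 0 <= N ^+ 4 * e by rewrite mulr_ge0// exprn_ge0.
  lra.
- rewrite /chi /e /tail -xE; case: ltP => hx; last by rewrite mulr0n subr0 ger0_norm.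
  by rewrite mulr1n distrC ger0_norm// subr_ge0.
Qed.

Let e4 : exists2 K : R, 0 <= K & forall n, (0 < n)%N -> n%:R ^+ 4 * tail n (m n) t alpha <= K.
Proof.
have xa' : bx t != alpha by rewrite -xE.
by have [K K0 hK] := tail_decay t0 a0 xa'; exists K => // n n0; rewrite mulrC; exact: hK.
Qed.

(** At the scale n^(3/2) the difference [Deltab] vanishes, D / n^3 tends to
chi x^3 y and V to 1 + chi; [cvg_posdiff_mean] concludes, whatever the sign s.
*)
Lemma zero_density_limit : (fun n => zero_density s n (m n) t / n32 n) @ \oo --> (if x < alpha then Num.sqrt t / (4 * (1 + t) ^+ 2) else 0).
Proof.
have [K K0 hK] := e4.
pose h n : R := n.+1%:R^-1.
have h0 n : 0 <= h n by rewrite /h invr_ge0.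
have ch : h @ \oo --> (0 : R) by exact: cvg_harmonic.
have csh : (fun n => Num.sqrt (h n)) @ \oo --> (0 : R).
  by rewrite -[X in _ --> X]sqrtr0; exact: (cvg_comp _ _ ch (@sqrt_continuous R 0)).
rewrite -(cvg_shiftS (fun n => zero_density s n (m n) t / n32 n)).
have ns : `|s| = 1 by apply/eqP; rewrite -sqrp_eq1// -normrX s2 normr1.
pose u n := s * Deltab n.+1 t (m n.+1) / n32 n.+1.
pose v n := Db n.+1 t (m n.+1) / n.+1%:R ^+ 3.
pose V n := Vb n.+1 t (m n.+1).
have n32p n : 0 < n32 n.+1 by exact: n32_gt0.
have E n : zero_density s n.+1 (m n.+1) t / n32 n.+1 = posdiff_mean (u n) (v n) / (V n * t).
  rewrite (zero_density_binomial n.+1 t0).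
  have -> : s * Deltab n.+1 t (m n.+1) = n32 n.+1 * u n by rewrite /u mulrCA divff ?mulr1// gt_eqF.
  have -> : Db n.+1 t (m n.+1) = n32 n.+1 ^+ 2 * v n.
    by rewrite n32_sqr /v mulrCA divff ?mulr1// expf_neq0.
  by rewrite posdiff_mean_scale// -/(V n) mulrAC [n32 _ * _]mulrC mulfK// gt_eqF.
under eq_fun do rewrite E.
have cu : u @ \oo --> (0 : R).
  apply/cvgr0Pnorm_le => eps eps0.
  near=> n.
  have [d1 _ _] := density_errors (ltn0Sn n).
  have n1 : 1 <= n.+1%:R :> R by rewrite ler1n.
  have b1 : `|Deltab n.+1 t (m n.+1)| <= n.+1%:R * (1 + 3 * K).
    apply: le_trans d1 _; rewrite mulrDr mulr1 lerD2l.
    apply: (@le_trans _ _ (3 * K)); first by rewrite ler_wpM2l// hK.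
    by rewrite -[leLHS]mul1r ler_wpM2r// mulr_ge0.
  rewrite /u normrM normrM ns mul1r normfV (gtr0_norm (n32p n)).
  apply: (@le_trans _ _ (Num.sqrt (h n) * (1 + 3 * K))).
    rewrite ler_pdivrMr//; apply: le_trans b1 _.
    rewrite /n32 /h mulrCA mulrA -[leLHS]mulr1.
    have -> : n.+1%:R * (Num.sqrt n.+1%:R^-1 * (1 + 3 * K)) * Num.sqrt n.+1%:R = n.+1%:R * (1 + 3 * K) * (Num.sqrt n.+1%:R^-1 * Num.sqrt n.+1%:R) by ring.
    by rewrite -sqrtrM ?invr_ge0// mulVf ?sqrtr1.
  rewrite -ler_pdivlMr; last by rewrite ltr_pwDl// mulr_ge0.
  near: n; apply: (cvgr_le 0 csh); rewrite divr_gt0// ltr_pwDl// mulr_ge0//.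
have cv : v @ \oo --> chi * (x ^+ 3 * y).
  have A : (fun n => chi * (a2b n.+1 t * bvar n.+1 t) / n.+1%:R ^+ 3) @ \oo --> chi * (x ^+ 3 * y).
    have EA n : chi * (a2b n.+1 t * bvar n.+1 t) / n.+1%:R ^+ 3 = chi * ((x ^+ 2 + x * y * h n) * (x * y)).
      have vE : bvar n.+1 t = n.+1%:R * x * y by rewrite /bvar bx1// -xE -yE.
      have nn : n.+1%:R != 0 :> R by rewrite pnatr_eq0.
      by rewrite /a2b vE /bmu -xE /h; move: (n.+1%:R) nn => M nn; field; exact: nn.
    under eq_fun do rewrite EA.
    have -> : x ^+ 3 * y = (x ^+ 2 + x * y * 0) * (x * y) by ring.
    apply: cvgM; first exact: cvg_cst.
    apply: cvgM; last exact: cvg_cst.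
    by apply: cvgD; [exact: cvg_cst|apply: cvgM; [exact: cvg_cst|exact: ch]].
  have B : (fun n => v n - chi * (a2b n.+1 t * bvar n.+1 t) / n.+1%:R ^+ 3) @ \oo --> (0 : R).
    apply/cvgr0Pnorm_le => eps eps0; near=> n.
    have [_ d2 _] := density_errors (ltn0Sn n).
    have n1 : 1 <= n.+1%:R :> R by rewrite ler1n.
    have n3 : 0 < n.+1%:R ^+ 3 :> R by rewrite exprn_gt0.
    rewrite /v -mulrBl normrM normfV (gtr0_norm n3).
    apply: (@le_trans _ _ (3 * K * h n)).
      apply: ler_pM => //; first by apply: le_trans d2 _; rewrite ler_wpM2l// hK.
      by rewrite /h lef_pV2 ?posrE// -[leLHS]expr1 ler_weXn2l.
    rewrite mulrC; apply: (@le_trans _ _ (h n * (3 * K + 1))); first by apply: ler_wpM2l; [exact: h0|rewrite lerDl].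
    rewrite -ler_pdivlMr; last by rewrite ltr_wpDl// mulr_ge0.
    near: n; apply: (cvgr_le 0 ch); rewrite divr_gt0// ltr_wpDl// mulr_ge0//.
  rewrite -[X in _ --> X]addr0.
  have -> : v = (fun n => chi * (a2b n.+1 t * bvar n.+1 t) / n.+1%:R ^+ 3 + (v n - chi * (a2b n.+1 t * bvar n.+1 t) / n.+1%:R ^+ 3)).
    by apply/funext => n; rewrite addrC subrK.
  exact: cvgD.
have cV : V @ \oo --> 1 + chi.
  apply: cvgD; first exact: cvg_cst.
  rewrite -[X in _ --> X]addr0.
  rewrite (_ : (fun n => bb _ _ _) = (fun n => chi + (bb n.+1 t (m n.+1) - chi))); last first.
    by apply/funext => n; rewrite addrC subrK.
  apply: cvgD; first exact: cvg_cst.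
  apply/cvgr0Pnorm_le => eps eps0; near=> n.
  have [_ _ d3] := density_errors (ltn0Sn n).
  have n1 : 1 <= n.+1%:R :> R by rewrite ler1n.
  apply: le_trans d3 _; have := hK n.+1 (ltn0Sn n); rewrite mulrC -ler_pdivlMr// => hk.
  apply: le_trans hk _; apply: (@le_trans _ _ (K * h n)).
    by rewrite ler_wpM2l// /h lef_pV2 ?posrE// -[leLHS]expr1 ler_weXn2l.
  rewrite mulrC; apply: (@le_trans _ _ (h n * (K + 1))); first by apply: ler_wpM2l; [exact: h0|rewrite lerDl].
  rewrite -ler_pdivlMr; last by rewrite ltr_wpDl.
  by near: n; apply: (cvgr_le 0 ch); rewrite divr_gt0// ltr_wpDl.
have D0 : 0 <= chi * (x ^+ 3 * y) by rewrite !mulr_ge0// ?exprn_ge0 ?(ltW x0) ?(ltW y0).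
have v0 n : 0 <= v n by rewrite /v divr_ge0 ?exprn_ge0// Db_ge0.
have Vt0 : (1 + chi) * t != 0 by rewrite gt_eqF// mulr_gt0// ltr_pwDl.
have -> : (if x < alpha then Num.sqrt t / (4 * (1 + t) ^+ 2) else 0) = Num.sqrt (chi * (x ^+ 3 * y)) / 2 / ((1 + chi) * t).
  rewrite /chi; case: ifP => _; last by rewrite mulr0n mul0r sqrtr0 !mul0r.
  rewrite mulr1n mul1r.
  have -> : x ^+ 3 * y = (t * y ^+ 2) ^+ 2 * t by rewrite xt; ring.
  rewrite sqrtrM ?sqr_ge0// sqrtr_sqr ger0_norm; last by rewrite mulr_ge0 ?sqr_ge0// ltW.
  by rewrite yE; field; rewrite !gt_eqF// ltr_wpDl.
apply: cvgM; first exact: cvg_posdiff_mean.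
apply: cvgV => //; apply: cvgM; [exact: cV|exact: cvg_cst].
Unshelve. all: by end_near. Qed.

End PointwiseLimit.

End DensityBounds.

(** * The limiting density and its integral *)

Section LimitIntegral.
Context {R : realType}.
Notation mu := (@lebesgue_measure R).

Let is_derive_1D (t : R) : is_derive t 1 (fun t : R => 1 + t) 1.
Proof.
rewrite (_ : (fun t : R => 1 + t) = cst 1 + id); last by [].
by apply: is_derive_eq; rewrite add0r.
Qed.

Let continuous_1D : continuous (fun t : R => 1 + t).
Proof. by move=> t; apply: cvgD; [exact: cvg_cst|]. Qed.

Let continuous_inv1D (t : R) : 0 <= t -> {for t, continuous (fun t : R => (1 + t)^-1)}.
Proof.
move=> t0; apply: cvgV; first by rewrite gt_eqF// ltr_pwDl.
exact: continuous_1D.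
Qed.

Let is_derive_inv1D (t : R) : 0 < 1 + t ->
  is_derive t 1 (fun t : R => (1 + t)^-1) (- (1 + t) ^- 2 *: 1).
Proof.
move=> t0; have t1 : 1 + t != 0 by rewrite gt_eqF.
exact: (@is_deriveV R (fun t : R => 1 + t) t 1 1 t1 (is_derive_1D t)).
Qed.

(** The power (1 + t)^(-3/2), which dominates the rescaled densities. *)
Definition envelope (t : R) : R := (1 + t)^-1 * Num.sqrt (1 + t)^-1.

Lemma continuous_envelope (t : R) : 0 <= t -> {for t, continuous envelope}.
Proof.
move=> t0; apply: cvgM; first exact: continuous_inv1D.
apply: (@continuous_comp _ _ _ (fun t : R => (1 + t)^-1) Num.sqrt); first exact: continuous_inv1D.
exact: sqrt_continuous.
Qed.

Lemma envelope_integral : (\int[mu]_(t in `[0%R, +oo[) (envelope t)%:E < +oo)%E.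
Proof.
pose F (t : R) : R := - (2 * Num.sqrt (1 + t)^-1).
have cs (t : R) : 0 <= t -> {for t, continuous (fun t : R => Num.sqrt (1 + t)^-1)}.
  move=> t0; apply: (@continuous_comp _ _ _ (fun t : R => (1 + t)^-1) Num.sqrt); first exact: continuous_inv1D.
  exact: sqrt_continuous.
have dF (t : R) : 0 < t -> is_derive t 1 F (envelope t).
  move=> t0; have t1 : 0 < 1 + t by rewrite ltr_wpDl.
  have u0 : 0 < (1 + t)^-1 by rewrite invr_gt0.
  have D1 : is_derive t 1 (fun t : R => (1 + t)^-1) (- (1 + t) ^- 2 *: 1).
    exact: is_derive_inv1D.
  have D2 : is_derive t 1 (Num.sqrt \o (fun t : R => (1 + t)^-1)) ((2 * Num.sqrt (1 + t)^-1)^-1 * (- (1 + t) ^- 2 *: 1)).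
    by apply: is_derive1_comp; exact: is_derive1_sqrt.
  rewrite (_ : F = - (cst 2 * (Num.sqrt \o (fun t : R => (1 + t)^-1)))); last by [].
  apply: is_derive_eq; rewrite /envelope /= scaler0 addr0 /GRing.scale/= mulr1.
  have s0 : Num.sqrt (1 + t)^-1 != 0 by rewrite gt_eqF// sqrtr_gt0.
  have s2 : Num.sqrt (1 + t)^-1 ^+ 2 = (1 + t)^-1 by rewrite sqr_sqrtr// ltW.
  rewrite -exprVn; move: (Num.sqrt _) s0 s2 => u s0 <-.
  by field.
rewrite (@ge0_continuous_FTC2y R envelope F 0 0).
- by rewrite -EFinB ltry.
- by move=> t t0; rewrite /envelope mulr_ge0 ?sqrtr_ge0// invr_ge0 addr_ge0.
- apply: continuous_in_subspaceT => t; rewrite inE/= in_itv/= andbT => t0.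
  exact: continuous_envelope.
- rewrite -oppr0 -[X in - X](mulr0 2); apply: cvgN; apply: cvgM; first exact: cvg_cst.
  rewrite -[X in _ --> X](@sqrtr0 R).
  have c : (1 + t)^-1 @[t --> +oo] --> (0 : R).
    apply/gtr0_cvgV0.
      by near=> t; rewrite ltr_pwDl//; near: t; exact: nbhs_pinfty_ge.
    apply/cvgryPge => A; near=> t.
    by apply: (@le_trans _ _ t); [near: t; apply: nbhs_pinfty_ge; rewrite num_real|rewrite lerDr].
  exact: (cvg_comp _ _ c (@sqrt_continuous R 0)).
- by move=> t t0; have [] := dF t t0.
- apply: cvg_at_right_filter; apply: cvgN; apply: cvgM; first exact: cvg_cst.
  exact: cs.
- by move=> t; rewrite in_itv/= andbT => t0; have := dF t t0 => D; rewrite derive1E derive_val.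
Unshelve. all: by end_near. Qed.

Definition profile (t : R) : R := Num.sqrt t / (4 * (1 + t) ^+ 2).
Definition primitive (t : R) : R := (atan (Num.sqrt t) - Num.sqrt t * (1 + t)^-1) / 4.

Lemma is_derive_primitive (t : R) : 0 < t -> is_derive t 1 primitive (profile t).
Proof.
move=> t0; have t1 : 0 < 1 + t by rewrite ltr_wpDl.
have D0 : is_derive t 1 Num.sqrt (2 * Num.sqrt t)^-1 by exact: is_derive1_sqrt.
have D1 : is_derive t 1 (fun t : R => (1 + t)^-1) (- (1 + t) ^- 2 *: 1).
  exact: is_derive_inv1D.
have D2 : is_derive t 1 (atan \o Num.sqrt) ((1 + Num.sqrt t ^+ 2)^-1 * (2 * Num.sqrt t)^-1).
  by apply: is_derive1_comp; exact: is_derive1_atan.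
have D3 := is_deriveM D0 D1.
have D4 := is_deriveB D2 D3.
have D5 := is_deriveM D4 (is_derive_cst (4^-1 : R) t (1 : R)).
rewrite (_ : primitive = ((atan \o Num.sqrt) - Num.sqrt * (fun t : R => (1 + t)^-1)) * cst 4^-1); last by [].
apply: (is_derive_eq D5); rewrite /profile /= scaler0 add0r /GRing.scale/= mulr1.
have s0 : Num.sqrt t != 0 by rewrite gt_eqF// sqrtr_gt0.
have s2 : t = Num.sqrt t ^+ 2 by rewrite sqr_sqrtr// ltW.
have t1n : 1 + Num.sqrt t ^+ 2 != 0 by rewrite -s2 gt_eqF.
rewrite [in 1 + t]s2; move: (Num.sqrt t) s0 t1n => u u0 u1.
by field; rewrite u0 u1.
Qed.

Lemma continuous_primitive (t : R) : 0 <= t -> {for t, continuous primitive}.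
Proof.
move=> t0; apply: cvgM; last exact: cvg_cst.
apply: cvgB.
  by apply: (@continuous_comp _ _ _ Num.sqrt atan); [exact: sqrt_continuous|exact: continuous_atan].
by apply: cvgM; [exact: sqrt_continuous|exact: continuous_inv1D].
Qed.

Lemma continuous_profile (t : R) : 0 <= t -> {for t, continuous profile}.
Proof.
move=> t0; apply: cvgM; first exact: sqrt_continuous.
apply: cvgV; first by rewrite mulf_neq0// expf_neq0// gt_eqF// ltr_pwDl.
by apply: cvgM; [exact: cvg_cst|apply: cvgM; exact: continuous_1D].
Qed.

Let primitive0 : primitive 0 = 0.
Proof. by rewrite /primitive sqrtr0 atan0 mul0r subr0 mul0r. Qed.

Variable alpha : R.
Hypothesis ha : 0 < alpha < 1.
Let a0 : 0 < alpha. Proof. by case/andP: ha. Qed.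
Let a1 : 0 < 1 - alpha. Proof. by case/andP: ha => _; rewrite subr_gt0. Qed.
(** The value of t for which t / (1 + t) = alpha. *)
Definition threshold : R := alpha / (1 - alpha).
Lemma threshold_gt0 : 0 < threshold. Proof. by rewrite divr_gt0. Qed.

Lemma primitive_threshold : primitive threshold = c_alpha alpha / 2.
Proof.
have T0 := threshold_gt0.
rewrite /primitive /c_alpha -/threshold.
have -> : Num.sqrt threshold * (1 + threshold)^-1 = Num.sqrt (alpha * (1 - alpha)).
  have E : 1 + threshold = (1 - alpha)^-1 by rewrite /threshold; field; rewrite gt_eqF.
  rewrite E invrK (_ : alpha * (1 - alpha) = threshold * (1 - alpha) ^+ 2).
    by rewrite [RHS]sqrtrM ?(ltW T0)// sqrtr_sqr gtr0_norm.
  by rewrite /threshold; field; rewrite gt_eqF.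
by field.
Qed.

Lemma profile_integral :
  (\int[mu]_(t in `[0%R, threshold]) (profile t)%:E = (c_alpha alpha / 2)%:E)%E.
Proof.
have T0 := threshold_gt0.
rewrite (@continuous_FTC2 R profile primitive)//.
- by rewrite primitive0 sube0 primitive_threshold.
- apply: continuous_in_subspaceT => t; rewrite inE/= in_itv/= => /andP[t0 _].
  exact: continuous_profile.
- split.
  + by move=> t; rewrite in_itv/= => /andP[t0 _]; have [] := is_derive_primitive t0.
  + by apply: cvg_at_right_filter; exact: continuous_primitive.
  + by apply: cvg_at_left_filter; apply: continuous_primitive; exact: ltW.
- move=> t; rewrite in_itv/= => /andP[t0 _]; have D := is_derive_primitive t0.
  by rewrite derive1E derive_val.
Qed.

(** By the mean value theorem, since the primitive vanishes at 0 and has a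
positive derivative. *)
Lemma c_alpha_gt0 : 0 < c_alpha alpha.
Proof.
have T0 := threshold_gt0.
have cP : {within `[0, threshold], continuous primitive}.
  apply: continuous_in_subspaceT => t; rewrite inE/= in_itv/= => /andP[t0 _].
  exact: continuous_primitive.
have dP t : t \in `]0, threshold[ -> is_derive t 1 primitive (profile t).
  by rewrite in_itv/= => /andP[t0 _]; exact: is_derive_primitive.
have [c] := MVT T0 dP cP.
rewrite in_itv/= primitive0 primitive_threshold !subr0 => /andP[c0 _] E.
have : 0 < c_alpha alpha / 2.
  rewrite E; apply: mulr_gt0 => //; rewrite /profile divr_gt0 ?sqrtr_gt0//.
  by rewrite mulr_gt0// exprn_gt0// ltr_wpDl.
by rewrite pmulr_lgt0.
Qed.
End LimitIntegral.

(** * Convergence of the rescaled expectation *)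

Section ScaledLimit.
Context {R : realType}.
Notation mu := (@lebesgue_measure R).
Notation MR := (measurableTypeR R).

Variables (alpha s : R) (m : nat -> nat).
Hypothesis ha : 0 < alpha < 1.
Hypothesis s2 : s ^+ 2 = 1.
Hypothesis mn : forall n, (m n <= n)%N.
Hypothesis m1 : forall n, (m n)%:R <= alpha * n%:R.
Hypothesis m2 : forall n, alpha * n%:R < (m n).+1%:R.
Let a0 : 0 < alpha. Proof. by case/andP: ha. Qed.
Let a1 : 0 < 1 - alpha. Proof. by case/andP: ha => _; rewrite subr_gt0. Qed.
Let T := threshold alpha.
Let T0 : 0 < T. Proof. exact: threshold_gt0. Qed.

Lemma bx_lt_alpha (t : R) : 0 < t -> (bx t < alpha) = (t < T).
Proof.
move=> t0; have t1 : 0 < 1 + t by rewrite ltr_wpDl.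
rewrite /bx ltr_pdivrMr// /T /threshold ltr_pdivlMr//.
by apply/idP/idP; lra.
Qed.

Lemma bx_neq_alpha (t : R) : 0 < t -> t != T -> bx t != alpha.
Proof.
move=> t0; have t1 : 0 < 1 + t by rewrite ltr_wpDl.
apply: contraNN => /eqP E; apply/eqP; rewrite /T /threshold -E /bx.
by field; rewrite (gt_eqF t1) /= addrK oner_neq0.
Qed.

(** The model is only defined for m > 0, hence for n >= 1 / alpha. *)
Lemma truncation_gt0 : exists n0, forall n, (n0 <= n)%N -> (0 < m n)%N.
Proof.
exists (Num.truncn alpha^-1).+1 => n hn.
have : (1 : R) < (m n).+1%:R.
  apply: le_lt_trans (m2 n); rewrite -ler_pdivrMl// mulr1.
  apply: ltW; apply: (@lt_le_trans _ _ (Num.truncn alpha^-1).+1%:R); last by rewrite ler_nat.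
  by apply: truncnS_gt; rewrite num_real.
by rewrite ltr1n.
Qed.

Let D : set MR := `]0, +oo[ `\ T.
Let mD : measurable D.
Proof. by apply: measurableD => //; exact: measurable_itv. Qed.

Lemma integrable_envelope : mu.-integrable D (fun t => (7 * envelope t)%:E).
Proof.
have e0 (t : R) : 0 <= t -> 0 <= envelope t.
  by move=> t0; rewrite /envelope mulr_ge0 ?sqrtr_ge0// invr_ge0 addr_ge0.
apply: (@integrableS _ _ _ mu `[0, +oo[ D) => //.
  by move=> t [/=]; rewrite !in_itv/= !andbT => /ltW.
have mE : measurable_fun (`[0, +oo[ : set MR) (fun t => (envelope t)%:E).
  apply/measurable_EFinP; apply: subspace_continuous_measurable_fun; first exact: measurable_itv.
  apply: continuous_in_subspaceT => t; rewrite inE/= in_itv/= andbT => t0.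
  exact: continuous_envelope.
apply/integrableP; split.
  apply/measurable_EFinP; apply: measurable_funM => //; exact/measurable_EFinP.
under eq_integral => t /[!inE]/= /[!in_itv]/= /[!andbT] t0.
  rewrite ger0_norm; last by rewrite mulr_ge0// e0.
  rewrite EFinM; over.
rewrite ge0_integralZl//; last first.
  by move=> t /=; rewrite in_itv/= andbT lee_fin => /e0.
by rewrite lte_mul_pinfty// envelope_integral.
Qed.

Let f (t : R) : \bar R := (if t < T then profile t else 0)%:E.

Lemma integral_truncated_profile : (\int[mu]_(t in D) f t = (c_alpha alpha / 2)%:E)%E.
Proof.
rewrite -(profile_integral ha) -[threshold alpha]/T.
have mp : measurable_fun (`]0, T[ : set MR) (fun t => (profile t)%:E).
  apply/measurable_EFinP; apply: subspace_continuous_measurable_fun; first exact: measurable_itv.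
  apply: continuous_in_subspaceT => t; rewrite inE/= in_itv/= => /andP[/ltW t0 _].
  exact: continuous_profile.
rewrite [RHS]integral_itv_bndoo// integral_mkcond [RHS]integral_mkcond.
apply: eq_integral => t _; rewrite /patch; case: ifPn => [|nD].
  rewrite inE => -[/=]; rewrite in_itv/= andbT => t0 _.
  rewrite /f mem_setE in_itv/= t0/=; case: ifPn => // _.
rewrite mem_setE in_itv/=; case: ifPn => // /andP[t0 tT].
move: nD; rewrite notin_setE => -[]; split; first by rewrite /= in_itv/= t0.
by move=> /= E; rewrite E ltxx in tT.
Qed.

Hypothesis meas : forall n, (0 < m n)%N ->
  measurable_fun (`]0, +oo[ : set MR) (fun t => (zero_density s n (m n) t)%:E).

(** Dominated convergence off the threshold, where the densities need not
converge, for the indices from [truncation_gt0] on. *)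
Lemma scaled_limit :
  (\int[mu]_(t in `]0%R, +oo[) (zero_density s n (m n) t)%:E * ((n32 n)^-1)%:E)%E @[n --> \oo]
    --> (c_alpha alpha / 2)%:E.
Proof.
have [n0 hn0] := truncation_gt0.
have m0 k : (0 < m (k + n0))%N by apply: hn0; rewrite leq_addl.
have k0 k : (0 < k + n0)%N by exact: leq_trans (m0 k) (mn _).
have mf k : measurable_fun D (fun t => (zero_density s (k + n0) (m (k + n0)) t / n32 (k + n0))%:E).
  apply/measurable_EFinP; apply: measurable_funM => //; apply/measurable_EFinP.
  by apply: measurable_funS (meas (m0 k)) => // t [].
rewrite -(cvg_shiftn n0).
have := @dominated_cvg _ MR R mu D mD
  (fun k t => (zero_density s (k + n0) (m (k + n0)) t / n32 (k + n0))%:E) f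
  (fun t => (7 * envelope t)%:E) mf.
rewrite integral_truncated_profile => H.
apply: cvg_trans (H _ _ _ _).
- apply: near_eq_cvg; apply: nearW => k /=.
  rewrite -ge0_integralZr//; last 3 first.
  - exact: meas.
  - by move=> t; rewrite /= in_itv/= andbT => t0; rewrite lee_fin zero_density_ge0.
  - by rewrite lee_fin invr_ge0 ltW// n32_gt0.
  rewrite -[RHS](@integral_setD1 R _ T)//; last first.
    by apply: emeasurable_funM => //; apply: measurable_funS (meas (m0 k)) => // t [].
- move=> t [/=]; rewrite in_itv/= andbT => t0 /eqP tT.
  apply: cvg_EFin; first exact: nearW.
  have := zero_density_limit t0 a0 s2 mn m1 m2 erefl erefl (bx_neq_alpha t0 tT).
  rewrite bx_lt_alpha// -(cvg_shiftn n0).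
  exact.
- by move=> t _.
- exact: integrable_envelope.
- move=> k t [/=]; rewrite in_itv/= andbT => t0 _.
  rewrite lee_fin ger0_norm; last by rewrite divr_ge0 ?zero_density_ge0// ltW// n32_gt0.
  rewrite ler_pdivrMr ?n32_gt0// mulrAC.
  exact: (zero_density_bound t0 (k0 k) (mn _) s2 erefl erefl).
Qed.
End ScaledLimit.

(** * Asymptotic equivalence *)

Section Quotient.
Context {R : realType}.

(** A finite nonzero limit of the rescaled sequences forces both sequences to
be finite, and v to be nonzero, from some index on; the quotient is then one
of real numbers. *)
Lemma cvg_quotient (u v : nat -> \bar R) (c : nat -> R) (l : R) :
  (\forall n \near \oo, 0 < c n) -> l != 0 ->
  (u n * (c n)%:E)%E @[n --> \oo] --> l%:E ->
  (v n * (c n)%:E)%E @[n --> \oo] --> l%:E ->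
  (u n / v n)%E @[n --> \oo] --> 1%E.
Proof.
move=> c0 l0 /fine_cvgP[uf ul] /fine_cvgP[vf vl].
have H : fine (u n * (c n)%:E)%E / fine (v n * (c n)%:E)%E @[n --> \oo] --> (1 : R).
  by rewrite -(divff l0); apply: cvgM => //; exact: cvgV.
have HE : (fine (u n * (c n)%:E)%E / fine (v n * (c n)%:E)%E)%:E @[n --> \oo] --> 1%E.
  by apply: cvg_EFin; [exact: nearW|exact: H].
have vne : \forall n \near \oo, fine (v n * (c n)%:E)%E != 0.
  exact: (cvgr_neq0 l vl l0).
apply: cvg_trans HE.
apply: near_eq_cvg; near=> n.
have cn : 0 < c n by near: n.
have un : (u n * (c n)%:E)%E \is a fin_num by near: n.
have vn : (v n * (c n)%:E)%E \is a fin_num by near: n.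
have g0 : fine (v n * (c n)%:E) != 0 by near: n.
have fin (x : \bar R) : (x * (c n)%:E)%E \is a fin_num -> exists r, x = r%:E.
  case: x => [r _|/=|/=]; first by exists r.
  - by rewrite gt0_mulye.
  - by rewrite gt0_mulNye.
have [U UE] := fin _ un; have [V VE] := fin _ vn.
move: g0; rewrite UE VE /= => g0.
have V0 : V != 0 by apply: contraNN g0 => /eqP ->; rewrite mul0r.
rewrite inver (negPf V0) -EFinM; congr (_%:E).
by field; rewrite V0 gt_eqF.
Unshelve. all: by end_near. Qed.

Lemma powR_n32 (n : nat) : n%:R `^ (3 / 2) = n32 n :> R.
Proof.
have [->|n0] := posnP n; first by rewrite powR0 ?mulf_neq0 ?invr_eq0// /n32 mul0r.
have -> : 3 / 2 = 1 + 2^-1 :> R by field.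
by rewrite powRD ?pnatr_eq0 ?gt_eqF ?implybT// powRr1// powR12_sqrt.
Qed.
End Quotient.

Theorem corollary2 (R : realType) (alpha : R) (halpha : 0 < alpha < 1)
    (m : nat -> nat) (hm : forall n, (m n)%:Z = Num.floor (alpha * n%:R))
    (d : nat -> measure_display) (T : forall n, measurableType (d n))
    (P : forall n, probability (T n) R)
    (a b : forall n, nat -> T n -> R[i])
    (hmodel : forall n, (0 < m n)%N ->
      truncated_model (P n) n (m n) (a n) (b n)) :
  let F n (w : T n) := random_harmonic n (m n) (a n) (b n) w in
  let EN_plus n := (\int[P n]_w num_zeros_preserving (F n w))%E in
  let EN_minus n := (\int[P n]_w num_zeros_reversing (F n w))%E in
  asymp_equiv EN_plus EN_minus /\
  asymp_equiv EN_minus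
    (fun n => (c_alpha alpha / 2 * n%:R `^ (3 / 2))%:E).
Proof.
move=> F EN_plus EN_minus.
have [a0 a1] := andP halpha.
have m1 n : (m n)%:R <= alpha * n%:R.
  by have := ge_floor (alpha * n%:R); rewrite -hm.
have m2 n : alpha * n%:R < (m n).+1%:R.
  have := floorD1_gt (alpha * n%:R); rewrite -hm intrD -natr1; exact.
have mn n : (m n <= n)%N.
  rewrite -(ler_nat R); apply: le_trans (m1 n) _.
  by rewrite ler_piMl// ltW.
have [n0 hn0] := truncation_gt0 halpha m2.
have c0 : c_alpha alpha / 2 != 0 :> R by rewrite gt_eqF// divr_gt0// c_alpha_gt0.
have w0 : \forall n \near \oo, 0 < (n32 n)^-1 :> R.
  by near=> n; rewrite invr_gt0 n32_gt0//; near: n; exact: nbhs_infty_gt.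
have L (s : R) : s ^+ 2 = 1 ->
    (\int[P n]_w counting (zeros_of n (m n) (a n) (b n) s w) * ((n32 n)^-1)%:E)%E @[n --> \oo]
      --> (c_alpha alpha / 2)%:E.
  move=> s2.
  have H := scaled_limit halpha s2 mn m1 m2 (fun n mp => measurable_zero_density (hmodel n mp) s2).
  apply: cvg_trans H; apply: near_eq_cvg; near=> n.
  rewrite expected_zeros//; apply: hmodel; apply: hn0; near: n; exact: nbhs_infty_ge.
have Lp : (EN_plus n * ((n32 n)^-1)%:E)%E @[n --> \oo] --> (c_alpha alpha / 2)%:E.
  rewrite (_ : EN_plus = fun n => \int[P n]_w counting (zeros_of n (m n) (a n) (b n) 1 w))%E.
    by apply: L; rewrite expr1n.
  apply/funext => n; apply: eq_integral => w _.
  rewrite /num_zeros_preserving /zeros_of; congr counting.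
  by apply/seteqP; split => z /=; rewrite mul1r.
have Lm : (EN_minus n * ((n32 n)^-1)%:E)%E @[n --> \oo] --> (c_alpha alpha / 2)%:E.
  rewrite (_ : EN_minus = fun n => \int[P n]_w counting (zeros_of n (m n) (a n) (b n) (-1) w))%E.
    by apply: L; rewrite sqrrN expr1n.
  apply/funext => n; apply: eq_integral => w _.
  rewrite /num_zeros_reversing /zeros_of; congr counting.
  by apply/seteqP; split => z /=; rewrite mulN1r oppr_gt0.
split; first exact: cvg_quotient w0 c0 Lp Lm.
apply: cvg_quotient w0 c0 Lm _.
apply: cvg_near_cst; near=> n.
rewrite powR_n32 -EFinM; congr (_%:E); rewrite mulfK// gt_eqF// n32_gt0//.
near: n; exact: nbhs_infty_gt.
Unshelve. all: by end_near. Qed.
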